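(* Fix $p>4$. There exists $\varepsilon>0$ such that, if $J_c-\varepsilon<J<J_c$, then every optimal periodic striped configuration is an infinite volume ground state of the model, and its sector is trivial (i.e. no other infinite volume ground state differs from it on only a finite set of sites).
   Context: Work on $\mathbb Z^2$ with $p>4$ and a coupling $J>0$. For $\underline\sigma\in\{\pm1\}^{\mathbb Z^2}$ the formal Hamiltonian is $H(\underline\sigma)=-J\sum_{\langle x,y\rangle}(\sigma_x\sigma_y-1)+\sum_{\{x,y\}}\frac{\sigma_x\sigma_y-1}{|x-y|^p}$, where the first sum is over nearest-neighbour pairs and the second over unordered pairs of distinct sites. For a finite $X\subset\mathbb Z^2$, $\underline\sigma_X\in\{\pm1\}^X$ and $\underline s\in\{\pm1\}^{\mathbb Z^2}$, set $H_X(\underline\sigma_X|\underline s)=-J\sum_{\langle x,y\rangle,\,x,y\in X}(\sigma_x\sigma_y-1)+\sum_{\{x,y\}\subset X}\frac{\sigma_x\sigma_y-1}{|x-y|^p}-J\sum_{x\in X,y\in X^c,|x-y|=1}(\sigma_xs_y-1)+\sum_{x\in X,y\in X^c}\frac{\sigma_xs_y-1}{|x-y|^p}$. A configuration $\underline s$ is an infinite volume ground state if $H_X(\underline\sigma_X|\underline s)-H_X(\underline s_X|\underline s)\ge0$ for every finite $X$ and every $\underline\sigma_X\in\{\pm1\}^X$ ($\underline s_X$ is the restriction of $\underline s$ to $X$). Two infinite volume ground states are equivalent if they differ only on a finite set; the equivalence class of a ground state is its sector, which is trivial if it has one element. Let $J_c=\sum_{y_1>0,\,y_2\in\mathbb Z}\frac{y_1}{(y_1^2+y_2^2)^{p/2}}$.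 For $h\in\mathbb N$ let $\underline\sigma^{(h)}$ be given by $\sigma^{(h)}_x=\mathrm{sign}(\sin(\pi(x_1+1/2)/h))$ (vertical stripes of width $h$ with alternating sign), and let $e_{\rm s}(h)$ be its energy per site, $e_{\rm s}(h)=\frac1{2h}\sum_{x_1=0}^{2h-1}\Big[-\frac J2\sum_{y:|y-x|=1}(\sigma_x\sigma_y-1)+\frac12\sum_{y\ne x}\frac{\sigma_x\sigma_y-1}{|x-y|^p}\Big]$ with $x=(x_1,0)$ and $\underline\sigma=\underline\sigma^{(h)}$. Let $h^*$ be a minimizer of $e_{\rm s}$ over $\mathbb N$ (unique except for exceptional values of $J$). The optimal periodic striped configurations are $\underline\sigma^*=\underline\sigma^{(h^* )}$ together with its images under lattice translations and rotation by $\pi/2$. *)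

(* Defs.v *)
From Stdlib Require Import Reals Lra ZArith List.
From Coquelicot Require Import Coquelicot.
Import ListNotations.
Open Scope R_scope.

Definition site := (Z * Z)%type.
Definition config := site -> bool.
Definition spin (b : bool) : R := if b then 1 else -1.

Definition bond (a b : bool) : R := spin a * spin b - 1.

Definition site_eqb (x y : site) : bool :=
  Z.eqb (fst x) (fst y) && Z.eqb (snd x) (snd y).
Definition memb (y : site) (X : list site) : bool := existsb (site_eqb y) X.

Definition dist2 (x y : site) : Z :=
  ((fst x - fst y) ^ 2 + (snd x - snd y) ^ 2)%Z.
Definition dpow (p : R) (x y : site) : R := Rpower (IZR (dist2 x y)) (p / 2).
Definition nn (x y : site) : bool := Z.eqb (dist2 x y) 1.
Definition nbrs (x : site) : list site :=
  [((fst x + 1)%Z, snd x); ((fst x - 1)%Z, snd x);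
   (fst x, (snd x + 1)%Z); (fst x, (snd x - 1)%Z)].

Definition sumR {A : Type} (f : A -> R) (l : list A) : R :=
  fold_right (fun a acc => f a + acc) 0 l.

Definition zrange (L : nat) : list Z :=
  map (fun n => (Z.of_nat n - Z.of_nat L)%Z) (seq 0 (2 * L + 1)).
Definition box (L : nat) : list site := list_prod (zrange L) (zrange L).

Definition zsum (f : site -> R) : R :=
  real (Lim_seq (fun L => sumR f (box L))).

(* H_X(sigma_X | s); sigma is a full configuration of which only the
   restriction to X is used. Sums over unordered pairs in X are written as
   1/2 of sums over ordered pairs. *)
Definition H_X (p J : R) (X : list site) (sg s : config) : R :=
  - J * (/ 2) * sumR (fun x => sumR (fun y =>
        if nn x y then bond (sg x) (sg y) else 0) X) X
  + (/ 2) * sumR (fun x => sumR (fun y =>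
        if site_eqb x y then 0 else bond (sg x) (sg y) / dpow p x y) X) X
  - J * sumR (fun x => sumR (fun y =>
        if memb y X then 0 else bond (sg x) (s y)) (nbrs x)) X
  + sumR (fun x => zsum (fun y =>
        if memb y X then 0 else bond (sg x) (s y) / dpow p x y)) X.

Definition ground_state (p J : R) (s : config) : Prop :=
  forall (X : list site), NoDup X ->
  forall sg : config, H_X p J X sg s - H_X p J X s s >= 0.

Definition differ_finitely (s t : config) : Prop :=
  exists l : list site, forall x, s x <> t x -> In x l.

Definition Jc (p : R) : R :=
  zsum (fun y => if (0 <? fst y)%Z then IZR (fst y) / dpow p y (0%Z, 0%Z) else 0).

Definition stripe (h : nat) : config :=
  fun x => if Rlt_dec 0 (sin (PI * (IZR (fst x) + / 2) / INR h)) then true else false.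

Definition e_s (p J : R) (h : nat) : R :=
  let sg := stripe h in
  / (2 * INR h) * sumR (fun n =>
     let x : site := (Z.of_nat n, 0%Z) in
       - (J / 2) * sumR (fun y => bond (sg x) (sg y)) (nbrs x)
       + / 2 * zsum (fun y => if site_eqb y x then 0
                              else bond (sg x) (sg y) / dpow p x y))
    (seq 0 (2 * h)).

Definition rot (x : site) : site := ((- snd x)%Z, fst x).
Definition transf (k : nat) (a : site) (s : config) : config :=
  fun x => let y := Nat.iter k rot x in s ((fst y + fst a)%Z, (snd y + snd a)%Z).

(* Main.v *)
(* Write tau = Jc - J.  For a configuration of period L in both directions, every pair (x, x + n) of
   opposite spins is analysed through the L-shaped path x, x + n1 e1, x + n: the energy per period is
   exactly the sum of one-dimensional energies of the rows and of the columns, plus a positive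
   repulsion between the two legs.

   In one dimension the interaction summed over the other coordinate is a positive mixture of
   exponentials exp (- al k), because |n|^(-p) = (z (conj z))^(-p/2) with z = n1 + i n2 and
   (1 - q)^(-p/2) has positive coefficients.  For one exponential the energy is a sum over the
   jumps of quantities s with s = lam^h (1 - s') (h the distance to the next jump, s' the next
   value), and s >= lam^h / (1 + lam^h) + (s^2 - s'^2) / 2, which telescopes.  Hence the energy of a
   row is at least the sum of e_s (a) over its sites, a being the length of the block of the site.

   So the energy is at least the sum over sites of e_s (a) + e_s (b), with a and b the lengths of the
   horizontal and vertical blocks, plus a constant per corner.  Let A be a large multiple of the
   optimal width.  If a, b > A then both terms are at least -2 tau / A and their sum exceeds the
   minimum of e_s.  Otherwise the site falls short of the minimum by at most 2 tau / max (a, b),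
   there is a corner nearby, and each corner is charged at most 8 tau (A + 1) in total.  Since
   p > 4, A can be chosen with tau A arbitrarily small as tau -> 0, so the corners pay and each
   contributes a definite positive energy.

   A finite perturbation of a striped state is compared with it on large tori; a non-trivial one has
   a corner, hence strictly larger energy. *)
Require Import Defs.
From Stdlib Require Import Reals Lra Lia Psatz ZArith List Bool Permutation Classical.
From Coquelicot Require Import Coquelicot.
Open Scope R_scope.

(** * Unconditional sums *)

(** [zsum] is a limit along centred squares, not visibly invariant under the translations,
    reflections and exchanges of coordinates used throughout. Lattice sums are therefore treated as
    unconditional sums over finite sets, where rearrangement and dominated convergence are
    available. Summing the binomial expansion over n2 directly is impossible: it produces characters
    cos (e (i - j) n2), whose sums diverge. Fejer weights in n2 repair this, since their
    trigonometric sums are squares; they are removed last. The optimal width is never estimated. The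
    mismatch of one stripe period is at most 2 |n1|, with equality for |n1| <= h, so -2 tau <= h
    e_s(h) <= -2 tau + tail(h) / h, and tail(h) -> 0 because p > 4 makes the second moment of
    |n|^(-p) finite. A trial width h0 of order 1 / tau gives A = 4 h0. Each corner site brings at
    least twice 2^(-p/2), and the charges take at most half of it. Torus energies let the
    displacement range over all of Z^2, so they are energies per period of periodic configurations
    of the plane, and their differences converge to differences of [H_X]. *)

Lemma sumR_app {A} (f : A -> R) l1 l2 : sumR f (l1 ++ l2) = sumR f l1 + sumR f l2.
Proof. induction l1 as [|a l IH]; simpl; [ring | rewrite IH; ring]. Qed.

Lemma sumR_map {A B} (g : A -> B) (f : B -> R) l : sumR f (map g l) = sumR (fun x => f (g x)) l.
Proof. induction l as [|a l IH]; simpl; [reflexivity | rewrite IH; reflexivity]. Qed.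

Lemma sumR_ext_in {A} (f g : A -> R) l : (forall x, In x l -> f x = g x) -> sumR f l = sumR g l.
Proof.
  induction l as [|a l IH]; simpl; intros H; [reflexivity|].
  rewrite H, IH; auto.
Qed.

Lemma sumR_ext {A} (f g : A -> R) l : (forall x, f x = g x) -> sumR f l = sumR g l.
Proof. intros; apply sumR_ext_in; auto. Qed.

Lemma sumR_plus {A} (f g : A -> R) l : sumR (fun x => f x + g x) l = sumR f l + sumR g l.
Proof. induction l as [|a l IH]; simpl; [ring | rewrite IH; ring]. Qed.

Lemma sumR_minus {A} (f g : A -> R) l : sumR (fun x => f x - g x) l = sumR f l - sumR g l.
Proof. induction l as [|a l IH]; simpl; [ring | rewrite IH; ring]. Qed.

Lemma sumR_scal {A} c (f : A -> R) l : sumR (fun x => c * f x) l = c * sumR f l.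
Proof. induction l as [|a l IH]; simpl; [ring | rewrite IH; ring]. Qed.

Lemma sumR_scal_r {A} c (f : A -> R) l : sumR (fun x => f x * c) l = sumR f l * c.
Proof. induction l as [|a l IH]; simpl; [ring | rewrite IH; ring]. Qed.

Lemma sumR_0 {A} (f : A -> R) l : (forall x, In x l -> f x = 0) -> sumR f l = 0.
Proof. induction l as [|a l IH]; simpl; intros H; [reflexivity | rewrite H, IH; auto; ring]. Qed.

Lemma sumR_const {A} c (l : list A) : sumR (fun _ => c) l = INR (length l) * c.
Proof.
  induction l as [|a l IH]; simpl length; [simpl; ring | rewrite S_INR; simpl sumR; rewrite IH;
    ring].
Qed.

Lemma sumR_le_in {A} (f g : A -> R) l : (forall x, In x l -> f x <= g x) -> sumR f l <= sumR g l.
Proof.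
  induction l as [|a l IH]; simpl; intros H; [lra|].
  apply Rplus_le_compat; auto.
Qed.

Lemma sumR_nonneg {A} (f : A -> R) l : (forall x, In x l -> 0 <= f x) -> 0 <= sumR f l.
Proof. intros H; rewrite <- (sumR_0 (fun _ => 0) l) by auto; apply sumR_le_in; auto. Qed.

Lemma sumR_term_le {A} (f : A -> R) l x :
  (forall y, In y l -> 0 <= f y) -> In x l -> f x <= sumR f l.
Proof.
  induction l as [|a l IH]; simpl; intros H [].
  - subst; assert (0 <= sumR f l) by (apply sumR_nonneg; auto); lra.
  - assert (0 <= f a) by auto. assert (f x <= sumR f l) by auto. lra.
Qed.

Lemma sumR_Rabs {A} (f : A -> R) l : Rabs (sumR f l) <= sumR (fun x => Rabs (f x)) l.
Proof.
  induction l as [|a l IH]; simpl; [rewrite Rabs_R0; lra|].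
  eapply Rle_trans; [apply Rabs_triang|]; lra.
Qed.

Lemma sumR_swap {A B} (f : A -> B -> R) la lb :
  sumR (fun a => sumR (fun b => f a b) lb) la = sumR (fun b => sumR (fun a => f a b) la) lb.
Proof.
  induction la as [|a la IH]; simpl.
  - symmetry; apply sumR_0; auto.
  - rewrite IH, <- sumR_plus; reflexivity.
Qed.

Lemma sumR_perm {A} (f : A -> R) l1 l2 : Permutation l1 l2 -> sumR f l1 = sumR f l2.
Proof. induction 1; simpl; lra. Qed.

Lemma sumR_list_prod {A B} (f : A * B -> R) la lb :
  sumR f (list_prod la lb) = sumR (fun a => sumR (fun b => f (a, b)) lb) la.
Proof.
  induction la as [|a la IH]; simpl; [reflexivity|].
  rewrite sumR_app, IH, sumR_map; reflexivity.
Qed.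

Lemma sumR_filter {A} (P : A -> bool) (f : A -> R) l :
  sumR f (filter P l) = sumR (fun x => if P x then f x else 0) l.
Proof.
  induction l as [|a l IH]; simpl; [reflexivity|].
  destruct (P a); simpl; rewrite IH; ring.
Qed.

Lemma sumR_incl_le {A} (f : A -> R) l1 l2 :
  (forall x, 0 <= f x) -> NoDup l1 -> incl l1 l2 -> sumR f l1 <= sumR f l2.
Proof.
  intros Hf; revert l2; induction l1 as [|a l IH]; simpl; intros l2 Hn Hi.
  - apply sumR_nonneg; auto.
  - inversion Hn; subst.
    destruct (in_split a l2) as (u & v & ->); [apply Hi; now left|].
    rewrite sumR_app; simpl.
    assert (sumR f l <= sumR f (u ++ v)).
    { apply IH; auto. intros x Hx.
      assert (In x (u ++ a :: v)) as Hin by (apply Hi; now right).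
      apply in_app_iff in Hin; simpl in Hin; apply in_app_iff.
      destruct Hin as [|[->|]]; tauto. }
    rewrite sumR_app in H; lra.
Qed.

Lemma NoDup_cover {A} (l : list A) : exists l', NoDup l' /\ incl l l'.
Proof.
  induction l as [|a l [l' [Hn Hi]]].
  - exists nil; split; [constructor | intros x []].
  - destruct (classic (In a l')) as [H|H].
    + exists l'; split; auto. intros x [->|Hx]; auto.
    + exists (a :: l'); split; [constructor; auto|].
      intros x [->|Hx]; [now left | right; auto].
Qed.

(** Convergence along the net of finite subsets, encoded as duplicate-free lists ordered by
    inclusion. It is invariant under every bijection of the index set, as the limit along [box] need
    not be. *)
Definition has_sum {A} (f : A -> R) (S : R) : Prop :=
  forall eps, 0 < eps -> exists l0, forall l, NoDup l -> incl l0 l -> Rabs (sumR f l - S) < eps.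

Definition summable {A} (f : A -> R) : Prop :=
  exists M, forall l, NoDup l -> sumR (fun x => Rabs (f x)) l <= M.

Lemma has_sum_ext {A} (f g : A -> R) S : (forall x, f x = g x) -> has_sum f S -> has_sum g S.
Proof.
  intros H HS eps He; destruct (HS eps He) as [l0 H0]; exists l0; intros l Hn Hi.
  rewrite <- (sumR_ext f g) by auto; auto.
Qed.

Lemma has_sum_plus {A} (f g : A -> R) S T :
  has_sum f S -> has_sum g T -> has_sum (fun x => f x + g x) (S + T).
Proof.
  intros HS HT eps He.
  destruct (HS (eps / 2)) as [l1 H1]; [lra|]. destruct (HT (eps / 2)) as [l2 H2]; [lra|].
  exists (l1 ++ l2); intros l Hn Hi.
  assert (incl l1 l /\ incl l2 l) as [Ha Hb] by (split; intros x Hx; apply Hi, in_app_iff; tauto).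
  specialize (H1 l Hn Ha); specialize (H2 l Hn Hb).
  rewrite sumR_plus.
  replace (sumR f l + sumR g l - (S + T)) with ((sumR f l - S) + (sumR g l - T)) by ring.
  eapply Rle_lt_trans; [apply Rabs_triang|]; lra.
Qed.

Lemma has_sum_scal {A} c (f : A -> R) S : has_sum f S -> has_sum (fun x => c * f x) (c * S).
Proof.
  intros HS eps He.
  assert (0 < Rabs c + 1) by (pose proof (Rabs_pos c); lra).
  destruct (HS (eps / (Rabs c + 1))) as [l0 H0]; [now apply Rdiv_lt_0_compat|].
  exists l0; intros l Hn Hi; specialize (H0 l Hn Hi).
  rewrite sumR_scal, <- Rmult_minus_distr_l, Rabs_mult.
  apply Rle_lt_trans with ((Rabs c + 1) * Rabs (sumR f l - S)).
  - apply Rmult_le_compat_r; [apply Rabs_pos | lra].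
  - apply Rmult_lt_compat_l with (r := Rabs c + 1) in H0; auto.
    replace ((Rabs c + 1) * (eps / (Rabs c + 1))) with eps in H0 by (field; lra). exact H0.
Qed.

Lemma has_sum_minus {A} (f g : A -> R) S T :
  has_sum f S -> has_sum g T -> has_sum (fun x => f x - g x) (S - T).
Proof.
  intros HS HT. replace (S - T) with (S + (-1) * T) by ring.
  apply has_sum_ext with (fun x => f x + (-1) * g x); [intros; ring|].
  apply has_sum_plus; auto. apply has_sum_scal; auto.
Qed.

Lemma has_sum_0 {A} : has_sum (fun _ : A => 0) 0.
Proof.
  intros eps He; exists nil; intros l _ _. rewrite sumR_0 by auto.
  rewrite Rminus_0_r, Rabs_R0; auto.
Qed.

Lemma has_sum_sumR {A B} (F : B -> A -> R) (S : B -> R) lb :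
  (forall b, In b lb -> has_sum (F b) (S b)) ->
  has_sum (fun a => sumR (fun b => F b a) lb) (sumR S lb).
Proof.
  induction lb as [|b lb IH]; simpl; intros H; [apply has_sum_0|].
  apply has_sum_plus; auto.
Qed.

Lemma has_sum_ge_part {A} (f : A -> R) S l :
  (forall x, 0 <= f x) -> has_sum f S -> NoDup l -> sumR f l <= S.
Proof.
  intros Hf HS Hl. apply Rnot_lt_le; intros Hlt.
  destruct (HS (sumR f l - S)) as [l0 H0]; [lra|].
  destruct (NoDup_cover (l0 ++ l)) as [l' [Hn Hi]].
  assert (incl l0 l' /\ incl l l') as [Ha Hb] by (split; intros x Hx; apply Hi, in_app_iff; tauto).
  specialize (H0 l' Hn Ha). apply Rabs_def2 in H0.
  pose proof (sumR_incl_le f l l' Hf Hl Hb). lra.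
Qed.

Lemma has_sum_nonneg {A} (f : A -> R) S : (forall x, 0 <= f x) -> has_sum f S -> 0 <= S.
Proof. intros Hf HS. apply (has_sum_ge_part f S nil); auto; constructor. Qed.

Lemma has_sum_le {A} (f g : A -> R) S T :
  (forall x, f x <= g x) -> has_sum f S -> has_sum g T -> S <= T.
Proof.
  intros H HS HT. assert (0 <= T - S); [|lra].
  apply has_sum_nonneg with (fun x => g x - f x); [intros x; specialize (H x); lra|].
  apply has_sum_minus; auto.
Qed.

Lemma summable_le {A} (f g : A -> R) :
  (forall x, Rabs (f x) <= g x) -> summable g -> summable f.
Proof.
  intros H [M HM]; exists M; intros l Hl. eapply Rle_trans; [|apply (HM l Hl)].
  apply sumR_le_in; intros x _. eapply Rle_trans; [apply H|apply Rle_abs].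
Qed.

Lemma summable_Rabs {A} (f : A -> R) : summable f -> summable (fun x => Rabs (f x)).
Proof.
  intros [M HM]; exists M; intros l Hl.
  rewrite (sumR_ext _ (fun x => Rabs (f x))); auto. intros; apply Rabs_Rabsolu.
Qed.

Lemma summable_inj {A B} (phi : B -> A) (f : A -> R) :
  (forall x y, phi x = phi y -> x = y) -> summable f -> summable (fun x => f (phi x)).
Proof.
  intros Hphi [M HM]; exists M; intros l Hl. rewrite <- (sumR_map phi (fun a => Rabs (f a))).
  apply HM, FinFun.Injective_map_NoDup; auto.
Qed.

Lemma summable_scal {A} c (f : A -> R) : summable f -> summable (fun x => c * f x).
Proof.
  intros [M HM]; exists (Rabs c * M); intros l Hl.
  rewrite (sumR_ext _ (fun x => Rabs c * Rabs (f x))) by (intros; apply Rabs_mult).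
  rewrite sumR_scal. apply Rmult_le_compat_l; [apply Rabs_pos | auto].
Qed.

Lemma summable_plus {A} (f g : A -> R) : summable f -> summable g -> summable (fun x => f x + g x).
Proof.
  intros [M HM] [N HN]; exists (M + N); intros l Hl.
  apply Rle_trans with (sumR (fun x => Rabs (f x) + Rabs (g x)) l).
  - apply sumR_le_in; intros; apply Rabs_triang.
  - rewrite sumR_plus. apply Rplus_le_compat; auto.
Qed.

Lemma summable_has_sum_nonneg {A} (f : A -> R) :
  (forall x, 0 <= f x) -> summable f -> exists S, has_sum f S.
Proof.
  intros Hf [M HM].
  destruct (completeness (fun s => exists l, NoDup l /\ s = sumR f l)) as [S [HS1 HS2]].
  - exists M. intros s [l [Hl ->]]. rewrite (sumR_ext f (fun x => Rabs (f x))); auto.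
    intros x; rewrite Rabs_pos_eq; auto.
  - exists 0, nil; split; [constructor | reflexivity].
  - exists S. intros eps He.
    assert (exists l0, NoDup l0 /\ S - eps < sumR f l0) as (l0 & Hl0 & Hs).
    { apply NNPP; intros Hc. assert (S <= S - eps); [|lra].
      apply HS2. intros s [l [Hl ->]]. apply Rnot_lt_le; intros Hlt. apply Hc; eauto. }
    exists l0; intros l Hn Hi.
    pose proof (sumR_incl_le f l0 l Hf Hl0 Hi).
    assert (sumR f l <= S) by (apply HS1; eauto).
    apply Rabs_def1; lra.
Qed.

(** Uses f = (|f| + f) - |f|, a difference of two nonnegative summable functions. *)
Lemma summable_has_sum {A} (f : A -> R) : summable f -> exists S, has_sum f S.
Proof.
  intros Hs.
  destruct (summable_has_sum_nonneg (fun x => Rabs (f x))) as [S HS].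
  { intros; apply Rabs_pos. }
  { apply summable_Rabs; auto. }
  destruct (summable_has_sum_nonneg (fun x => Rabs (f x) + f x)) as [T HT].
  { intros x; pose proof (Rabs_maj2 (f x)); lra. }
  { destruct Hs as [M HM]; exists (2 * M); intros l Hl.
    apply Rle_trans with (sumR (fun x => 2 * Rabs (f x)) l).
    - apply sumR_le_in; intros x _. pose proof (Rabs_triang (Rabs (f x)) (f x)).
      rewrite Rabs_Rabsolu in H; lra.
    - rewrite sumR_scal. specialize (HM l Hl); lra. }
  exists (T - S).
  apply has_sum_ext with (fun x => Rabs (f x) + f x - Rabs (f x)); [intros; ring|].
  apply has_sum_minus; auto.
Qed.

Lemma summable_tail {A} (g : A -> R) : (forall x, 0 <= g x) -> summable g ->
  forall eps, 0 < eps -> exists l0, NoDup l0 /\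
    forall l, NoDup l -> (forall x, In x l -> ~ In x l0) -> sumR g l < eps.
Proof.
  intros Hg Hs eps He. destruct (summable_has_sum_nonneg g Hg Hs) as [S HS].
  destruct (HS (eps / 2)) as [l1 H1]; [lra|].
  destruct (NoDup_cover l1) as [l0 [Hn Hi]]. exists l0; split; auto.
  intros l Hl Hd.
  assert (NoDup (l0 ++ l)) by (apply NoDup_app; auto; intros x Hx Hx'; apply (Hd x); auto).
  pose proof (H1 l0 Hn Hi) as Ha.
  assert (incl l1 (l0 ++ l)) as Hi' by (intros x Hx; apply in_app_iff; left; auto).
  pose proof (H1 (l0 ++ l) H Hi') as Hb. rewrite sumR_app in Hb.
  apply Rabs_def2 in Ha; apply Rabs_def2 in Hb. lra.
Qed.

Lemma is_lim_seq_sumR {A} (F : nat -> A -> R) (f : A -> R) l :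
  (forall x, In x l -> is_lim_seq (fun m => F m x) (f x)) ->
  is_lim_seq (fun m => sumR (F m) l) (sumR f l).
Proof.
  induction l as [|a l IH]; simpl; intros H; [apply is_lim_seq_const|].
  apply is_lim_seq_plus'; auto.
Qed.

Lemma is_lim_seq_Rabs (u : nat -> R) (l : R) :
  is_lim_seq u l <-> forall eps, 0 < eps -> exists N, forall n, (N <= n)%nat -> Rabs (u n - l) <
    eps.
Proof.
  split.
  - intros H eps He. apply is_lim_seq_spec in H.
    destruct (H (mkposreal eps He)) as [N HN]; exists N; auto.
  - intros H. apply is_lim_seq_spec. intros [eps He]. destruct (H eps He) as [N HN]; exists N; auto.
Qed.

(** Dominated convergence. A finite set [l2] carries all but eps / 8 of [g], hence controls the
    remainder of every [F n] at once; on [l2] only finitely many pointwise limits are involved. *)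
Lemma has_sum_dominated {A} (F : nat -> A -> R) (f g : A -> R) (S : nat -> R) T :
  summable g -> (forall m x, Rabs (F m x) <= g x) ->
  (forall x, is_lim_seq (fun m => F m x) (f x)) ->
  (forall m, has_sum (F m) (S m)) -> has_sum f T -> is_lim_seq S T.
Proof.
  intros Hg HF Hlim HS HT.
  assert (Hg0 : forall x, 0 <= g x) by (intros x; eapply Rle_trans;
    [apply Rabs_pos | apply (HF O x)]).
  apply is_lim_seq_Rabs; intros eps He.
  destruct (summable_tail g Hg0 Hg (eps / 8)) as (l0 & Hn0 & Ht); [lra|].
  destruct (HT (eps / 8)) as [l1 H1]; [lra|].
  destruct (NoDup_cover (l0 ++ l1)) as (l2 & Hn2 & Hi2).
  assert (incl l0 l2 /\ incl l1 l2) as [Ha Hb] by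
    (split; intros x Hx; apply Hi2, in_app_iff; tauto).
  pose proof (is_lim_seq_sumR F f l2 (fun x _ => Hlim x)) as Hl.
  destruct (proj1 (is_lim_seq_Rabs _ _) Hl (eps / 8)) as [N HN]; [lra|].
  exists N; intros n Hn. specialize (HN n Hn). specialize (H1 l2 Hn2 Hb).
  assert (Rabs (sumR (F n) l2 - S n) <= eps / 4).
  { destruct (HS n (eps / 8)) as [l3 H3]; [lra|].
    destruct (NoDup_cover l3) as (l4 & Hn4 & Hi4).
    (* [l5] lists the points of [l4] outside [l2]; being disjoint from [l0], it only sees the tail
       of [g]. *)
    assert (Hd : exists l5, NoDup l5 /\ (forall x, In x l5 -> ~ In x l2) /\ incl l4 (l2 ++ l5)).
    { clear - Hn4. induction l4 as [|a l IH].
      - exists nil; repeat split; [constructor | simpl; tauto | intros x []].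
      - inversion Hn4; subst. destruct IH as (l5 & Hn5 & Hd5 & Hi5); auto.
        destruct (classic (In a (l2 ++ l5))) as [Hin|Hin].
        + exists l5; repeat split; auto. intros x [->|Hx]; auto.
        + exists (a :: l5). rewrite in_app_iff in Hin. repeat split.
          * constructor; tauto.
          * intros x [->|Hx]; auto.
          * intros x [->|Hx]; apply in_app_iff; simpl; [tauto|].
            apply Hi5, in_app_iff in Hx; tauto. }
    destruct Hd as (l5 & Hn5 & Hd5 & Hi5).
    assert (NoDup (l2 ++ l5)) as Hn25 by (apply NoDup_app; auto; intros x Hx Hx'; apply (Hd5 x);
      auto).
    assert (incl l3 (l2 ++ l5)) as Hi35 by (intros x Hx; auto).
    specialize (H3 _ Hn25 Hi35). rewrite sumR_app in H3.
    assert (Rabs (sumR (F n) l5) <= eps / 8).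
    { eapply Rle_trans; [apply sumR_Rabs|]. eapply Rle_trans.
      - apply sumR_le_in; intros x _; apply HF.
      - left; apply Ht; auto. intros x Hx Hx0. apply (Hd5 x Hx); auto. }
    replace (sumR (F n) l2 - S n) with ((sumR (F n) l2 + sumR (F n) l5 - S n) - sumR (F n) l5) by
      ring.
    eapply Rle_trans; [apply Rabs_triang|]. rewrite Rabs_Ropp; lra. }
  replace (S n - T) with (- (sumR (F n) l2 - S n) + ((sumR (F n) l2 - sumR f l2) + (sumR f l2 - T)))
    by ring.
  eapply Rle_lt_trans; [apply Rabs_triang|]. rewrite Rabs_Ropp.
  pose proof (Rabs_triang (sumR (F n) l2 - sumR f l2) (sumR f l2 - T)). lra.
Qed.

Lemma has_sum_bij {A B} (phi : B -> A) (psi : A -> B) (f : A -> R) S :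
  (forall a, phi (psi a) = a) -> (forall b, psi (phi b) = b) ->
  has_sum f S -> has_sum (fun b => f (phi b)) S.
Proof.
  intros H1 H2 HS eps He. destruct (HS eps He) as [l0 H0].
  exists (map psi l0); intros l Hn Hi. rewrite <- sumR_map. apply H0.
  - apply FinFun.Injective_map_NoDup; auto. intros x y Hxy.
    rewrite <- (H2 x), <- (H2 y), Hxy; auto.
  - intros a Ha. rewrite <- (H1 a). apply in_map, Hi, in_map; auto.
Qed.

Lemma has_sum_slice (F : Z * Z -> R) m S :
  (forall k m', m' <> m -> F (k, m') = 0) ->
  has_sum (fun k => F (k, m)) S -> has_sum F S.
Proof.
  intros H0 HS eps He. destruct (HS eps He) as [l0 H]. exists (map (fun k => (k, m)) l0).
  intros l Hn Hi.
  set (l' := filter (fun n : Z * Z => Z.eqb (snd n) m) l).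
  replace (sumR F l) with (sumR F l').
  2:{ unfold l'; rewrite sumR_filter. apply sumR_ext; intros [k m']; simpl.
      destruct (Z.eqb_spec m' m) as [->|Hne]; auto. symmetry; auto. }
  assert (Hl' : l' = map (fun k => (k, m)) (map fst l')).
  { rewrite map_map. rewrite <- (map_id l') at 1. apply map_ext_in. intros [k m'] Hin.
    unfold l' in Hin; apply filter_In in Hin; simpl in *. destruct Hin as [_ Hm].
    apply Z.eqb_eq in Hm; subst; auto. }
  rewrite Hl', sumR_map. apply H.
  - apply (NoDup_map_inv (fun k => (k, m))). rewrite <- Hl'. apply NoDup_filter; auto.
  - intros k Hk. apply in_map_iff. exists (k, m); split; auto.
    unfold l'; apply filter_In; split; [|simpl; apply Z.eqb_refl].
    apply Hi, (in_map (fun k => (k, m))); auto.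
Qed.

(** The second factor has finite support (a Fejer weight later on), so the sum is a finite
    combination of sums along lines. *)
Lemma has_sum_prod_finite (f g : Z -> R) S lm :
  NoDup lm -> (forall m, ~ In m lm -> g m = 0) -> has_sum f S ->
  has_sum (fun n : Z * Z => f (fst n) * g (snd n)) (S * sumR g lm).
Proof.
  intros Hn Hg HS.
  apply has_sum_ext with (fun n : Z * Z => sumR
    (fun m => if Z.eqb (snd n) m then f (fst n) * g m else 0) lm).
  - intros [k m]; simpl. clear HS. revert g Hg. induction lm as [|a lm IH]; simpl; intros g Hg.
    + rewrite Hg; auto; ring.
    + inversion Hn; subst. destruct (Z.eqb_spec m a) as [->|Hne].
      * rewrite sumR_0; [ring|]. intros x Hx. destruct (Z.eqb_spec a x); auto. now subst.
      (* The induction hypothesis is applied to [g] with its value at [a] replaced by 0, because [g]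
         need not vanish at [a], which lies outside the shorter list. *)
      * assert (Hm : forall m', ~ In m' lm -> (if Z.eqb m' a then 0 else g m') = 0).
        { intros m' Hm'. destruct (Z.eqb_spec m' a); auto. apply Hg; intros [Heq|Hin]; auto. }
        specialize (IH H2 _ Hm). simpl in IH.
        rewrite (proj2 (Z.eqb_neq m a)) in IH by auto.
        rewrite <- IH, Rplus_0_l. apply sumR_ext_in; intros x Hx.
        destruct (Z.eqb_spec m x); auto. destruct (Z.eqb_spec x a); auto; now subst.
  - rewrite <- sumR_scal. apply has_sum_sumR. intros m _.
    apply has_sum_slice with m.
    + intros k m' Hm; simpl. rewrite (proj2 (Z.eqb_neq m' m)); auto.
    + simpl. rewrite Z.eqb_refl. rewrite (Rmult_comm S).
      apply has_sum_ext with (fun k => g m * f k); [intros; ring|]. apply has_sum_scal; auto.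
Qed.

(** * Sums over the lattice *)

Lemma in_zrange L k : In k (zrange L) <-> (- Z.of_nat L <= k <= Z.of_nat L)%Z.
Proof.
  unfold zrange; rewrite in_map_iff; split.
  - intros (n & <- & Hn). apply in_seq in Hn; lia.
  - intros H. exists (Z.to_nat (k + Z.of_nat L)); split; [lia|]. apply in_seq; lia.
Qed.

Lemma NoDup_zrange L : NoDup (zrange L).
Proof.
  unfold zrange. apply FinFun.Injective_map_NoDup; [intros x y; lia | apply seq_NoDup].
Qed.

Lemma in_box L x : In x (box L) <-> In (fst x) (zrange L) /\ In (snd x) (zrange L).
Proof. destruct x as [a b]; exact (in_prod_iff (zrange L) (zrange L) a b). Qed.

Lemma NoDup_list_prod {A B} (la : list A) (lb : list B) :
  NoDup la -> NoDup lb -> NoDup (list_prod la lb).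
Proof.
  intros Ha Hb; induction Ha as [|a la Hn Ha IH]; simpl; [constructor|].
  apply NoDup_app; auto.
  - apply FinFun.Injective_map_NoDup; auto. intros x y Hxy; congruence.
  - intros [x y] Hin Hin'. apply in_map_iff in Hin; destruct Hin as (z & Hz & _).
    apply in_prod_iff in Hin'. inversion Hz; subst; tauto.
Qed.

Lemma NoDup_box L : NoDup (box L).
Proof. apply NoDup_list_prod; apply NoDup_zrange. Qed.

Lemma zrange_cover (l : list Z) : exists L, forall K, (L <= K)%nat -> incl l (zrange K).
Proof.
  induction l as [|a l [L HL]]; [exists O; intros K _ x []|].
  exists (L + Z.abs_nat a)%nat. intros K HK x [->|Hx].
  - apply in_zrange; lia.
  - apply (HL K); auto; lia.
Qed.

Lemma box_cover (l : list site) : exists L, forall K, (L <= K)%nat -> incl l (box K).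
Proof.
  destruct (zrange_cover (map fst l)) as [L1 H1]. destruct (zrange_cover (map snd l)) as [L2 H2].
  exists (L1 + L2)%nat. intros K HK x Hx. apply in_box; split.
  - apply (H1 K); [lia | apply in_map; auto].
  - apply (H2 K); [lia | apply in_map; auto].
Qed.

Lemma has_sum_zrange_lim (f : Z -> R) S : has_sum f S -> is_lim_seq (fun L => sumR f (zrange L)) S.
Proof.
  intros HS. apply is_lim_seq_Rabs; intros eps He. destruct (HS eps He) as [l0 H0].
  destruct (zrange_cover l0) as [L HL]. exists L; intros n Hn.
  apply H0; [apply NoDup_zrange | auto].
Qed.

Lemma zsum_has_sum (f : site -> R) S : has_sum f S -> zsum f = S.
Proof.
  intros HS. unfold zsum.
  rewrite (is_lim_seq_unique _ S); [reflexivity|].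
  apply is_lim_seq_Rabs; intros eps He. destruct (HS eps He) as [l0 H0].
  destruct (box_cover l0) as [L HL]. exists L; intros n Hn. apply H0; [apply NoDup_box | auto].
Qed.

Lemma has_sum_zsum (f : site -> R) : summable f -> has_sum f (zsum f).
Proof.
  intros H. destruct (summable_has_sum f H) as [S HS]. rewrite (zsum_has_sum f S HS); auto.
Qed.

Lemma zsum_ext (f g : site -> R) : (forall x, f x = g x) -> zsum f = zsum g.
Proof.
  intros H. unfold zsum. f_equal. apply Lim_seq_ext; intros n. apply sumR_ext; auto.
Qed.

Lemma zsum_plus (f g : site -> R) : summable f -> summable g ->
  zsum (fun x => f x + g x) = zsum f + zsum g.
Proof. intros; apply zsum_has_sum, has_sum_plus; apply has_sum_zsum; auto. Qed.

Lemma zsum_minus (f g : site -> R) : summable f -> summable g ->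
  zsum (fun x => f x - g x) = zsum f - zsum g.
Proof. intros; apply zsum_has_sum, has_sum_minus; apply has_sum_zsum; auto. Qed.

Lemma zsum_scal c (f : site -> R) : summable f -> zsum (fun x => c * f x) = c * zsum f.
Proof. intros; apply zsum_has_sum, has_sum_scal; apply has_sum_zsum; auto. Qed.

Lemma zsum_le (f g : site -> R) : summable f -> summable g -> (forall x, f x <= g x) ->
  zsum f <= zsum g.
Proof. intros Hf Hg H; apply (has_sum_le f g); auto using has_sum_zsum. Qed.

Lemma zsum_sumR {B} (F : B -> site -> R) lb : (forall b, In b lb -> summable (F b)) ->
  zsum (fun x => sumR (fun b => F b x) lb) = sumR (fun b => zsum (F b)) lb.
Proof. intros H; apply zsum_has_sum, has_sum_sumR; intros b Hb; apply has_sum_zsum; auto. Qed.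

Lemma zsum_bij (phi psi : site -> site) (f : site -> R) : summable f ->
  (forall a, phi (psi a) = a) -> (forall b, psi (phi b) = b) ->
  zsum (fun x => f (phi x)) = zsum f.
Proof. intros Hf H1 H2; apply zsum_has_sum, (has_sum_bij phi psi); auto using has_sum_zsum. Qed.

Lemma zsum_dominated (F : nat -> site -> R) (f g : site -> R) :
  summable g -> (forall m x, Rabs (F m x) <= g x) ->
    (forall x, is_lim_seq (fun m => F m x) (f x)) ->
  is_lim_seq (fun m => zsum (F m)) (zsum f).
Proof.
  intros Hg HF Hl.
  assert (Hf : summable f).
  { apply summable_le with g; auto. intros x.
    apply (is_lim_seq_le (fun m => Rabs (F m x)) (fun _ => g x) (Rabs (f x)) (g x)); auto.
    - apply (is_lim_seq_abs _ (f x)); auto.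
    - apply is_lim_seq_const. }
  apply (has_sum_dominated F f g); auto.
  - intros m; apply has_sum_zsum, summable_le with g; auto.
  - apply has_sum_zsum; auto.
Qed.

Lemma sumR_zrange_S (f : Z -> R) L :
  sumR f (zrange (S L)) = f (- Z.of_nat (S L))%Z + sumR f (zrange L) + f (Z.of_nat (S L)).
Proof.
  unfold zrange. rewrite !sumR_map.
  replace (2 * S L + 1)%nat with (S (2 * L + 1 + 1)) by lia.
  cbn [seq sumR fold_right]. fold (sumR (fun x => f (Z.of_nat x - Z.of_nat (S L))%Z)
    (seq 1 (2 * L + 1 + 1))).
  rewrite seq_app, sumR_app. simpl (seq (1 + _) 1). cbn [sumR fold_right].
  rewrite <- seq_shift, sumR_map.
  rewrite (sumR_ext (fun x => f (Z.of_nat (S x) - Z.of_nat (S L))%Z)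
    (fun x => f (Z.of_nat x - Z.of_nat L)%Z)).
  2:{ intros x; f_equal; lia. }
  rewrite Rplus_0_r, Rplus_assoc.
  replace (Z.of_nat 0 - Z.of_nat (S L))%Z with (- Z.of_nat (S L))%Z by lia.
  do 3 f_equal. lia.
Qed.

Lemma summable_Z (f : Z -> R) M : (forall L, sumR (fun k => Rabs (f k)) (zrange L) <= M) ->
  summable f.
Proof.
  intros H; exists M; intros l Hl. destruct (zrange_cover l) as [L HL].
  eapply Rle_trans; [|apply (H L)]. apply sumR_incl_le; auto. intros; apply Rabs_pos.
Qed.

Lemma sumR_box (f : site -> R) L :
  sumR f (box L) = sumR (fun a => sumR (fun b => f (a, b)) (zrange L)) (zrange L).
Proof. exact (sumR_list_prod f (zrange L) (zrange L)). Qed.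

Lemma summable_prod (f g : Z -> R) : summable f -> summable g ->
  summable (fun n : site => f (fst n) * g (snd n)).
Proof.
  intros [M HM] [N HN]. exists (M * N). intros l Hl. destruct (box_cover l) as [L HL].
  eapply Rle_trans. { apply sumR_incl_le; [intros; apply Rabs_pos | auto | apply (HL L); auto]. }
  rewrite sumR_box; simpl.
  rewrite (sumR_ext _ (fun a => Rabs (f a) * sumR (fun b => Rabs (g b)) (zrange L))).
  2:{ intros a. rewrite <- sumR_scal. apply sumR_ext; intros; apply Rabs_mult. }
  rewrite sumR_scal_r. specialize (HM _ (NoDup_zrange L)). specialize (HN _ (NoDup_zrange L)).
  apply Rmult_le_compat; auto; apply sumR_nonneg; intros; apply Rabs_pos.
Qed.

(** Comparison with the integral of x^(-(1+d)) in discrete form, from ln (k + 1) - ln k >= 1 / (k +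
    1) and exp x >= 1 + x. *)
Lemma Rpower_telescope d k : 0 < d -> 0 < k ->
  d * Rpower (k + 1) (- (1 + d)) <= Rpower k (- d) - Rpower (k + 1) (- d).
Proof.
  intros Hd Hk.
  assert (Hl : / (k + 1) <= ln (k + 1) - ln k).
  { pose proof (exp_ineq1_le (ln (k / (k + 1)))) as H.
    rewrite exp_ln in H by (apply Rdiv_lt_0_compat; lra).
    rewrite ln_div in H by lra.
    assert (k / (k + 1) = 1 - / (k + 1)) by (field; lra). lra. }
  assert (H1 : Rpower k (- d) = Rpower (k + 1) (- d) * exp (d * (ln (k + 1) - ln k))).
  { unfold Rpower; rewrite <- exp_plus; f_equal; ring. }
  assert (H2 : Rpower (k + 1) (- (1 + d)) = Rpower (k + 1) (- d) * / (k + 1)).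
  { replace (- (1 + d)) with (- d + - (1)) by ring.
    rewrite Rpower_plus, (Rpower_Ropp _ 1), Rpower_1 by lra.
    reflexivity. }
  rewrite H1, H2. pose proof (exp_ineq1_le (d * (ln (k + 1) - ln k))).
  assert (0 < Rpower (k + 1) (- d)) by apply exp_pos.
  assert (d * / (k + 1) <= d * (ln (k + 1) - ln k)) by (apply Rmult_le_compat_l; lra).
  nra.
Qed.

Lemma summable_Rpower_Z q : 1 < q -> summable (fun k : Z => Rpower (IZR (Z.max 1 (Z.abs k))) (- q)).
Proof.
  intros Hq. set (f := fun k : Z => Rpower (IZR (Z.max 1 (Z.abs k))) (- q)).
  assert (Hf : forall k, 0 < f k) by (intros; apply exp_pos).
  apply summable_Z with (3 + 2 / (q - 1)). intros L.
  rewrite (sumR_ext _ f) by (intros; apply Rabs_pos_eq; left; apply Hf).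
  assert (Hone : forall k, (-1 <= k <= 1)%Z -> f k = 1).
  { intros k Hk; unfold f. replace (Z.max 1 (Z.abs k)) with 1%Z by lia.
    unfold Rpower; rewrite ln_1, Rmult_0_r, exp_0; auto. }
  assert (H2 : 0 < 2 / (q - 1)) by (apply Rdiv_lt_0_compat; lra).
  destruct L as [|L].
  { unfold zrange; simpl. rewrite Hone by lia. lra. }
  (* The bound is sharpened by the telescoping term, so that the induction on [L] closes. *)
  apply Rle_trans with (3 + 2 / (q - 1) * (1 - Rpower (INR (S L)) (- (q - 1)))).
  2:{ assert (0 < Rpower (INR (S L)) (- (q - 1))) by apply exp_pos. nra. }
  induction L as [|L IH].
  - rewrite sumR_zrange_S. unfold zrange; simpl. rewrite !Hone by lia.
    unfold Rpower; rewrite ln_1, Rmult_0_r, exp_0; lra.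
  - rewrite sumR_zrange_S.
    assert (Hv : forall k, Z.abs k = Z.of_nat (S (S L)) -> f k =
      Rpower (INR (S L) + 1) (- (1 + (q - 1)))).
    { intros k Hk; unfold f. rewrite Hk, Z.max_r, <- INR_IZR_INZ, S_INR by lia. f_equal; ring. }
    rewrite !Hv by lia.
    pose proof (Rpower_telescope (q - 1) (INR (S L))) as Ht.
    assert (0 < INR (S L)) by (apply lt_0_INR; lia).
    specialize (Ht ltac:(lra) H). rewrite (S_INR (S L)).
    set (a := Rpower (INR (S L) + 1) (- (1 + (q - 1)))) in *.
    set (b := Rpower (INR (S L)) (- (q - 1))) in *.
    set (c := Rpower (INR (S L) + 1) (- (q - 1))) in *.
    assert (2 * a <= 2 / (q - 1) * (b - c)).
    { replace (2 * a) with (2 / (q - 1) * ((q - 1) * a)) by (field; lra).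
      apply Rmult_le_compat_l; lra. }
    lra.
Qed.

(** * The weights |n|^(-p) and their second moment *)

Definition zero_site : site := (0%Z, 0%Z).

Definition weight (p : R) (n : site) : R := if site_eqb n zero_site then 0 else /
  dpow p n zero_site.

Lemma site_eqb_spec x y : reflect (x = y) (site_eqb x y).
Proof.
  destruct x as [x1 x2], y as [y1 y2]; unfold site_eqb; simpl.
  destruct (Z.eqb_spec x1 y1), (Z.eqb_spec x2 y2); simpl; constructor; congruence.
Qed.

Lemma dpow_pos p x y : 0 < dpow p x y.
Proof. apply exp_pos. Qed.

Lemma weight_nonneg p n : 0 <= weight p n.
Proof.
  unfold weight; destruct (site_eqb n zero_site); [lra|].
  left; apply Rinv_0_lt_compat, dpow_pos.
Qed.

Definition norm2 (n : site) : R := IZR (fst n) ^ 2 + IZR (snd n) ^ 2.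

Lemma dist2_norm2 n : IZR (dist2 n zero_site) = norm2 n.
Proof.
  unfold dist2, norm2, zero_site; simpl fst; simpl snd.
  rewrite !Z.sub_0_r, plus_IZR, !Z.pow_2_r, !mult_IZR. ring.
Qed.

Lemma norm2_ge_1 n : n <> zero_site -> 1 <= norm2 n.
Proof.
  intros Hn. rewrite <- dist2_norm2. apply IZR_le. unfold dist2, zero_site; simpl.
  destruct n as [a b]; simpl. assert (a <> 0 \/ b <> 0)%Z; [|nia].
  destruct (Z.eq_dec a 0), (Z.eq_dec b 0); auto. exfalso; apply Hn; subst; reflexivity.
Qed.

Lemma weight_Rpower p n : n <> zero_site -> weight p n = Rpower (norm2 n) (- (p / 2)).
Proof.
  intros Hn; unfold weight, dpow. destruct (site_eqb_spec n zero_site); [easy|].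
  rewrite dist2_norm2, Rpower_Ropp; auto.
Qed.

Lemma weight_zero p : weight p zero_site = 0.
Proof. reflexivity. Qed.

(** Here p > 4 means q = p/2 - 1 > 1. Since |n|^2 >= max(1, |n1|) max(1, |n2|), the function
    |n|^(2-p) is bounded by a product of two summable one-dimensional powers. *)
Lemma summable_norm2_weight p : 4 < p -> summable (fun n => norm2 n * weight p n).
Proof.
  intros Hp. set (q := p / 2 - 1). assert (Hq : 1 < q) by (unfold q; lra).
  apply summable_le with (fun n => Rpower (IZR (Z.max 1 (Z.abs (fst n)))) (- q)
                                   * Rpower (IZR (Z.max 1 (Z.abs (snd n)))) (- q)).
  2:{ apply (summable_prod (fun k => Rpower (IZR (Z.max 1 (Z.abs k))) (- q))
               (fun k => Rpower (IZR (Z.max 1 (Z.abs k))) (- q))); apply summable_Rpower_Z; auto. }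
  intros n. destruct (site_eqb_spec n zero_site) as [->|Hn].
  { rewrite weight_zero, Rmult_0_r, Rabs_R0. left; apply Rmult_lt_0_compat; apply exp_pos. }
  pose proof (norm2_ge_1 n Hn) as H1.
  rewrite weight_Rpower by auto.
  replace (norm2 n * Rpower (norm2 n) (- (p / 2))) with (Rpower (norm2 n) (- q)).
  2:{ rewrite <- (Rpower_1 (norm2 n)) at 2 by lra. rewrite <- Rpower_plus. f_equal; unfold q; lra. }
  rewrite Rabs_pos_eq by (left; apply exp_pos).
  assert (HA : 0 < IZR (Z.max 1 (Z.abs (fst n)))) by (apply IZR_lt; lia).
  assert (HB : 0 < IZR (Z.max 1 (Z.abs (snd n)))) by (apply IZR_lt; lia).
  rewrite Rpower_mult_distr, !Rpower_Ropp by auto.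
  apply Rinv_le_contravar; [apply exp_pos|].
  apply Rle_Rpower_l; [lra|]. split; [apply Rmult_lt_0_compat; auto|].
  rewrite <- mult_IZR, <- dist2_norm2. apply IZR_le.
  destruct n as [a b]; unfold dist2, zero_site; cbn [fst snd].
  assert (a <> 0 \/ b <> 0)%Z.
  { destruct (Z.eq_dec a 0), (Z.eq_dec b 0); auto. exfalso; apply Hn; subst; reflexivity. }
  rewrite !Z.sub_0_r.
  replace (a ^ 2)%Z with (Z.abs a * Z.abs a)%Z by nia.
  replace (b ^ 2)%Z with (Z.abs b * Z.abs b)%Z by nia.
  generalize (Z.abs_nonneg a), (Z.abs_nonneg b).
  assert (Z.abs a <> 0 \/ Z.abs b <> 0)%Z by lia. revert H0.
  generalize (Z.abs a), (Z.abs b); intros u v; intros.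
  destruct (Z.max_spec 1 u) as [[? ->]|[? ->]], (Z.max_spec 1 v) as [[? ->]|[? ->]]; nia.
Qed.

(** The usual summability test below: with a finite second moment, any factor of at most quadratic
    growth is allowed. *)
Lemma summable_weight_mult p (c : site -> R) C : 4 < p ->
  (forall n, n <> zero_site -> Rabs (c n) <= C * norm2 n) -> summable (fun n => weight p n * c n).
Proof.
  intros Hp Hc. apply summable_le with (fun n => C * (norm2 n * weight p n)).
  2:{ apply summable_scal, summable_norm2_weight; auto. }
  intros n. destruct (site_eqb_spec n zero_site) as [->|Hn].
  { rewrite weight_zero, !Rmult_0_l, !Rmult_0_r, Rabs_R0. lra. }
  rewrite Rabs_mult, (Rabs_pos_eq (weight p n)) by apply weight_nonneg.
  specialize (Hc n Hn). pose proof (weight_nonneg p n). nra.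
Qed.

Lemma summable_weight p : 4 < p -> summable (weight p).
Proof.
  intros Hp. apply summable_le with (fun n => weight p n * 1).
  - intros n; rewrite Rmult_1_r, Rabs_pos_eq; [lra | apply weight_nonneg].
  - apply summable_weight_mult with 1; auto. intros n Hn; rewrite Rabs_R1.
    pose proof (norm2_ge_1 n Hn); lra.
Qed.

Lemma Rabs_fst_le_norm2 n : Rabs (IZR (fst n)) <= norm2 n.
Proof.
  unfold norm2. rewrite <- abs_IZR.
  assert (IZR (Z.abs (fst n)) <= IZR (fst n ^ 2)) by (apply IZR_le; nia).
  rewrite Z.pow_2_r, mult_IZR in H. nra.
Qed.

(** * The binomial series in the complex disc *)

Lemma is_lim_seq_inv_S : is_lim_seq (fun m => / INR (S m)) 0.
Proof.
  apply (is_lim_seq_incr_1 (fun n => / INR n)).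
  replace (Finite 0) with (Rbar_inv p_infty) by reflexivity.
  apply is_lim_seq_inv; [apply is_lim_seq_INR | discriminate].
Qed.

Lemma is_lim_seq_square (u : nat -> R) (l : R) :
  is_lim_seq u l -> is_lim_seq (fun n => u n ^ 2) (l ^ 2).
Proof.
  intros Hu; simpl. apply is_lim_seq_mult'; auto. apply is_lim_seq_mult'; auto.
  apply is_lim_seq_const.
Qed.

(* The coefficients of (1 - q)^(-s) = sum_n binc s n q^n. *)
Fixpoint binc (s : R) (n : nat) : R :=
  match n with O => 1 | S m => binc s m * ((s + INR m) / (INR m + 1)) end.

Lemma binc_pos s n : 0 < s -> 0 < binc s n.
Proof.
  intros Hs; induction n as [|n IH]; simpl; [lra|].
  pose proof (pos_INR n). apply Rmult_lt_0_compat; auto. apply Rdiv_lt_0_compat; lra.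
Qed.

Lemma CV_radius_binc s : 0 < s -> CV_radius (binc s) = Finite 1.
Proof.
  intros Hs. rewrite (CV_radius_finite_DAlembert _ 1); [f_equal; lra | | lra |].
  - intros n; pose proof (binc_pos s n Hs); lra.
  - apply is_lim_seq_ext with (fun n => 1 + (s - 1) * / (INR n + 1)).
    + intros n. pose proof (binc_pos s n Hs). pose proof (pos_INR n).
      cbn [binc]. replace (binc s n * ((s + INR n) / (INR n + 1)) / binc s n)
        with ((s + INR n) / (INR n + 1)) by (field; lra).
      rewrite Rabs_pos_eq; [field; lra|]. apply Rdiv_le_0_compat; lra.
    + replace (Finite 1) with (Finite (1 + (s - 1) * 0)) by (f_equal; ring).
      apply is_lim_seq_plus'; [apply is_lim_seq_const|].
      apply is_lim_seq_mult'; [apply is_lim_seq_const|].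
      apply is_lim_seq_ext with (2 := is_lim_seq_inv_S). intros n; rewrite S_INR; auto.
Qed.

Lemma CV_radius_le_compat (a b : nat -> R) :
  (forall n, Rabs (a n) <= Rabs (b n)) -> Rbar_le (CV_radius b) (CV_radius a).
Proof.
  intros H. destruct (CV_radius_bounded b) as [_ Hb]. apply Hb. intros r [M HM].
  destruct (CV_radius_bounded a) as [Ha _]. apply Ha. exists M; intros n.
  eapply Rle_trans; [|apply HM]. rewrite !Rabs_mult. apply Rmult_le_compat_r; auto. apply Rabs_pos.
Qed.

Lemma CV_radius_trig s phi (T : R -> R) x : 0 < s -> (forall t, Rabs (T t) <= 1) -> Rabs x < 1 ->
  Rbar_lt (Rabs x) (CV_radius (fun n => binc s n * T (INR n * phi))).
Proof.
  intros Hs HT Hx. apply Rbar_lt_le_trans with (CV_radius (binc s)).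
  - rewrite CV_radius_binc by auto. exact Hx.
  - apply CV_radius_le_compat. intros n. rewrite Rabs_mult.
    pose proof (HT (INR n * phi)). pose proof (Rabs_pos (binc s n)). nra.
Qed.

Lemma Rabs_cos_le t : Rabs (cos t) <= 1.
Proof. apply Rabs_le, COS_bound. Qed.

Lemma Rabs_sin_le t : Rabs (sin t) <= 1.
Proof. apply Rabs_le, SIN_bound. Qed.

Lemma Rpower_1_base s : Rpower 1 s = 1.
Proof. unfold Rpower; rewrite ln_1, Rmult_0_r, exp_0; reflexivity. Qed.

Lemma mod2_pos x phi : Rabs x < 1 -> 0 < 1 - 2 * x * cos phi + x ^ 2.
Proof.
  intros Hx. apply Rabs_def2 in Hx. pose proof (COS_bound phi).
  pose proof (sin2_cos2 phi) as H2. unfold Rsqr in H2.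
  destruct (Rle_lt_dec 0 x).
  - assert (0 < (1 - x) * (1 - x)) by nra. nra.
  - assert (0 < (1 + x) * (1 + x)) by nra. nra.
Qed.

(* |1 - q|^(-2s) for q = x e^(i phi), by the binomial series: both sides solve the same linear
   differential equation in x. *)
Lemma binomial_series_norm s phi x : 0 < s -> 0 <= x < 1 ->
  PSeries (fun n => binc s n * cos (INR n * phi)) x ^ 2
  + PSeries (fun n => binc s n * sin (INR n * phi)) x ^ 2
  = Rpower (1 - 2 * x * cos phi + x ^ 2) (- s).
Proof.
  intros Hs Hx.
  set (a := fun n => binc s n * cos (INR n * phi)).
  set (d := fun n => binc s n * sin (INR n * phi)).
  assert (Ha : forall y, Rabs y < 1 -> Rbar_lt (Rabs y) (CV_radius a)).
  { intros y Hy; apply (CV_radius_trig s phi cos); auto using Rabs_cos_le. }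
  assert (Hd : forall y, Rabs y < 1 -> Rbar_lt (Rabs y) (CV_radius d)).
  { intros y Hy; apply (CV_radius_trig s phi sin); auto using Rabs_sin_le. }
  set (P' := PSeries (PS_derive a)). set (Q' := PSeries (PS_derive d)).
  assert (Hinc : forall (b : nat -> R) n, PS_incr_1 (PS_derive b) n = INR n * b n).
  { intros b [|n]; [simpl; unfold zero; simpl; ring | reflexivity]. }
  assert (Hr : forall n, INR (S n) * binc s (S n) = (s + INR n) * binc s n).
  { intros n; rewrite S_INR; simpl. pose proof (pos_INR n). field; lra. }
  (* A recursion (n + 1) b(n + 1) = (s + n) (u b(n) + v e(n)) between coefficients becomes a linear
     relation between the sums and their derivatives. *)
  assert (Hlin : forall (b e : nat -> R) u v y,
    Rbar_lt (Rabs y) (CV_radius b) -> Rbar_lt (Rabs y) (CV_radius e) ->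
    (forall n, PS_derive b n = (s + INR n) * (u * b n + v * e n)) ->
    PSeries (PS_derive b) y = s * (u * PSeries b y + v * PSeries e y)
      + y * (u * PSeries (PS_derive b) y + v * PSeries (PS_derive e) y)).
  { intros b e u v y Hb He Hrec.
    assert (Hex : forall (g : nat -> R) c, Rbar_lt (Rabs y) (CV_radius g) ->
      ex_pseries (PS_scal c g) y).
    { intros g c Hg. apply ex_pseries_scal; [apply Rmult_comm | apply CV_radius_inside; auto]. }
    assert (Hex' : forall (g : nat -> R) c, Rbar_lt (Rabs y) (CV_radius g) ->
      ex_pseries (PS_scal c (PS_incr_1 (PS_derive g))) y).
    { intros g c Hg. apply Hex. rewrite CV_radius_incr_1, CV_radius_derive; auto. }
    transitivity (PSeries (PS_plus (PS_plus (PS_scal (s * u) b) (PS_scal (s * v) e))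
      (PS_plus (PS_scal u (PS_incr_1 (PS_derive b))) (PS_scal v (PS_incr_1 (PS_derive e))))) y).
    - apply PSeries_ext; intros n. rewrite Hrec. unfold PS_plus, PS_scal. rewrite !Hinc.
      unfold plus, scal; simpl. unfold mult; simpl. ring.
    - rewrite PSeries_plus, PSeries_plus, PSeries_plus, !PSeries_scal, !PSeries_incr_1.
      + ring.
      + apply Hex'; auto.
      + apply Hex'; auto.
      + apply Hex; auto.
      + apply Hex; auto.
      + apply ex_pseries_plus; apply Hex; auto.
      + apply ex_pseries_plus; apply Hex'; auto. }
  (* For G = [PSeries a] + i [PSeries d] and w = exp (i phi), [HP] and [HQ] are the real and
     imaginary parts of G' = s w G + y w G', that is (1 - y w) G' = s w G. *)
  assert (HP : forall y, Rabs y < 1 -> P' y = s * (cos phi * PSeries a y + - sin phi * PSeries d y)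
                                        + y * (cos phi * P' y + - sin phi * Q' y)).
  { intros y Hy. apply Hlin; auto. intros n. unfold PS_derive, a, d.
    rewrite <- Rmult_assoc, Hr, S_INR.
    replace ((INR n + 1) * phi) with (INR n * phi + phi) by ring. rewrite cos_plus. ring. }
  assert (HQ : forall y, Rabs y < 1 -> Q' y = s * (cos phi * PSeries d y + sin phi * PSeries a y)
                                        + y * (cos phi * Q' y + sin phi * P' y)).
  { intros y Hy. apply Hlin; auto. intros n. unfold PS_derive, a, d.
    rewrite <- Rmult_assoc, Hr, S_INR.
    replace ((INR n + 1) * phi) with (INR n * phi + phi) by ring. rewrite sin_plus. ring. }
  (* This is |G|^2 |1 - y w|^(2 s); it is constant, hence equal to its value 1 at 0. *)
  set (F := fun y => (PSeries a y ^ 2 + PSeries d y ^ 2) * Rpower (1 - 2 * y * cos phi + y ^ 2) s).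
  assert (HF : forall y, Rabs y < 1 -> is_derive F y 0).
  { intros y Hy. pose proof (mod2_pos y phi Hy) as Hm.
    pose proof (is_derive_PSeries a y (Ha y Hy)) as DP. fold (P' y) in DP.
    pose proof (is_derive_PSeries d y (Hd y Hy)) as DQ. fold (Q' y) in DQ.
    specialize (HP y Hy); specialize (HQ y Hy).
    set (m := 1 - 2 * y * cos phi + y ^ 2) in *.
    assert (DR : is_derive (fun y => Rpower (1 - 2 * y * cos phi + y ^ 2) s) y
                   ((- 2 * cos phi + 2 * y) * (s * Rpower m (s - 1)))).
    { apply (is_derive_comp (fun z => Rpower z s) (fun y => 1 - 2 * y * cos phi + y ^ 2)).
      - apply is_derive_Reals, derivable_pt_lim_power; auto.
      - auto_derive; auto. ring. }
    assert (Hp1 : Rpower m (s - 1) = Rpower m s / m).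
    { unfold Rminus; rewrite Rpower_plus, Rpower_Ropp, Rpower_1; auto. }
    unfold F.
    evar_last.
    { apply @is_derive_mult; [|exact DR|intros; apply Rmult_comm].
      apply @is_derive_plus; [apply is_derive_pow; exact DP | apply is_derive_pow; exact DQ]. }
    unfold plus, mult; simpl. rewrite Hp1.
    replace (1 - 2 * y * cos phi + y * (y * 1)) with m by (unfold m; ring).
    set (p := PSeries a y) in *. set (q := PSeries d y) in *. set (p' := P' y) in *.
    set (q' := Q' y) in *.
    replace ((1 + 1) * p' * (p * 1) + (1 + 1) * q' * (q * 1)) with (2 * (p * p' + q * q')) by ring.
    (* [HA] and [HB] form a linear system of determinant [m] in p' and q'; solving it gives [m]
       times half the derivative of |G|^2. *)
    assert (K : m * (p * p' + q * q') = s * (cos phi - y) * (p ^ 2 + q ^ 2)).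
    { pose proof (sin2_cos2 phi) as Hsc. unfold Rsqr in Hsc.
      set (c := cos phi) in *. set (t := sin phi) in *.
      assert (HA : (1 - y * c) * p' + y * t * q' = s * (c * p - t * q)) by lra.
      assert (HB : (1 - y * c) * q' - y * t * p' = s * (c * q + t * p)) by lra.
      assert (Hmm : m = (1 - y * c) ^ 2 + (y * t) ^ 2) by (unfold m; nra).
      assert (E1 : m * p' = (1 - y * c) * (s * (c * p - t * q)) - y * t * (s * (c * q + t * p)))
        by (rewrite <- HA, <- HB, Hmm; ring).
      assert (E2 : m * q' = (1 - y * c) * (s * (c * q + t * p)) + y * t * (s * (c * p - t * q)))
        by (rewrite <- HA, <- HB, Hmm; ring).
      replace (m * (p * p' + q * q')) with (p * (m * p') + q * (m * q')) by ring.
      rewrite E1, E2.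
      replace (s * (c - y) * (p ^ 2 + q ^ 2)) with (s * (c - y * (t * t + c * c)) * (p ^ 2 + q ^ 2))
        by (rewrite Hsc; ring). ring. }
    replace (p * p' + q * q') with (s * (cos phi - y) * (p ^ 2 + q ^ 2) / m)
      by (rewrite <- K; field; lra).
    field. lra. }
  assert (HF0 : F x = 1).
  { destruct (Req_dec x 0) as [->|Hx0].
    - unfold F. rewrite !PSeries_0. unfold a, d; simpl. rewrite Rmult_0_l, cos_0, sin_0.
      replace (1 - 2 * 0 * cos phi + 0 * (0 * 1)) with 1 by ring.
      rewrite Rpower_1_base; ring.
    - rewrite <- (eq_is_derive F 0 x).
      + unfold F. rewrite !PSeries_0. unfold a, d; simpl. rewrite Rmult_0_l, cos_0, sin_0.
        replace (1 - 2 * 0 * cos phi + 0 * (0 * 1)) with 1 by ring.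
        rewrite Rpower_1_base; ring.
      + intros t Ht; apply HF. rewrite Rabs_pos_eq; lra.
      + lra. }
  unfold F in HF0. rewrite Rpower_Ropp.
  assert (0 < Rpower (1 - 2 * x * cos phi + x ^ 2) s) by apply exp_pos.
  apply Rmult_eq_reg_r with (Rpower (1 - 2 * x * cos phi + x ^ 2) s); [|lra].
  rewrite HF0. field; lra.
Qed.

(** * Positive mixtures of exponentials *)

Lemma sumR_seq_S (f : nat -> R) n : sumR f (seq 0 (S n)) = sumR f (seq 0 n) + f n.
Proof. rewrite seq_S, sumR_app; simpl; ring. Qed.

Lemma sumR_seq_sum_n (f : nat -> R) n : sumR f (seq 0 (S n)) = sum_n f n.
Proof.
  induction n as [|n IH]; [rewrite sum_O; simpl; ring|].
  rewrite sumR_seq_S, IH, sum_Sn; reflexivity.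
Qed.

(** * Fejer weights *)

Lemma sumR_seq_indicator n z :
  sumR (fun l => if Z.eqb (Z.of_nat l) z then 1 else 0) (seq 0 n)
  = if (Z.leb 0 z && Z.ltb z (Z.of_nat n))%bool then 1 else 0.
Proof.
  induction n as [|n IH].
  - simpl. destruct (Z.leb_spec 0 z), (Z.ltb_spec z 0); simpl; auto; lia.
  - rewrite sumR_seq_S, IH.
    destruct (Z.leb_spec 0 z), (Z.ltb_spec z (Z.of_nat n)), (Z.ltb_spec z (Z.of_nat (S n))),
      (Z.eqb_spec (Z.of_nat n) z); simpl; lia || lra.
Qed.

Lemma sumR_mult {A B} (f : A -> R) (g : B -> R) la lb :
  sumR f la * sumR g lb = sumR (fun a => sumR (fun b => f a * g b) lb) la.
Proof.
  rewrite <- sumR_scal_r. apply sumR_ext; intros a. rewrite sumR_scal; reflexivity.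
Qed.

(** The triangular weight max(0, 1 - |m| / N), written as a count of pairs with j - l = m so that
    its trigonometric sums are recognisable as squares. *)
Definition fejer (N : nat) (m : Z) : R :=
  / INR N * sumR (fun j => sumR (fun l => if Z.eqb (Z.of_nat l) (Z.of_nat j - m) then 1 else 0)
                               (seq 0 N)) (seq 0 N).

Lemma fejer_bounds N m : 0 <= fejer N m <= 1.
Proof.
  unfold fejer. destruct N as [|N]; [simpl; lra|].
  assert (0 < INR (S N)) by (apply lt_0_INR; lia).
  assert (0 < / INR (S N)) by (apply Rinv_0_lt_compat; auto).
  split.
  - apply Rmult_le_pos; [lra|]. apply sumR_nonneg; intros; apply sumR_nonneg; intros.
    destruct (Z.eqb _ _); lra.
  - apply Rmult_le_reg_l with (INR (S N)); auto.
    rewrite <- Rmult_assoc, Rinv_r, Rmult_1_l, Rmult_1_r by lra.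
    apply Rle_trans with (sumR (fun _ => 1) (seq 0 (S N))).
    + apply sumR_le_in; intros j _. rewrite sumR_seq_indicator. destruct (andb _ _); lra.
    + rewrite sumR_const, length_seq; lra.
Qed.

Lemma fejer_out N m : ~ In m (zrange N) -> fejer N m = 0.
Proof.
  intros Hm. rewrite in_zrange in Hm. unfold fejer. rewrite sumR_0; [ring|].
  intros j Hj. apply in_seq in Hj. apply sumR_0. intros l Hl. apply in_seq in Hl.
  destruct (Z.eqb_spec (Z.of_nat l) (Z.of_nat j - m)); auto. lia.
Qed.

Lemma fejer_opp N m : fejer N (- m) = fejer N m.
Proof.
  unfold fejer. rewrite sumR_swap. f_equal. apply sumR_ext; intros j; apply sumR_ext; intros l.
  destruct (Z.eqb_spec (Z.of_nat j) (Z.of_nat l - - m)), (Z.eqb_spec (Z.of_nat l) (Z.of_nat j - m));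
    auto; lia.
Qed.

Lemma fejer_lim m : is_lim_seq (fun N => fejer N m) 1.
Proof.
  assert (H : forall m N, (0 <= m)%Z -> 1 - IZR m * / INR (S N) <= fejer (S N) m).
  { clear m; intros m N Hm. unfold fejer.
    assert (HN : 0 < INR (S N)) by (apply lt_0_INR; lia).
    apply Rmult_le_reg_l with (INR (S N)); auto.
    rewrite <- Rmult_assoc, Rinv_r, Rmult_1_l by lra.
    replace (INR (S N) * (1 - IZR m * / INR (S N))) with (INR (S N) - IZR m) by (field; lra).
    rewrite (sumR_ext_in _ (fun j => if Z.leb m (Z.of_nat j) then 1 else 0)).
    2:{ intros j Hj; apply in_seq in Hj. rewrite sumR_seq_indicator.
        destruct (Z.leb_spec 0 (Z.of_nat j - m)), (Z.ltb_spec (Z.of_nat j - m) (Z.of_nat (S N))),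
          (Z.leb_spec m (Z.of_nat j)); simpl; auto; lia. }
    clear HN; generalize (S N); intros n; induction n as [|n IH].
    - simpl. apply IZR_le in Hm; lra.
    - rewrite sumR_seq_S, S_INR. destruct (Z.leb_spec m (Z.of_nat n)); [lra|].
      assert (0 <= sumR (fun j => if Z.leb m (Z.of_nat j) then 1 else 0) (seq 0 n)).
      { apply sumR_nonneg; intros; destruct (Z.leb _ _); lra. }
      assert (IZR (Z.of_nat n + 1) <= IZR m) by (apply IZR_le; lia).
      rewrite plus_IZR, <- INR_IZR_INZ in H1. lra. }
  apply is_lim_seq_incr_1.
  apply is_lim_seq_le_le with (u := fun N => 1 - IZR (Z.abs m) * / INR (S N)) (w := fun _ => 1).
  - intros N; split; [|apply fejer_bounds].
    destruct (Z.abs_eq_or_opp m) as [E|E].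
    + rewrite E; apply H; lia.
    + rewrite E, <- fejer_opp; apply H; lia.
  - replace (Finite 1) with (Finite (1 - IZR (Z.abs m) * 0)) by (f_equal; ring).
    apply is_lim_seq_minus'; [apply is_lim_seq_const|].
    apply is_lim_seq_mult'; [apply is_lim_seq_const | apply is_lim_seq_inv_S].
  - apply is_lim_seq_const.
Qed.

(** [N] times this sum is |sum_j exp (i th j)|^2, the sum of the squares of a cosine sum and a sine
    sum. *)
Lemma fejer_positive N th : 0 <= sumR (fun m => fejer N m * cos (th * IZR m)) (zrange N).
Proof.
  unfold fejer.
  rewrite (sumR_ext _ (fun m => / INR N * sumR (fun j => sumR (fun l =>
     if Z.eqb (Z.of_nat l) (Z.of_nat j - m) then cos (th * IZR m) else 0) (seq 0 N)) (seq 0 N))).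
  2:{ intros m. rewrite Rmult_assoc, <- sumR_scal_r. f_equal. apply sumR_ext; intros j.
      rewrite <- sumR_scal_r. apply sumR_ext; intros l. destruct (Z.eqb _ _); ring. }
  rewrite sumR_scal.
  apply Rmult_le_pos.
  { destruct N; [simpl; rewrite Rinv_0; lra|]. left; apply Rinv_0_lt_compat, lt_0_INR; lia. }
  rewrite sumR_swap.
  rewrite (sumR_ext_in _ (fun j => sumR (fun l => cos (th * INR j) * cos (th * INR l)
                                                 + sin (th * INR j) * sin (th * INR l)) (seq 0 N))).
  - rewrite (sumR_ext _ (fun j => sumR (fun l => cos (th * INR j) * cos (th * INR l)) (seq 0 N)
                       + sumR (fun l => sin (th * INR j) * sin (th * INR l)) (seq 0 N)))
      by (intros; apply sumR_plus).
    rewrite sumR_plus, <- !sumR_mult. nra.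
  - intros j Hj. apply in_seq in Hj. rewrite sumR_swap. apply sumR_ext_in; intros l Hl.
    apply in_seq in Hl.
    rewrite <- cos_minus, <- Rmult_minus_distr_l, !INR_IZR_INZ, <- minus_IZR.
    set (z := (Z.of_nat j - Z.of_nat l)%Z).
    rewrite (sumR_ext _ (fun m => if Z.eqb m z then cos (th * IZR z) else 0)).
    2:{ intros m; destruct (Z.eqb_spec (Z.of_nat l) (Z.of_nat j - m)), (Z.eqb_spec m z);
        unfold z in *; subst; auto; lia. }
    assert (Hz : In z (zrange N)) by (apply in_zrange; unfold z; lia).
    apply in_split in Hz. destruct Hz as (l1 & l2 & E). rewrite E.
    pose proof (NoDup_zrange N) as Hn. rewrite E in Hn. apply NoDup_remove_2 in Hn.
    rewrite in_app_iff in Hn. rewrite sumR_app; simpl. rewrite Z.eqb_refl.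
    rewrite !sumR_0; [ring| |]; intros x Hx; destruct (Z.eqb_spec x z); auto; subst; tauto.
Qed.

Lemma exp_pow x n : exp x ^ n = exp (INR n * x).
Proof.
  induction n as [|n IH]; [simpl; rewrite Rmult_0_l, exp_0; auto|].
  rewrite S_INR; simpl pow. rewrite IH, <- exp_plus. f_equal; ring.
Qed.

Definition partial (T : R -> R) (s r phi : R) (K : nat) : R :=
  sumR (fun i => binc s i * T (INR i * phi) * r ^ i) (seq 0 K).

Lemma partial_lim T s r phi : 0 < s -> (forall t, Rabs (T t) <= 1) -> 0 <= r < 1 ->
  is_lim_seq (partial T s r phi) (PSeries (fun n => binc s n * T (INR n * phi)) r).
Proof.
  intros Hs HT Hr. apply is_lim_seq_incr_1.
  apply is_lim_seq_ext with (sum_n (fun i => binc s i * T (INR i * phi) * r ^ i)).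
  { intros n; symmetry; apply sumR_seq_sum_n. }
  apply (Series_correct (fun i => binc s i * T (INR i * phi) * r ^ i)).
  apply ex_series_Rabs.
  apply (CV_disk_inside (fun i => binc s i * T (INR i * phi))).
  apply CV_radius_trig; auto. rewrite Rabs_pos_eq; lra.
Qed.

(** The bound is independent of [K], of the angle and of r <= r1, as needed to let [K] tend to
    infinity under a lattice sum. *)
Lemma partial_bound T s r r1 phi K : 0 < s -> (forall t, Rabs (T t) <= 1) -> 0 <= r <= r1 -> r1 <
  1 ->
  Rabs (partial T s r phi K) <= PSeries (binc s) r1.
Proof.
  intros Hs HT Hr Hr1.
  apply Rle_trans with (sumR (fun i => binc s i * r1 ^ i) (seq 0 K)).
  - unfold partial; eapply Rle_trans; [apply sumR_Rabs|]. apply sumR_le_in; intros i _.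
    pose proof (binc_pos s i Hs). specialize (HT (INR i * phi)).
    rewrite !Rabs_mult, (Rabs_pos_eq (binc s i)), (Rabs_pos_eq (r ^ i)) by (try apply pow_le; lra).
    assert (r ^ i <= r1 ^ i) by (apply pow_incr; lra).
    assert (0 <= r ^ i) by (apply pow_le; lra).
    pose proof (Rabs_pos (T (INR i * phi))).
    apply Rle_trans with (binc s i * 1 * r ^ i).
    + apply Rmult_le_compat_r; auto. apply Rmult_le_compat_l; lra.
    + rewrite Rmult_1_r. apply Rmult_le_compat_l; lra.
  - assert (Hl : is_lim_seq (fun K => sumR (fun i => binc s i * r1 ^ i) (seq 0 K))
      (PSeries (binc s) r1)).
    { apply is_lim_seq_ext with (partial (fun _ => 1) s r1 0).
      - intros n; unfold partial; apply sumR_ext; intros; ring.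
      - rewrite (PSeries_ext _ (fun n => binc s n * (fun _ => 1) (INR n * 0))) by (intros; ring).
        apply partial_lim; [auto | | lra]. intros; rewrite Rabs_R1; lra. }
    apply (is_lim_seq_incr_compare _ _ Hl).
    intros n; rewrite sumR_seq_S. pose proof (binc_pos s n Hs).
    assert (0 <= r1 ^ n) by (apply pow_le; lra). nra.
Qed.

(** On the slab |n2| <= N one has |n|^2 <= (1 + N^2) n1^2, which turns a bound by |n1|^(-p) into a
    multiple of the summable weight. *)
Lemma Rpower_slab p n N : 0 < p -> fst n <> 0%Z -> In (snd n) (zrange N) ->
  Rpower (IZR (Z.abs (fst n))) (- p) <= Rpower (1 + INR N ^ 2) (p / 2) * weight p n.
Proof.
  intros Hp Hn Hm. apply in_zrange in Hm.
  assert (Hz : n <> zero_site) by (intros ->; apply Hn; reflexivity).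
  rewrite weight_Rpower by auto. set (k := IZR (Z.abs (fst n))).
  assert (Hk : 1 <= k) by (apply IZR_le; lia).
  assert (Hk2 : k ^ 2 = IZR (fst n) ^ 2) by (unfold k; rewrite abs_IZR, <- !Rsqr_pow2; symmetry;
    apply Rsqr_abs).
  pose proof (norm2_ge_1 n Hz).
  assert (Hle : norm2 n <= (1 + INR N ^ 2) * (k * k)).
  { unfold norm2. assert (IZR (snd n) ^ 2 <= INR N ^ 2).
    { rewrite INR_IZR_INZ. simpl; rewrite !Rmult_1_r, <- !mult_IZR. apply IZR_le. nia. }
    rewrite <- Hk2. assert (1 <= k * k) by nra. set (M := INR N ^ 2) in *.
    assert (0 <= M) by (unfold M; apply pow2_ge_0).
    assert (M * 1 <= M * (k * k)) by (apply Rmult_le_compat_l; lra). lra. }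
  assert (E : Rpower k (- p) = Rpower (k * k) (- (p / 2))).
  { rewrite <- Rpower_mult_distr, <- Rpower_plus by lra. f_equal; lra. }
  rewrite E, !Rpower_Ropp.
  assert (0 < 1 + INR N ^ 2) by nra.
  assert (0 < Rpower (norm2 n) (p / 2)) by apply exp_pos.
  assert (0 < Rpower (k * k) (p / 2)) by apply exp_pos.
  assert (Rpower (norm2 n) (p / 2) <= Rpower (1 + INR N ^ 2) (p / 2) * Rpower (k * k) (p / 2)).
  { rewrite Rpower_mult_distr by nra. apply Rle_Rpower_l; lra. }
  apply Rmult_le_reg_r with (Rpower (norm2 n) (p / 2)); auto.
  rewrite Rmult_assoc, Rinv_l, Rmult_1_r by lra.
  apply Rmult_le_reg_l with (Rpower (k * k) (p / 2)); auto.
  rewrite <- Rmult_assoc, Rinv_r, Rmult_1_l by lra. lra.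
Qed.

Definition nonneg_sum {A} (f : A -> R) : Prop := exists S, 0 <= S /\ has_sum f S.

Lemma nonneg_sum_ext {A} (f g : A -> R) : (forall x, f x = g x) -> nonneg_sum f -> nonneg_sum g.
Proof. intros H [S [H0 HS]]; exists S; split; auto. apply has_sum_ext with f; auto. Qed.

Lemma nonneg_sum_scal {A} c (f : A -> R) : 0 <= c -> nonneg_sum f -> nonneg_sum (fun x => c * f x).
Proof.
  intros Hc [S [H0 HS]]; exists (c * S); split;
    [apply Rmult_le_pos; auto | apply has_sum_scal; auto].
Qed.

Lemma nonneg_sum_sumR {A B} (F : B -> A -> R) lb :
  (forall b, In b lb -> nonneg_sum (F b)) -> nonneg_sum (fun a => sumR (fun b => F b a) lb).
Proof.
  induction lb as [|b lb IH]; simpl; intros H.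
  - exists 0; split; [lra | apply has_sum_0].
  - destruct (H b) as [S [HS0 HS]]; auto. destruct IH as [T [HT0 HT]]; auto.
    exists (S + T); split; [lra | apply has_sum_plus; auto].
Qed.

Lemma nonneg_sum_dominated (F : nat -> site -> R) (f g : site -> R) :
  summable g -> (forall m x, Rabs (F m x) <= g x) ->
    (forall x, is_lim_seq (fun m => F m x) (f x)) ->
  (forall m, nonneg_sum (F m)) -> nonneg_sum f.
Proof.
  intros Hg HF Hl Hn.
  assert (Hf : summable f).
  { apply summable_le with g; auto. intros x.
    apply (is_lim_seq_le (fun m => Rabs (F m x)) (fun _ => g x) (Rabs (f x)) (g x)); auto.
    - apply (is_lim_seq_abs _ (f x)); auto.
    - apply is_lim_seq_const. }
  exists (zsum f); split; [|apply has_sum_zsum; auto].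
  apply (is_lim_seq_le (fun _ => 0) (fun m => zsum (F m)) 0 (zsum f)).
  - intros m. destruct (Hn m) as [S [HS0 HS]]. rewrite (zsum_has_sum _ _ HS); auto.
  - apply is_lim_seq_const.
  - apply zsum_dominated with g; auto.
Qed.

(* With q = exp (- e (|n1| + i n2)) and P_K the partial sums of (1 - q)^(-p/2), this is
   exp (- e p |n1|) |P_K (q)|^2, a positive combination of exponentials in |n1| times characters
   in n2. Times e^p it tends to |n|^(-p) as K -> oo and then e -> 0. *)
Definition kern (p e : R) (K : nat) (n : site) : R :=
  exp (- (e * p * IZR (Z.abs (fst n)))) *
  (partial cos (p / 2) (exp (- (e * IZR (Z.abs (fst n))))) (e * IZR (snd n)) K ^ 2
   + partial sin (p / 2) (exp (- (e * IZR (Z.abs (fst n))))) (e * IZR (snd n)) K ^ 2).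

(** The squared modulus of a partial sum in q is a double sum of terms q^i (conj q)^j. The factor
    exp (- e p |n1|) keeps every rate e (p + i + j) strictly positive, including i = j = 0. *)
Lemma kern_expand p e K n :
  kern p e K n = sumR (fun i => sumR (fun j => binc (p / 2) i * binc (p / 2) j *
     (exp (- (e * (p + INR i + INR j) * IZR (Z.abs (fst n)))) *
      cos (e * (INR i - INR j) * IZR (snd n)))) (seq 0 K)) (seq 0 K).
Proof.
  unfold kern, partial. set (k := IZR (Z.abs (fst n))). set (m := IZR (snd n)).
  simpl pow. rewrite !Rmult_1_r, !sumR_mult, <- sumR_plus, <- sumR_scal.
  apply sumR_ext; intros i. rewrite <- sumR_plus, <- sumR_scal. apply sumR_ext; intros j.
  rewrite !exp_pow.
  replace (- (e * (p + INR i + INR j) * k)) with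
    (- (e * p * k) + (INR i * - (e * k) + INR j * - (e * k))) by ring.
  rewrite !exp_plus.
  replace (e * (INR i - INR j) * m) with (INR i * (e * m) - INR j * (e * m)) by ring.
  rewrite cos_minus. ring.
Qed.

Definition laplace_pos (c : Z -> R) : Prop :=
  forall al, 0 < al -> nonneg_sum (fun k => exp (- (al * IZR (Z.abs k))) * c k).

(** Each term of the expansion factors into a Laplace sum in n1, nonnegative by [laplace_pos], and a
    Fejer sum of cosines in n2; its coefficient is positive. *)
Lemma kern_nonneg_sum p e K N c : 0 < p -> 0 < e -> laplace_pos c ->
  nonneg_sum (fun n : site => fejer N (snd n) * (c (fst n) * kern p e K n)).
Proof.
  intros Hp He Hc.
  apply nonneg_sum_ext with (fun n : site => sumR (fun i => sumR (fun j =>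
     binc (p / 2) i * binc (p / 2) j *
     ((exp (- (e * (p + INR i + INR j) * IZR (Z.abs (fst n)))) * c (fst n)) *
      (fejer N (snd n) * cos (e * (INR i - INR j) * IZR (snd n))))) (seq 0 K)) (seq 0 K)).
  { intros n. rewrite kern_expand, <- !sumR_scal. apply sumR_ext; intros i.
    rewrite <- !sumR_scal. apply sumR_ext; intros j. ring. }
  apply nonneg_sum_sumR; intros i _. apply nonneg_sum_sumR; intros j _.
  pose proof (binc_pos (p / 2) i ltac:(lra)). pose proof (binc_pos (p / 2) j ltac:(lra)).
  apply nonneg_sum_scal; [nra|].
  pose proof (pos_INR i). pose proof (pos_INR j).
  destruct (Hc (e * (p + INR i + INR j))) as [S [HS0 HS]]; [nra|].
  exists (S * sumR (fun m => fejer N m * cos (e * (INR i - INR j) * IZR m)) (zrange N)); split.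
  - apply Rmult_le_pos; auto. apply fejer_positive.
  - apply (has_sum_prod_finite (fun k => exp (- (e * (p + INR i + INR j) * IZR (Z.abs k))) * c k)
             (fun m => fejer N m * cos (e * (INR i - INR j) * IZR m))); auto using NoDup_zrange.
    intros m Hm; rewrite fejer_out; auto; ring.
Qed.

Definition kern_inf (p e : R) (n : site) : R :=
  exp (- (e * p * IZR (Z.abs (fst n)))) *
  Rpower (1 - 2 * exp (- (e * IZR (Z.abs (fst n)))) * cos (e * IZR (snd n))
          + exp (- (e * IZR (Z.abs (fst n)))) ^ 2) (- (p / 2)).

Lemma exp_neg_lt_1 y : 0 < y -> exp (- y) < 1.
Proof. intros; rewrite <- exp_0; apply exp_increasing; lra. Qed.

Lemma kern_lim p e n : 0 < p -> 0 < e -> fst n <> 0%Z ->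
  is_lim_seq (fun K => kern p e K n) (kern_inf p e n).
Proof.
  intros Hp He Hn. unfold kern, kern_inf.
  assert (0 < e * IZR (Z.abs (fst n))) by (apply Rmult_lt_0_compat; auto; apply IZR_lt; lia).
  set (r := exp (- (e * IZR (Z.abs (fst n))))).
  assert (Hr : 0 <= r < 1) by (split; [left; apply exp_pos | apply exp_neg_lt_1; auto]).
  rewrite <- binomial_series_norm by lra.
  apply is_lim_seq_mult'; [apply is_lim_seq_const|].
  apply is_lim_seq_plus'; apply is_lim_seq_square, partial_lim; auto using Rabs_cos_le, Rabs_sin_le;
    lra.
Qed.

Lemma exp_le_compat x y : x <= y -> exp x <= exp y.
Proof. intros [H | ->]; [left; apply exp_increasing; auto | lra]. Qed.

Lemma exp_decay_Rpower p y : 0 < p -> 0 < y -> exp (- (p * y)) <= Rpower y (- p).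
Proof.
  intros Hp Hy. unfold Rpower. apply exp_le_compat.
  assert (ln y <= y).
  { pose proof (exp_ineq1_le (ln y)). rewrite exp_ln in H by auto. lra. }
  nra.
Qed.

(** The constant depends on [e] but not on [K]: for |n1| >= 1 the modulus of q is at most exp (- e)
    < 1, which bounds the partial sums, and the exponential prefactor supplies the power decay. *)
Lemma kern_bound p e : 0 < p -> 0 < e -> exists D, 0 <= D /\ forall K n, fst n <> 0%Z ->
  Rabs (kern p e K n) <= D * Rpower (IZR (Z.abs (fst n))) (- p).
Proof.
  intros Hp He. set (B := PSeries (binc (p / 2)) (exp (- e))).
  exists (Rpower e (- p) * (2 * B ^ 2)).
  split; [apply Rmult_le_pos; [left; apply exp_pos | pose proof (pow2_ge_0 B); lra]|].
  intros K n Hn. unfold kern. set (k := IZR (Z.abs (fst n))).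
  assert (Hk : 1 <= k) by (apply IZR_le; lia).
  assert (Hr : 0 <= exp (- (e * k)) <= exp (- e)).
  { split; [left; apply exp_pos | apply exp_le_compat; nra]. }
  pose proof (partial_bound cos (p / 2) _ _ (e * IZR (snd n)) K ltac:(lra)
    Rabs_cos_le Hr (exp_neg_lt_1 e He)) as Hc.
  pose proof (partial_bound sin (p / 2) _ _ (e * IZR (snd n)) K ltac:(lra)
    Rabs_sin_le Hr (exp_neg_lt_1 e He)) as Hs.
  fold B in Hc, Hs.
  set (u := partial cos _ _ _ _) in *. set (v := partial sin _ _ _ _) in *.
  assert (u ^ 2 <= B ^ 2) by (rewrite <- (pow2_abs u); apply pow_incr; split; auto using Rabs_pos).
  assert (v ^ 2 <= B ^ 2) by (rewrite <- (pow2_abs v); apply pow_incr; split; auto using Rabs_pos).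
  pose proof (pow2_ge_0 u). pose proof (pow2_ge_0 v).
  rewrite Rabs_pos_eq by (apply Rmult_le_pos; [left; apply exp_pos | lra]).
  pose proof (exp_decay_Rpower p (e * k) Hp ltac:(nra)) as Hd.
  rewrite <- Rpower_mult_distr in Hd by lra.
  replace (p * (e * k)) with (e * p * k) in Hd by ring.
  apply Rle_trans with (Rpower e (- p) * Rpower k (- p) * (2 * B ^ 2)); [|right; ring].
  apply Rmult_le_compat; try lra. left; apply exp_pos.
Qed.

(** The condition [c 0%Z = 0] removes the column n1 = 0, where |q| = 1 and the kernels are not
    controlled; the Fejer factor confines n2 to a slab. *)
Lemma fejer_dominated p c C (G : site -> R) D N n : 0 < p -> c 0%Z = 0 ->
  (forall k, Rabs (c k) <= C) ->
  0 <= D -> (fst n <> 0%Z -> Rabs (G n) <= D * Rpower (IZR (Z.abs (fst n))) (- p)) ->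
  Rabs (fejer N (snd n) * (c (fst n) * G n)) <= C * D * Rpower (1 + INR N ^ 2) (p / 2) * weight p n.
Proof.
  intros Hp Hc0 Hc HD HG.
  assert (HC : 0 <= C) by (eapply Rle_trans; [apply Rabs_pos | apply (Hc 0%Z)]).
  assert (HW : 0 < Rpower (1 + INR N ^ 2) (p / 2)) by apply exp_pos.
  pose proof (weight_nonneg p n) as Hw.
  assert (H0 : 0 <= C * D * Rpower (1 + INR N ^ 2) (p / 2) * weight p n).
  { repeat apply Rmult_le_pos; auto; lra. }
  destruct (Z.eq_dec (fst n) 0) as [E|E].
  { rewrite E, Hc0, Rmult_0_l, Rmult_0_r, Rabs_R0; auto. }
  destruct (classic (In (snd n) (zrange N))) as [Hin|Hout].
  2:{ rewrite fejer_out, Rmult_0_l, Rabs_R0; auto. }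
  pose proof (Rpower_slab p n N Hp E Hin) as Hsl.
  pose proof (fejer_bounds N (snd n)) as Hf. specialize (HG E). specialize (Hc (fst n)).
  rewrite !Rabs_mult, (Rabs_pos_eq (fejer _ _)) by lra.
  assert (0 < Rpower (IZR (Z.abs (fst n))) (- p)) by apply exp_pos.
  apply Rle_trans with (1 * (C * (D * (Rpower (1 + INR N ^ 2) (p / 2) * weight p n))));
    [|right; ring].
  apply Rmult_le_compat; try lra.
  - apply Rmult_le_pos; apply Rabs_pos.
  - apply Rmult_le_compat; try apply Rabs_pos; auto.
    eapply Rle_trans; [exact HG|]. apply Rmult_le_compat_l; auto.
Qed.

Lemma kern_inf_nonneg_sum p e N c C : 4 < p -> 0 < e -> c 0%Z = 0 -> (forall k, Rabs (c k) <= C) ->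
  laplace_pos c -> nonneg_sum (fun n : site => fejer N (snd n) * (c (fst n) * kern_inf p e n)).
Proof.
  intros Hp He Hc0 Hc Hl. destruct (kern_bound p e) as (D & HD0 & HD); [lra | auto |].
  apply nonneg_sum_dominated with
    (F := fun K n => fejer N (snd n) * (c (fst n) * kern p e K n))
    (g := fun n => C * D * Rpower (1 + INR N ^ 2) (p / 2) * weight p n).
  - apply summable_scal, summable_weight; auto.
  - intros K n. apply fejer_dominated; auto; lra.
  - intros n. destruct (Z.eq_dec (fst n) 0) as [E|E].
    + rewrite E, Hc0. apply is_lim_seq_ext with (fun _ => fejer N (snd n) * (0 * kern_inf p e n)).
      * intros; ring.
      * apply is_lim_seq_const.
    + apply is_lim_seq_mult'; [apply is_lim_seq_const|].
      apply is_lim_seq_mult'; [apply is_lim_seq_const|]. apply kern_lim; lra || auto.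
  - intros K. apply kern_nonneg_sum; auto; lra.
Qed.

(** Absorbing e^p and exp (- e p |n1|) into the base turns |1 - q|^2 into |(exp (e |n1|) - exp (i e
    n2)) / e|^2, which tends to n1^2 + n2^2 as e -> 0. *)
Lemma kern_inf_rescaled p e n : 0 < e -> fst n <> 0%Z ->
  Rpower e p * kern_inf p e n =
  Rpower (((exp (e * IZR (Z.abs (fst n))) - 1) / e) ^ 2
          + 2 * exp (e * IZR (Z.abs (fst n))) * ((1 - cos (e * IZR (snd n))) / e ^ 2)) (- (p / 2)).
Proof.
  intros He Hn. unfold kern_inf. set (k := IZR (Z.abs (fst n))). set (m := IZR (snd n)).
  assert (Hk : 0 < e * k) by (apply Rmult_lt_0_compat; auto; apply IZR_lt; lia).
  assert (Hr : Rabs (exp (- (e * k))) < 1).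
  { rewrite Rabs_pos_eq by (left; apply exp_pos). apply exp_neg_lt_1; auto. }
  pose proof (mod2_pos (exp (- (e * k))) (e * m) Hr) as Hm.
  assert (E1 : Rpower e p = Rpower (/ e ^ 2) (- (p / 2))).
  { unfold Rpower. rewrite ln_Rinv, ln_pow by (auto; apply pow_lt; auto). f_equal. simpl; field. }
  assert (E2 : exp (- (e * p * k)) = Rpower (exp (e * k) ^ 2) (- (p / 2))).
  { unfold Rpower. rewrite ln_pow, ln_exp by apply exp_pos. f_equal; simpl; field. }
  rewrite E1, E2.
  assert (0 < / e ^ 2) by (apply Rinv_0_lt_compat, pow_lt; auto).
  assert (0 < exp (e * k)) by apply exp_pos.
  assert (0 < exp (e * k) ^ 2) by (apply pow_lt; auto).
  rewrite Rpower_mult_distr, Rpower_mult_distr; auto; [|apply Rmult_lt_0_compat; auto].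
  f_equal. rewrite exp_Ropp. field. lra.
Qed.

(** Uniform in [e]: exp x - 1 >= x, and the cosine term only enlarges the base of a negative
    power. *)
Lemma kern_inf_bound p e n : 0 < p -> 0 < e -> fst n <> 0%Z ->
  Rabs (Rpower e p * kern_inf p e n) <= 1 * Rpower (IZR (Z.abs (fst n))) (- p).
Proof.
  intros Hp He Hn. rewrite kern_inf_rescaled by auto.
  set (k := IZR (Z.abs (fst n))). set (m := IZR (snd n)).
  assert (Hk : 0 < k) by (apply IZR_lt; lia).
  rewrite Rabs_pos_eq, Rmult_1_l by (left; apply exp_pos).
  replace (Rpower k (- p)) with (Rpower (k * k) (- (p / 2))).
  2:{ rewrite <- Rpower_mult_distr, <- Rpower_plus by auto. f_equal; lra. }
  rewrite !Rpower_Ropp. apply Rinv_le_contravar; [apply exp_pos|].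
  apply Rle_Rpower_l; [lra|]. split; [nra|].
  assert (k <= (exp (e * k) - 1) / e).
  { apply Rle_div_r; auto. pose proof (exp_ineq1_le (e * k)). lra. }
  assert (0 <= 2 * exp (e * k) * ((1 - cos (e * m)) / e ^ 2)).
  { pose proof (exp_pos (e * k)). pose proof (COS_bound (e * m)).
    apply Rmult_le_pos; [lra|]. apply Rdiv_le_0_compat; [lra | apply pow_lt; auto]. }
  nra.
Qed.

Lemma is_lim_seq_quotient (f : R -> R) (l : R) : f 0 = 0 -> is_derive f 0 l ->
  is_lim_seq (fun m => f (/ INR (S m)) / / INR (S m)) l.
Proof.
  intros H0 Hd. apply is_derive_Reals in Hd. apply is_lim_seq_Rabs; intros eps He.
  destruct (Hd eps He) as [del Hdel].
  destruct (proj1 (is_lim_seq_Rabs _ _) is_lim_seq_inv_S del (cond_pos del)) as [N HN].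
  exists N; intros n Hn. specialize (HN n Hn). rewrite Rminus_0_r in HN.
  assert (/ INR (S n) <> 0) by (apply Rinv_neq_0_compat, not_0_INR; lia).
  specialize (Hdel _ H HN). rewrite Rplus_0_l, H0, Rminus_0_r in Hdel. exact Hdel.
Qed.

Lemma kern_inf_lim p n : 0 < p -> fst n <> 0%Z ->
  is_lim_seq (fun m => Rpower (/ INR (S m)) p * kern_inf p (/ INR (S m)) n) (weight p n).
Proof.
  intros Hp Hn.
  assert (Hz : n <> zero_site) by (intros ->; apply Hn; reflexivity).
  set (k := IZR (Z.abs (fst n))). set (j := IZR (snd n)).
  apply is_lim_seq_ext with (fun m => Rpower (((exp (/ INR (S m) * k) - 1) / / INR (S m)) ^ 2
      + 2 * exp (/ INR (S m) * k) * (2 * (sin (/ INR (S m) * (j / 2)) / / INR (S m)) ^ 2))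
          (- (p / 2))).
  { intros m. assert (0 < / INR (S m)) by (apply Rinv_0_lt_compat, lt_0_INR; lia).
    rewrite kern_inf_rescaled by auto. fold k j. set (e := / INR (S m)) in *. do 3 f_equal.
    replace (e * j) with (2 * (e * (j / 2))) by field.
    rewrite cos_2a_sin. field. lra. }
  rewrite weight_Rpower by auto.
  assert (Hl : is_lim_seq (fun m => ((exp (/ INR (S m) * k) - 1) / / INR (S m)) ^ 2
      + 2 * exp (/ INR (S m) * k) * (2 * (sin (/ INR (S m) * (j / 2)) / / INR (S m)) ^ 2))
          (norm2 n)).
  { assert (H1 : is_lim_seq (fun m => (exp (/ INR (S m) * k) - 1) / / INR (S m)) k).
    { apply (is_lim_seq_quotient (fun e => exp (e * k) - 1)).
      - rewrite Rmult_0_l, exp_0; ring.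
      - auto_derive; auto. rewrite Rmult_0_l, exp_0; ring. }
    assert (H2 : is_lim_seq (fun m => sin (/ INR (S m) * (j / 2)) / / INR (S m)) (j / 2)).
    { apply (is_lim_seq_quotient (fun e => sin (e * (j / 2)))).
      - rewrite Rmult_0_l, sin_0; ring.
      - auto_derive; auto. rewrite Rmult_0_l, cos_0; ring. }
    assert (H3 : is_lim_seq (fun m => exp (/ INR (S m) * k)) 1).
    { rewrite <- exp_0. replace 0 with (0 * k) by ring.
      apply (is_lim_seq_continuous (fun x => exp (x * k))).
      - apply derivable_continuous_pt, ex_derive_Reals_0. auto_derive; auto.
      - apply is_lim_seq_inv_S. }
    replace (norm2 n) with (k ^ 2 + 2 * 1 * (2 * (j / 2) ^ 2)).
    2:{ unfold norm2, j, k. rewrite abs_IZR, pow2_abs. field. }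
    apply is_lim_seq_plus'; [apply is_lim_seq_square; auto|].
    apply is_lim_seq_mult'; apply is_lim_seq_mult'; auto using is_lim_seq_square, is_lim_seq_const.
    }
  apply (is_lim_seq_continuous (fun x => Rpower x (- (p / 2)))); auto.
  apply derivable_continuous_pt. exists (- (p / 2) * Rpower (norm2 n) (- (p / 2) - 1)).
  apply derivable_pt_lim_power. pose proof (norm2_ge_1 n Hz); lra.
Qed.

(* |n|^(-p), summed over n2, is a positive mixture of the exponentials exp (- al |n1|). *)
Lemma weight_mixture p c C : 4 < p -> c 0%Z = 0 -> (forall k, Rabs (c k) <= C) -> laplace_pos c ->
  0 <= zsum (fun n : site => weight p n * c (fst n)).
Proof.
  intros Hp Hc0 Hc Hl.
  assert (HC : 0 <= C) by (eapply Rle_trans; [apply Rabs_pos | apply (Hc 0%Z)]).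
  assert (H : nonneg_sum (fun n : site => weight p n * c (fst n))).
  2:{ destruct H as [S [HS0 HS]]. rewrite (zsum_has_sum _ _ HS); auto. }
  (* For fixed [N] one lets [K] tend to infinity (inside [kern_inf_nonneg_sum]) and then e = 1 / (m
     + 1) tend to 0. The limit in [N] comes last, because the domination used for the kernels
     depends on the width of the slab. *)
  assert (H1 : forall N, nonneg_sum (fun n : site => fejer N (snd n) * (c (fst n) * weight p n))).
  { intros N. apply nonneg_sum_dominated with
      (F := fun m n => fejer N (snd n) * (c (fst n)
        * (Rpower (/ INR (S m)) p * kern_inf p (/ INR (S m)) n)))
      (g := fun n => C * 1 * Rpower (1 + INR N ^ 2) (p / 2) * weight p n).
    - apply summable_scal, summable_weight; auto.
    - intros m n. apply (fejer_dominated p c C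
        (fun n => Rpower (/ INR (S m)) p * kern_inf p (/ INR (S m)) n));
        auto; try lra. intros Hn. apply kern_inf_bound; auto; try lra.
      apply Rinv_0_lt_compat, lt_0_INR; lia.
    - intros n. destruct (Z.eq_dec (fst n) 0) as [E|E].
      + rewrite E, Hc0. apply is_lim_seq_ext with (fun _ => fejer N (snd n) * (0 * weight p n)).
        * intros; ring.
        * apply is_lim_seq_const.
      + apply is_lim_seq_mult'; [apply is_lim_seq_const|].
        apply is_lim_seq_mult'; [apply is_lim_seq_const|]. apply kern_inf_lim; auto; lra.
    - intros m. apply nonneg_sum_ext with (fun n => Rpower (/ INR (S m)) p *
        (fejer N (snd n) * (c (fst n) * kern_inf p (/ INR (S m)) n))); [intros; ring|].
      apply nonneg_sum_scal; [left; apply exp_pos|].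
      apply kern_inf_nonneg_sum with C; auto. apply Rinv_0_lt_compat, lt_0_INR; lia. }
  apply nonneg_sum_dominated with
    (F := fun N n => fejer N (snd n) * (c (fst n) * weight p n)) (g := fun n => C * weight p n);
      auto.
  - apply summable_scal, summable_weight; auto.
  - intros N n. pose proof (fejer_bounds N (snd n)). pose proof (weight_nonneg p n).
    rewrite !Rabs_mult, (Rabs_pos_eq (fejer _ _)), (Rabs_pos_eq (weight _ _)) by lra.
    rewrite <- (Rmult_1_l (C * _)). apply Rmult_le_compat; try lra.
    + apply Rmult_le_pos; auto using Rabs_pos.
    + apply Rmult_le_compat_r; auto.
  - intros n. replace (weight p n * c (fst n)) with (1 * (c (fst n) * weight p n)) by ring.
    apply is_lim_seq_mult'; [apply fejer_lim | apply is_lim_seq_const].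
Qed.

(** * Periodic functions on the line *)

Definition psum (L : nat) (f : Z -> R) : R := sumR (fun n => f (Z.of_nat n)) (seq 0 L).

Definition periodic {A} (L : nat) (f : Z -> A) : Prop := forall x, f (x + Z.of_nat L)%Z = f x.

Lemma psum_ext L f g : (forall x, f x = g x) -> psum L f = psum L g.
Proof. intros H; apply sumR_ext; auto. Qed.

Lemma psum_S L f : psum (S L) f = psum L f + f (Z.of_nat L).
Proof. apply sumR_seq_S. Qed.

Lemma psum_plus L f g : psum L (fun x => f x + g x) = psum L f + psum L g.
Proof. apply sumR_plus. Qed.

Lemma psum_minus L f g : psum L (fun x => f x - g x) = psum L f - psum L g.
Proof. apply sumR_minus. Qed.

Lemma psum_scal L c f : psum L (fun x => c * f x) = c * psum L f.
Proof. apply sumR_scal. Qed.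

Lemma psum_le L f g : (forall x, f x <= g x) -> psum L f <= psum L g.
Proof. intros H; apply sumR_le_in; auto. Qed.

Lemma psum_nonneg L f : (forall x, 0 <= f x) -> 0 <= psum L f.
Proof. intros H; apply sumR_nonneg; auto. Qed.

Lemma psum_const L c : psum L (fun _ => c) = INR L * c.
Proof. unfold psum; rewrite sumR_const, length_seq; reflexivity. Qed.

Lemma psum_sumR {A} L (F : A -> Z -> R) l :
  psum L (fun x => sumR (fun a => F a x) l) = sumR (fun a => psum L (F a)) l.
Proof. unfold psum; apply sumR_swap. Qed.

Lemma psum_swap L M (F : Z -> Z -> R) :
  psum L (fun x => psum M (fun y => F x y)) = psum M (fun y => psum L (fun x => F x y)).
Proof. unfold psum; apply sumR_swap. Qed.

Lemma psum_shift_1 L f : periodic L f -> psum L (fun x => f (x + 1)%Z) = psum L f.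
Proof.
  intros Hf. assert (H : forall n, psum n (fun x => f (x + 1)%Z) = psum n f + f (Z.of_nat n)
    - f 0%Z).
  { induction n as [|n IH]; [unfold psum; simpl; ring|].
    rewrite !psum_S, IH. replace (Z.of_nat (S n)) with (Z.of_nat n + 1)%Z by lia. ring. }
  rewrite H. specialize (Hf 0%Z). rewrite Z.add_0_l in Hf. rewrite Hf; ring.
Qed.

Lemma psum_shift L f k : periodic L f -> psum L (fun x => f (x + k)%Z) = psum L f.
Proof.
  intros Hf. induction k as [|k IH|k IH] using Z.peano_ind.
  - apply psum_ext; intros; f_equal; lia.
  - rewrite <- IH, <- (psum_shift_1 L (fun x => f (x + k)%Z)).
    + apply psum_ext; intros; f_equal; lia.
    + intros x. rewrite <- (Hf (x + k)%Z); f_equal; lia.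
  - rewrite <- IH, <- (psum_shift_1 L (fun x => f (x + Z.pred k)%Z)).
    + apply psum_ext; intros; f_equal; lia.
    + intros x. rewrite <- (Hf (x + Z.pred k)%Z); f_equal; lia.
Qed.

Lemma sumR_seq_rev n (F : nat -> R) :
  sumR (fun i => F (n - 1 - i)%nat) (seq 0 n) = sumR F (seq 0 n).
Proof.
  induction n as [|n IH]; [reflexivity|]. rewrite sumR_seq_S with (f := F), <- IH.
  simpl seq. cbn [sumR fold_right]. rewrite <- seq_shift.
  change (fold_right (fun a acc => F (S n - 1 - a)%nat + acc) 0 (map S (seq 0 n)))
    with (sumR (fun a => F (S n - 1 - a)%nat) (map S (seq 0 n))).
  rewrite sumR_map, Rplus_comm. f_equal; [|f_equal; lia].
  apply sumR_ext; intros; f_equal; lia.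
Qed.

Lemma psum_opp L f : periodic L f -> psum L (fun x => f (- x)%Z) = psum L f.
Proof.
  intros Hf.
  assert (Hp : periodic L (fun x => f (- x)%Z)).
  { intros x; simpl. rewrite <- (Hf (- (x + Z.of_nat L))%Z); f_equal; lia. }
  rewrite <- (psum_shift L _ (1 - Z.of_nat L)%Z Hp).
  unfold psum. rewrite <- (sumR_seq_rev L (fun n => f (Z.of_nat n))).
  apply sumR_ext_in; intros i Hi; apply in_seq in Hi. f_equal; lia.
Qed.

Lemma periodic_mul {A} L (f : Z -> A) m x : periodic L f -> f (x + m * Z.of_nat L)%Z = f x.
Proof.
  intros Hf. induction m as [|m IH|m IH] using Z.peano_ind.
  - f_equal; lia.
  - rewrite <- IH, <- (Hf (x + m * Z.of_nat L)%Z); f_equal; lia.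
  - rewrite <- IH, <- (Hf (x + Z.pred m * Z.of_nat L)%Z); f_equal; lia.
Qed.

Lemma psum_app n m f : psum (n + m) f = psum n f + psum m (fun x => f (Z.of_nat n + x)%Z).
Proof.
  induction m as [|m IH]; [rewrite Nat.add_0_r; unfold psum at 3; simpl; ring|].
  rewrite Nat.add_succ_r, !psum_S, IH, Nat2Z.inj_add; ring.
Qed.

Lemma psum_multiple P m f : periodic P f -> psum (m * P) f = INR m * psum P f.
Proof.
  intros Hf. induction m as [|m IH]; [unfold psum; simpl; ring|].
  replace (S m * P)%nat with (m * P + P)%nat by lia.
  rewrite psum_app, IH, S_INR.
  replace (psum P (fun x => f (Z.of_nat (m * P) + x)%Z)) with (psum P f); [ring|].
  apply psum_ext; intros x. rewrite Nat2Z.inj_mul, Z.add_comm, periodic_mul; auto.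
Qed.

Definition ne (a b : bool) : R := if xorb a b then 1 else 0.

Lemma ne_bounds a b : 0 <= ne a b <= 1.
Proof. destruct a, b; unfold ne; simpl; lra. Qed.

Lemma ne_sym a b : ne a b = ne b a.
Proof. destruct a, b; reflexivity. Qed.

Lemma ne_refl a : ne a a = 0.
Proof. destruct a; reflexivity. Qed.

Lemma ne_triangle a b c : ne a c <= ne a b + ne b c.
Proof. destruct a, b, c; unfold ne; simpl; lra. Qed.

(** The ends of a two-step path with middle point [b] differ exactly when one of the two steps is a
    change. The product term becomes the repulsion between the legs. *)
Lemma ne_cross a b c : ne a c = ne a b + ne b c - 2 * (ne b a * ne b c).
Proof. destruct a, b, c; unfold ne; simpl; ring. Qed.

Definition mismatch (L : nat) (f : Z -> bool) (k : Z) : R :=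
  psum L (fun x => ne (f x) (f (x + k)%Z)).

Lemma mismatch_bounds L f k : 0 <= mismatch L f k <= INR L.
Proof.
  split; [apply psum_nonneg; intros; apply ne_bounds|].
  rewrite <- (Rmult_1_r (INR L)), <- psum_const. apply psum_le; intros; apply ne_bounds.
Qed.

Lemma mismatch_0 L f : mismatch L f 0 = 0.
Proof. apply sumR_0; intros. rewrite Z.add_0_r; apply ne_refl. Qed.

Lemma mismatch_opp L f k : periodic L f -> mismatch L f (- k) = mismatch L f k.
Proof.
  intros Hf. unfold mismatch.
  rewrite <- (psum_shift L _ k).
  - apply psum_ext; intros x. rewrite ne_sym. do 2 f_equal. lia.
  - intros x. rewrite Hf. f_equal. rewrite <- (Hf (x + - k)%Z). f_equal; lia.
Qed.

Lemma mismatch_succ L f k : periodic L f -> mismatch L f (k + 1) <= mismatch L f k + mismatch L f 1.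
Proof.
  intros Hf. unfold mismatch. rewrite <- (psum_shift L (fun x => ne (f x) (f (x + 1)%Z)) k),
    <- psum_plus.
  - apply psum_le; intros x. rewrite Z.add_assoc. apply ne_triangle.
  - intros x. rewrite Hf. f_equal. rewrite <- (Hf (x + 1)%Z). f_equal; lia.
Qed.

Lemma mismatch_le L f k : periodic L f -> mismatch L f k <= Rabs (IZR k) * mismatch L f 1.
Proof.
  intros Hf.
  assert (H : forall n : nat, mismatch L f (Z.of_nat n) <= INR n * mismatch L f 1).
  { induction n as [|n IH]; [rewrite mismatch_0; simpl; lra|].
    rewrite Nat2Z.inj_succ, S_INR. pose proof (mismatch_succ L f (Z.of_nat n) Hf). unfold Z.succ.
    lra. }
  destruct (Z.abs_eq_or_opp k) as [E|E].
  - rewrite <- abs_IZR, E. specialize (H (Z.to_nat k)). rewrite INR_IZR_INZ, Z2Nat.id in H by lia.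
    auto.
  - rewrite <- (mismatch_opp L f k Hf), <- abs_IZR, E.
    specialize (H (Z.to_nat (- k))). rewrite INR_IZR_INZ, Z2Nat.id in H by lia. auto.
Qed.

(** * Constant blocks of a periodic function *)

Fixpoint first (P : nat -> bool) (n : nat) : nat :=
  match n with O => O | S m => if P O then O else S (first (fun i => P (S i)) m) end.

Lemma first_le P n : (first P n <= n)%nat.
Proof. revert P; induction n as [|n IH]; intros P; simpl; [lia|]. destruct (P O); [lia|].
specialize (IH (fun i => P (S i))); lia. Qed.

Lemma first_lt P n : (first P n < n)%nat -> P (first P n) = true.
Proof.
  revert P; induction n as [|n IH]; intros P; simpl; [lia|]. destruct (P O) eqn:E; auto.
  intros H; apply (IH (fun i => P (S i))); lia.
Qed.

Lemma first_before P n i : (i < first P n)%nat -> P i = false.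
Proof.
  revert P i; induction n as [|n IH]; intros P i; simpl; [lia|]. destruct (P O) eqn:E; [lia|].
  destruct i as [|i]; auto. intros H; apply (IH (fun i => P (S i))); lia.
Qed.

Lemma first_unique P n r : (r < n)%nat -> P r = true -> (forall i, (i < r)%nat -> P i = false) ->
  first P n = r.
Proof.
  intros Hr HP Hb. destruct (Nat.lt_trichotomy (first P n) r) as [H|[H|H]]; auto.
  - pose proof (Hb _ H). rewrite first_lt in H0; [discriminate | lia].
  - rewrite (first_before P n r H) in HP; discriminate.
Qed.

Lemma first_ex P n i : (i < n)%nat -> P i = true -> (first P n < n)%nat.
Proof.
  intros Hi HP. destruct (Nat.lt_ge_cases i (first P n)) as [H|H]; [|lia].
  rewrite (first_before P n i H) in HP; discriminate.
Qed.

Lemma first_ext P Q n : (forall i, P i = Q i) -> first P n = first Q n.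
Proof.
  revert P Q; induction n as [|n IH]; intros P Q H; simpl; auto.
  rewrite H. destruct (Q O); auto.
Qed.

Definition jump (f : Z -> bool) (x : Z) : bool := xorb (f x) (f (x + 1)%Z).

(** Distance from [z] to the last site of its block. The search covers one period, and for a
    function of period [L] > 0 the value [L] signals that there is no jump. *)
Definition right_gap (f : Z -> bool) (L : nat) (z : Z) : nat :=
  first (fun i => jump f (z + Z.of_nat i)) L.

Definition left_gap (f : Z -> bool) (L : nat) (z : Z) : nat :=
  first (fun i => jump f (z - 1 - Z.of_nat i)) L.

(** Meant for a jump [x]: the length of the block that starts at x + 1. *)
Definition next_block (f : Z -> bool) (L : nat) (x : Z) : nat := S (right_gap f L (x + 1)).

(* The length of the constant block of f through z; a constant f gets the junk value 0. *)
Definition width (f : Z -> bool) (L : nat) (z : Z) : nat :=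
  if Nat.ltb (right_gap f L z) L then S (left_gap f L z + right_gap f L z) else O.

Lemma jump_periodic L f : periodic L f -> periodic L (jump f).
Proof.
  intros Hf x; unfold jump. rewrite Hf. f_equal. rewrite <- (Hf (x + 1)%Z); f_equal; lia.
Qed.

Lemma right_gap_periodic L f M : periodic L f -> periodic L (right_gap f M).
Proof.
  intros Hf x. apply first_ext; intros i. rewrite <- (jump_periodic L f Hf (x + Z.of_nat i)%Z);
    f_equal; lia.
Qed.

Lemma left_gap_periodic L f M : periodic L f -> periodic L (left_gap f M).
Proof.
  intros Hf x. apply first_ext; intros i. rewrite <- (jump_periodic L f Hf (x - 1 - Z.of_nat i)%Z);
    f_equal; lia.
Qed.

Lemma width_periodic L f M : periodic L f -> periodic L (width f M).
Proof. intros Hf x; unfold width. rewrite (right_gap_periodic L f M Hf x),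
  (left_gap_periodic L f M Hf x); auto. Qed.

Lemma right_gap_lt L f x0 z : (0 < L)%nat -> periodic L f -> jump f x0 = true ->
  (right_gap f L z < L)%nat.
Proof.
  intros HL Hf Hx0. apply first_ex with (Z.to_nat ((x0 - z) mod Z.of_nat L)).
  - pose proof (Z.mod_pos_bound (x0 - z) (Z.of_nat L)). lia.
  - pose proof (Z.mod_pos_bound (x0 - z) (Z.of_nat L)). rewrite Z2Nat.id by lia.
    rewrite <- Hx0, <- (periodic_mul L (jump f) ((x0 - z) / Z.of_nat L) (z + _)) by
      (apply jump_periodic; auto).
    f_equal. pose proof (Z.div_mod (x0 - z) (Z.of_nat L)). lia.
Qed.

Lemma left_gap_lt L f x0 z : (0 < L)%nat -> periodic L f -> jump f x0 = true ->
  (left_gap f L z < L)%nat.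
Proof.
  intros HL Hf Hx0. apply first_ex with (Z.to_nat ((z - 1 - x0) mod Z.of_nat L)).
  - pose proof (Z.mod_pos_bound (z - 1 - x0) (Z.of_nat L)). lia.
  - pose proof (Z.mod_pos_bound (z - 1 - x0) (Z.of_nat L)). rewrite Z2Nat.id by lia.
    rewrite <- Hx0, <- (periodic_mul L (jump f) (- ((z - 1 - x0) / Z.of_nat L)) (z - 1 - _)) by
      (apply jump_periodic; auto).
    f_equal. pose proof (Z.div_mod (z - 1 - x0) (Z.of_nat L)). lia.
Qed.

Lemma sumR_seq_lt_indicator n L (F : nat -> R) : (n <= L)%nat ->
  sumR F (seq 0 n) = sumR (fun j => if Nat.ltb j n then F j else 0) (seq 0 L).
Proof.
  intros H. replace L with (n + (L - n))%nat by lia. rewrite seq_app, sumR_app.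
  rewrite (sumR_0 _ (seq (0 + n) (L - n))).
  - rewrite Rplus_0_r. apply sumR_ext_in; intros j Hj; apply in_seq in Hj.
    destruct (Nat.ltb_spec j n); auto; lia.
  - intros j Hj; apply in_seq in Hj. destruct (Nat.ltb_spec j n); auto; lia.
Qed.

(** Every [z] lies in the block opened by exactly one jump, at z - 1 - [left_gap f L z]. Each term
    is translated by its offset [j] in the block, using periodicity; after exchanging the sums every
    [z] is met once. *)
Lemma psum_blocks L f (F : Z -> R) x0 : (0 < L)%nat -> periodic L f -> periodic L F -> jump f x0 =
  true ->
  psum L F = psum L (fun x => if jump f x then
     sumR (fun j => F (x + 1 + Z.of_nat j)%Z) (seq 0 (next_block f L x)) else 0).
Proof.
  intros HL Hf HF Hx0.
  rewrite (psum_ext L (fun x => if jump f x then _ else 0) (fun x => sumR (fun j =>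
     (fun z => if (jump f (z - 1 - Z.of_nat j) && Nat.leb j (right_gap f L (z - Z.of_nat j)))%bool
      then F z else 0) (x + (1 + Z.of_nat j))%Z) (seq 0 L))).
  2:{ intros x. destruct (jump f x) eqn:E.
      - rewrite (sumR_seq_lt_indicator _ L).
        2:{ unfold next_block. pose proof (right_gap_lt L f x0 (x + 1) HL Hf Hx0). lia. }
        apply sumR_ext; intros j.
        replace (x + (1 + Z.of_nat j) - 1 - Z.of_nat j)%Z with x by lia.
        replace (x + (1 + Z.of_nat j) - Z.of_nat j)%Z with (x + 1)%Z by lia.
        rewrite E; cbn [andb]. unfold next_block.
        destruct (Nat.ltb_spec j (S (right_gap f L (x + 1)))),
          (Nat.leb_spec j (right_gap f L (x + 1))); try lia; auto.
        f_equal; lia.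
      - symmetry; apply sumR_0; intros j _.
        replace (x + (1 + Z.of_nat j) - 1 - Z.of_nat j)%Z with x by lia. rewrite E; auto. }
  rewrite psum_sumR.
  rewrite (sumR_ext _ (fun j => psum L (fun z => if (jump f (z - 1 - Z.of_nat j) &&
      Nat.leb j (right_gap f L (z - Z.of_nat j)))%bool then F z else 0))).
  2:{ intros j. apply (psum_shift L (fun z => if (jump f (z - 1 - Z.of_nat j) &&
        Nat.leb j (right_gap f L (z - Z.of_nat j)))%bool then F z else 0) (1 + Z.of_nat j)%Z).
        intros z.
      replace (z + Z.of_nat L - 1 - Z.of_nat j)%Z with (z - 1 - Z.of_nat j + Z.of_nat L)%Z by lia.
      replace (z + Z.of_nat L - Z.of_nat j)%Z with (z - Z.of_nat j + Z.of_nat L)%Z by lia.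
      rewrite HF, (jump_periodic L f Hf), (right_gap_periodic L f L Hf); auto. }
  rewrite <- psum_sumR. apply psum_ext; intros z.
  assert (Hl : (left_gap f L z < L)%nat) by (apply left_gap_lt with x0; auto).
  rewrite (sumR_ext_in _ (fun j => (if Z.eqb (Z.of_nat j) (Z.of_nat (left_gap f L z)) then 1 else 0)
    * F z)).
  - rewrite sumR_scal_r, sumR_seq_indicator.
    rewrite (proj2 (Z.leb_le _ _)), (proj2 (Z.ltb_lt _ _)) by lia. simpl; ring.
  - intros j Hj; apply in_seq in Hj.
    (* [j] is the offset of [z] in its block exactly when z - 1 - j is a jump and no jump lies
       between. *)
    assert (Hiff : (jump f (z - 1 - Z.of_nat j) && Nat.leb j (right_gap f L (z - Z.of_nat j)))%bool
      = true
                   <-> j = left_gap f L z).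
    { rewrite andb_true_iff, Nat.leb_le. split.
      - intros [H1 H2]. symmetry. apply first_unique; [lia | auto |].
        intros i Hi. replace (z - 1 - Z.of_nat i)%Z with (z - Z.of_nat j + Z.of_nat (j - 1 - i))%Z
          by lia.
        apply (first_before (fun i => jump f (z - Z.of_nat j + Z.of_nat i)) L).
        unfold right_gap in H2; lia.
      - intros ->. split; [apply (first_lt (fun i => jump f (z - 1 - Z.of_nat i))); auto|].
        destruct (Nat.le_gt_cases (left_gap f L z) (right_gap f L (z - Z.of_nat (left_gap f L z))))
          as [|H]; auto.
        exfalso. pose proof (right_gap_lt L f x0 (z - Z.of_nat (left_gap f L z)) HL Hf Hx0) as Hr.
        pose proof (first_lt _ _ Hr) as Ht. fold (right_gap f L (z - Z.of_nat (left_gap f L z)))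
          in Ht.
        set (r := right_gap f L (z - Z.of_nat (left_gap f L z))) in *.
        set (l := left_gap f L z) in *.
        assert (Hb : jump f (z - 1 - Z.of_nat (l - 1 - r)) = false).
        { apply (first_before (fun i => jump f (z - 1 - Z.of_nat i)) L).
          fold (left_gap f L z); fold l; lia. }
        replace (z - 1 - Z.of_nat (l - 1 - r))%Z with (z - Z.of_nat l + Z.of_nat r)%Z in Hb by lia.
        simpl in Ht. congruence. }
    destruct (andb _ _) eqn:E.
    + rewrite (proj1 Hiff eq_refl), Z.eqb_refl; ring.
    + destruct (Z.eqb_spec (Z.of_nat j) (Z.of_nat (left_gap f L z))) as [He|]; [|ring].
      apply Nat2Z.inj in He. apply Hiff in He. congruence.
Qed.

Lemma next_block_gaps L f x0 x j : (0 < L)%nat -> periodic L f -> jump f x0 = true -> jump f x =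
  true ->
  (j < next_block f L x)%nat ->
  left_gap f L (x + 1 + Z.of_nat j) = j /\
  right_gap f L (x + 1 + Z.of_nat j) = (next_block f L x - 1 - j)%nat /\
  width f L (x + 1 + Z.of_nat j) = next_block f L x.
Proof.
  intros HL Hf Hx0 Hx Hj. unfold next_block in *.
  pose proof (right_gap_lt L f x0 (x + 1) HL Hf Hx0) as Hr.
  pose proof (first_lt _ _ Hr) as Ht; fold (right_gap f L (x + 1)) in Ht; simpl in Ht.
  set (r := right_gap f L (x + 1)) in *.
  assert (Hb : forall i, (i < r)%nat -> jump f (x + 1 + Z.of_nat i) = false).
  { intros i Hi. apply (first_before (fun i => jump f (x + 1 + Z.of_nat i)) L); auto. }
  assert (H1 : left_gap f L (x + 1 + Z.of_nat j) = j).
  { apply first_unique; [lia | |].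
    - replace (x + 1 + Z.of_nat j - 1 - Z.of_nat j)%Z with x by lia; auto.
    - intros i Hi. replace (x + 1 + Z.of_nat j - 1 - Z.of_nat i)%Z with
        (x + 1 + Z.of_nat (j - 1 - i))%Z by lia.
      apply Hb; lia. }
  assert (H2 : right_gap f L (x + 1 + Z.of_nat j) = (S r - 1 - j)%nat).
  { apply first_unique; [lia | |].
    - replace (x + 1 + Z.of_nat j + Z.of_nat (S r - 1 - j))%Z with (x + 1 + Z.of_nat r)%Z by lia;
        auto.
    - intros i Hi. replace (x + 1 + Z.of_nat j + Z.of_nat i)%Z with (x + 1 + Z.of_nat (j + i))%Z by
        lia.
      apply Hb; lia. }
  split; [|split]; auto. unfold width. rewrite H1, H2.
  rewrite (proj2 (Nat.ltb_lt _ _)) by lia. lia.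
Qed.

(** * The one-dimensional chessboard estimate *)

(** Evenness and [c 0%Z = 0] reduce the two-sided sum to twice a one-sided series. Absolute
    summability follows by comparing the exponential with an inverse square. *)
Lemma laplace_even (c : Z -> R) C al V : 0 < al -> c 0%Z = 0 -> (forall k, Rabs (c k) <= C) ->
  (forall k, c (- k)%Z = c k) ->
  is_series (fun k => exp (- al) ^ (S k) * c (Z.of_nat (S k))) V ->
  has_sum (fun k => exp (- (al * IZR (Z.abs k))) * c k) (2 * V).
Proof.
  intros Hal Hc0 Hc Hev HS. set (f := fun k => exp (- (al * IZR (Z.abs k))) * c k).
  assert (HC : 0 <= C) by (eapply Rle_trans; [apply Rabs_pos | apply (Hc 0%Z)]).
  assert (Hsum : summable f).
  { apply summable_le with (fun k => C * Rpower (al / 2) (- (2))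
      * Rpower (IZR (Z.max 1 (Z.abs k))) (- (2))).
    2:{ apply summable_scal, summable_Rpower_Z; lra. }
    intros k; unfold f. destruct (Z.eq_dec k 0) as [->|Hk].
    - rewrite Hc0, Rmult_0_r, Rabs_R0. repeat apply Rmult_le_pos; auto; left; apply exp_pos.
    - rewrite Z.max_r by lia. assert (0 < IZR (Z.abs k)) by (apply IZR_lt; lia).
      rewrite Rabs_mult, Rabs_pos_eq by (left; apply exp_pos).
      pose proof (exp_decay_Rpower 2 (al / 2 * IZR (Z.abs k)) ltac:(lra) ltac:(nra)) as Hd.
      rewrite <- Rpower_mult_distr in Hd by lra.
      replace (2 * (al / 2 * IZR (Z.abs k))) with (al * IZR (Z.abs k)) in Hd by field.
      rewrite Rmult_comm, Rmult_assoc. apply Rmult_le_compat; auto using Rabs_pos.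
      left; apply exp_pos. }
  destruct (summable_has_sum f Hsum) as [T HT].
  replace (2 * V) with T; auto.
  pose proof (has_sum_zrange_lim f T HT) as H1. apply is_lim_seq_incr_1 in H1.
  assert (H2 : is_lim_seq (fun L => sumR f (zrange (S L))) (2 * V)).
  { apply is_lim_seq_ext with (fun n => 2 * sum_n (fun k => exp (- al) ^ (S k) * c (Z.of_nat (S k)))
      n).
    - assert (Hv : forall k, Z.abs k <> 0%Z -> f k = exp (- al) ^ (Z.abs_nat k)
        * c (Z.of_nat (Z.abs_nat k))).
      { intros k _; unfold f. rewrite exp_pow, INR_IZR_INZ, Zabs2Nat.id_abs.
        f_equal; [f_equal; ring|].
        destruct (Z.abs_eq_or_opp k) as [-> | ->]; auto. }
      assert (Hp : forall n, f (- Z.of_nat (S n))%Z + f (Z.of_nat (S n))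
                 = 2 * (exp (- al) ^ (S n) * c (Z.of_nat (S n)))).
      { intros n. rewrite !Hv by lia. replace (Z.abs_nat (- Z.of_nat (S n))) with (S n) by lia.
        rewrite Zabs2Nat.id. ring. }
      induction n as [|n IH].
      + rewrite sumR_zrange_S, sum_O, <- Hp.
        assert (Hf0 : sumR f (zrange 0) = 0) by (unfold zrange, f; simpl; rewrite Hc0; ring).
        rewrite Hf0. ring.
      + rewrite sumR_zrange_S, <- IH, sum_Sn. unfold plus; simpl plus.
        rewrite Rmult_plus_distr_l, <- Hp. ring.
    - apply (is_lim_seq_scal_l _ 2 V), HS. }
  apply is_lim_seq_unique in H1, H2. congruence.
Qed.

Definition decay_sum (lam : R) (f : Z -> bool) (x : Z) : R :=
  Series (fun k => lam ^ (S k) * ne (f x) (f (x + Z.of_nat (S k))%Z)).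

Lemma is_series_geom_S lam : 0 < lam < 1 -> is_series (fun k => lam ^ (S k)) (lam / (1 - lam)).
Proof.
  intros Hl. unfold Rdiv. apply (is_series_scal lam (fun k => lam ^ k)).
  apply is_series_geom. rewrite Rabs_pos_eq; lra.
Qed.

Lemma ex_series_decay lam (c : nat -> R) C : 0 < lam < 1 -> (forall k, Rabs (c k) <= C) ->
  ex_series (fun k => lam ^ (S k) * c k).
Proof.
  intros Hl Hc. apply (ex_series_le (K := R_AbsRing) (V := R_CompleteNormedModule)) with
    (fun k => C * lam ^ (S k)).
  - intros k. unfold norm; simpl norm. change abs with Rabs.
    rewrite Rabs_mult, Rabs_pos_eq by (apply pow_le; lra).
    rewrite Rmult_comm. apply Rmult_le_compat_r; auto. apply pow_le; lra.
  - exists (C * (lam / (1 - lam))). apply (is_series_scal C (fun k => lam ^ (S k))).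
    apply is_series_geom_S; auto.
Qed.

Lemma Rabs_ne_le a b : Rabs (ne a b) <= 1.
Proof. pose proof (ne_bounds a b). rewrite Rabs_pos_eq; lra. Qed.

Lemma decay_sum_is_series lam f x : 0 < lam < 1 ->
  is_series (fun k => lam ^ (S k) * ne (f x) (f (x + Z.of_nat (S k))%Z)) (decay_sum lam f x).
Proof.
  intros Hl. apply Series_correct, (ex_series_decay lam
    (fun k => ne (f x) (f (x + Z.of_nat (S k))%Z)) 1); auto.
  intros; apply Rabs_ne_le.
Qed.

(** Moving the origin by one site costs a factor lam. Across a jump the reference spin is flipped,
    so every [ne] turns into its complement and a geometric series appears. *)
Lemma decay_sum_step lam f x : 0 < lam < 1 ->
  decay_sum lam f x = if jump f x then lam / (1 - lam) - lam * decay_sum lam f (x + 1)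
                      else lam * decay_sum lam f (x + 1).
Proof.
  intros Hl. unfold decay_sum at 1. rewrite Series_incr_1.
  2:{ exists (decay_sum lam f x). apply decay_sum_is_series; auto. }
  replace (x + Z.of_nat 1)%Z with (x + 1)%Z by lia.
  assert (E : forall k, (x + Z.of_nat (S (S k)))%Z = (x + 1 + Z.of_nat (S k))%Z) by (intros; lia).
  unfold jump. destruct (xorb (f x) (f (x + 1)%Z)) eqn:Ej.
  - rewrite (Series_ext _ (fun k => lam * (lam ^ (S k) - lam ^ (S k)
      * ne (f (x + 1)%Z) (f (x + 1 + Z.of_nat (S k))%Z)))).
    + rewrite Series_scal_l, Series_minus.
      * fold (decay_sum lam f (x + 1)). rewrite (is_series_unique _ _ (is_series_geom_S lam Hl)).
        unfold ne at 1; rewrite Ej. field; lra.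
      * eexists; apply is_series_geom_S; auto.
      * eexists; apply decay_sum_is_series; auto.
    + intros k. rewrite E. simpl pow.
      destruct (f x), (f (x + 1)%Z); try discriminate; destruct (f (x + 1 + Z.of_nat (S k))%Z);
        unfold ne; simpl xorb; cbv iota; ring.
  - apply xorb_eq in Ej. rewrite <- Ej, ne_refl, Rmult_0_r, Rplus_0_l.
    rewrite (Series_ext _ (fun k => lam * (lam ^ (S k)
      * ne (f (x + 1)%Z) (f (x + 1 + Z.of_nat (S k))%Z)))).
    + rewrite Series_scal_l; reflexivity.
    + intros k. rewrite E, Ej. simpl pow. ring.
Qed.

Lemma decay_sum_run lam f x n : 0 < lam < 1 ->
  (forall i, (i < n)%nat -> jump f (x + Z.of_nat i) = false) ->
  decay_sum lam f x = lam ^ n * decay_sum lam f (x + Z.of_nat n).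
Proof.
  intros Hl. revert x; induction n as [|n IH]; intros x Hj.
  - rewrite Z.add_0_r; simpl; ring.
  - pose proof (Hj O ltac:(lia)) as H0. rewrite Z.add_0_r in H0. rewrite decay_sum_step, H0 by auto.
    rewrite (IH (x + 1)%Z).
    + replace (x + Z.of_nat (S n))%Z with (x + 1 + Z.of_nat n)%Z by lia. simpl; ring.
    + intros i Hi. replace (x + 1 + Z.of_nat i)%Z with (x + Z.of_nat (S i))%Z by lia. apply Hj; lia.
Qed.

Lemma decay_sum_block lam f x n : 0 < lam < 1 -> jump f x = true ->
  (forall i, (i < n)%nat -> jump f (x + 1 + Z.of_nat i) = false) ->
  decay_sum lam f x = lam / (1 - lam) - lam ^ (S n) * decay_sum lam f (x + Z.of_nat (S n)).
Proof.
  intros Hl Hx Hj. rewrite decay_sum_step, Hx by auto.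
  rewrite (decay_sum_run lam f (x + 1) n) by auto.
  replace (x + Z.of_nat (S n))%Z with (x + 1 + Z.of_nat n)%Z by lia. simpl; ring.
Qed.

(* An affine reparametrisation after which passing through a block of length n reads
   s x = lam^n (1 - s (x + n)). *)
Definition dual_sum (lam : R) (f : Z -> bool) (x : Z) : R := 1 - (1 - lam) / lam
  * decay_sum lam f x.

Lemma dual_sum_block lam f x n : 0 < lam < 1 -> jump f x = true ->
  (forall i, (i < n)%nat -> jump f (x + 1 + Z.of_nat i) = false) ->
  dual_sum lam f x = lam ^ (S n) * (1 - dual_sum lam f (x + Z.of_nat (S n))).
Proof.
  intros Hl Hx Hj. unfold dual_sum. rewrite (decay_sum_block lam f x n) by auto. field; lra.
Qed.

Lemma decay_sum_periodic lam L f : periodic L f -> periodic L (decay_sum lam f).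
Proof.
  intros Hf x. apply Series_ext; intros k. rewrite Hf. do 2 f_equal.
  rewrite <- (Hf (x + Z.of_nat (S k))%Z). f_equal; lia.
Qed.

Lemma is_series_sumR {A} (F : A -> nat -> R) (S : A -> R) l :
  (forall a, is_series (F a) (S a)) -> is_series (fun k => sumR (fun a => F a k) l) (sumR S l).
Proof.
  intros H; induction l as [|a l IH]; simpl.
  - apply filterlim_ext with (fun _ : nat => 0); [|apply filterlim_const].
    intros n. induction n as [|n IH]; [rewrite sum_O; auto|]. rewrite sum_Sn, <- IH.
    unfold plus; simpl; ring.
  - apply (is_series_plus (F a) (fun k => sumR (fun a => F a k) l)); auto.
Qed.

Lemma mismatch_is_series lam L f : 0 < lam < 1 ->
  is_series (fun k => lam ^ (S k) * mismatch L f (Z.of_nat (S k))) (psum L (decay_sum lam f)).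
Proof.
  intros Hl. apply is_series_ext with (fun k => sumR (fun n => lam ^ (S k) *
     ne (f (Z.of_nat n)) (f (Z.of_nat n + Z.of_nat (S k))%Z)) (seq 0 L)).
  - intros k. unfold mismatch, psum. rewrite <- sumR_scal. reflexivity.
  - apply (is_series_sumR (fun n k => lam ^ (S k)
      * ne (f (Z.of_nat n)) (f (Z.of_nat n + Z.of_nat (S k))%Z))).
    intros n. apply decay_sum_is_series; auto.
Qed.

(** With D = [decay_sum lam f], periodicity makes (1 - lam) times the sum equal to the sum of D(x) -
    lam D(x + 1), which vanishes except at jumps. *)
Lemma psum_decay_sum lam L f : 0 < lam < 1 -> periodic L f ->
  psum L (decay_sum lam f) =
  lam / (1 - lam) ^ 2 * psum L (fun x => if jump f x then 1 - 2 * dual_sum lam f x else 0).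
Proof.
  intros Hl Hf.
  assert (H : psum L (decay_sum lam f) - lam * psum L (decay_sum lam f)
     = lam / (1 - lam) * psum L (fun x => if jump f x then 1 - 2 * dual_sum lam f x else 0)).
  { rewrite <- (psum_shift_1 L (decay_sum lam f)) at 2 by (apply decay_sum_periodic; auto).
    rewrite <- !psum_scal, <- psum_minus. apply psum_ext; intros x.
    unfold dual_sum. pose proof (decay_sum_step lam f x Hl) as E. destruct (jump f x).
    - replace (lam * decay_sum lam f (x + 1)) with (lam / (1 - lam) - decay_sum lam f x) by
        (rewrite E; ring).
      field; lra.
    - rewrite E; ring. }
  apply Rmult_eq_reg_l with (1 - lam); [|lra].
  replace ((1 - lam) * psum L (decay_sum lam f)) with
    (psum L (decay_sum lam f) - lam * psum L (decay_sum lam f)) by ring.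
  rewrite H. field; lra.
Qed.

(* The energy of one exponential dominates the sum, over the blocks, of the energy of the
   equal-width arrangement: the defect is a perfect square plus a telescoping term. *)
Lemma dual_sum_chessboard lam L f x0 : 0 < lam < 1 -> (0 < L)%nat -> periodic L f -> jump f x0 =
  true ->
  psum L (fun x => if jump f x then lam ^ next_block f L x / (1 + lam ^ next_block f L x) else 0)
  <= psum L (fun x => if jump f x then dual_sum lam f x else 0).
Proof.
  intros Hl HL Hf Hx0.
  (* The squared dual sum at the first jump at or after z. Its increment vanishes off the jumps, and
     at a jump it is the difference of the squares at this jump and at the next one. *)
  set (T := fun z => dual_sum lam f (z + Z.of_nat (right_gap f L z)) ^ 2).
  assert (HT : periodic L T).
  { intros z; unfold T. rewrite (right_gap_periodic L f L Hf z). unfold dual_sum.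
    replace (z + Z.of_nat L + Z.of_nat (right_gap f L z))%Z
      with (z + Z.of_nat (right_gap f L z) + Z.of_nat L)%Z by lia.
    rewrite (decay_sum_periodic lam L f Hf); auto. }
  assert (H0 : psum L (fun z => / 2 * (T z - T (z + 1)%Z)) = 0).
  { rewrite psum_scal, psum_minus, psum_shift_1 by auto. ring. }
  rewrite <- (Rplus_0_r (psum L (fun x => if jump f x then lam ^ _ / _ else 0))), <- H0,
    <- psum_plus.
  apply psum_le; intros x.
  pose proof (right_gap_lt L f x0 (x + 1) HL Hf Hx0) as Hr.
  destruct (jump f x) eqn:Ex.
  - assert (Hg : right_gap f L x = O).
    { apply first_unique; auto; [rewrite Z.add_0_r; auto | lia]. }
    assert (Hn : (x + 1 + Z.of_nat (right_gap f L (x + 1)))%Z = (x + Z.of_nat (next_block f L x))%Z)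
      by (unfold next_block; lia).
    unfold T. rewrite Hg, Hn, Z.add_0_r.
    assert (E : dual_sum lam f x = lam ^ next_block f L x
      * (1 - dual_sum lam f (x + Z.of_nat (next_block f L x)))).
    { apply dual_sum_block; auto. intros i Hi.
      apply (first_before (fun i => jump f (x + 1 + Z.of_nat i)) L); auto. }
    rewrite E. set (X := lam ^ next_block f L x).
    set (u := dual_sum lam f (x + Z.of_nat (next_block f L x))).
    assert (HX : 0 < X) by (apply pow_lt; lra).
    assert (HX1 : X <= 1).
    { unfold X. rewrite <- (pow1 (next_block f L x)). apply pow_incr; lra. }
    (* The defect of one block: the squared distance of [u] from X / (1 + X), the fixed point of u =
       X (1 - u). *)
    assert (Hsq : 0 <= (1 - X ^ 2) / 2 * (u - X / (1 + X)) ^ 2).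
    { apply Rmult_le_pos; [nra | apply pow2_ge_0]. }
    replace ((1 - X ^ 2) / 2 * (u - X / (1 + X)) ^ 2) with
      (X * (1 - u) - (X / (1 + X) + / 2 * ((X * (1 - u)) ^ 2 - u ^ 2))) in Hsq by (field; lra).
    lra.
  - assert (Hg : right_gap f L x = S (right_gap f L (x + 1))).
    { pose proof (first_lt _ _ Hr) as Ht. fold (right_gap f L (x + 1)) in Ht.
      pose proof (right_gap_lt L f x0 x HL Hf Hx0) as Hrx.
      pose proof (first_lt _ _ Hrx) as Htx. fold (right_gap f L x) in Htx. simpl in Ht, Htx.
      assert (Hnz : right_gap f L x <> O).
      { intros Hz. rewrite Hz, Z.add_0_r in Htx. congruence. }
      replace (right_gap f L (x + 1)) with (right_gap f L x - 1)%nat; [lia|].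
      symmetry. apply first_unique; [lia | |].
      - replace (x + 1 + Z.of_nat (right_gap f L x - 1))%Z with (x + Z.of_nat (right_gap f L x))%Z
          by lia; auto.
      - intros i Hi. replace (x + 1 + Z.of_nat i)%Z with (x + Z.of_nat (S i))%Z by lia.
        apply (first_before (fun i => jump f (x + Z.of_nat i)) L). fold (right_gap f L x); lia. }
    unfold T. rewrite Hg.
    replace (x + Z.of_nat (S (right_gap f L (x + 1))))%Z with
      (x + 1 + Z.of_nat (right_gap f L (x + 1)))%Z by lia.
    lra.
Qed.

(** * The one-dimensional stripe profile *)

Definition st (h : nat) (u : Z) : bool := stripe h (u, 0%Z).

Lemma st_base h u : (0 <= u < Z.of_nat h)%Z -> st h u = true.
Proof.
  intros Hu. unfold st, stripe; simpl fst. destruct (Rlt_dec _ _) as [|H]; auto. exfalso; apply H.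
  assert (0 <= IZR u) by (apply IZR_le; lia).
  assert (IZR u + 1 <= INR h).
  { rewrite INR_IZR_INZ, <- plus_IZR. apply IZR_le; lia. }
  pose proof PI_RGT_0. assert (0 < INR h) by lra.
  apply sin_gt_0.
  - apply Rdiv_lt_0_compat; auto. apply Rmult_lt_0_compat; lra.
  - apply Rlt_div_l; auto. apply Rmult_lt_compat_l; lra.
Qed.

(** The sine changes sign under a shift by pi. It is nonzero at these points, as a zero would make 2
    u + 1 even, so the strict test in [stripe] is exactly negated. *)
Lemma st_antiperiodic h u : (0 < h)%nat -> st h (u + Z.of_nat h) = negb (st h u).
Proof.
  intros Hh. unfold st, stripe; simpl fst. assert (0 < INR h) by (apply lt_0_INR; auto).
  rewrite plus_IZR, <- INR_IZR_INZ.
  replace (PI * (IZR u + INR h + / 2) / INR h) with (PI * (IZR u + / 2) / INR h + PI) by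
    (field; lra).
  rewrite neg_sin. set (th := PI * (IZR u + / 2) / INR h).
  assert (sin th <> 0).
  { intros H0. apply sin_eq_0_0 in H0. destruct H0 as [k Hk]. unfold th in Hk.
    pose proof PI_RGT_0.
    assert (E : IZR u + / 2 = IZR k * INR h).
    { apply Rmult_eq_reg_l with (PI / INR h); [|apply Rgt_not_eq, Rdiv_lt_0_compat; lra].
      transitivity (PI * (IZR u + / 2) / INR h); [field; lra | rewrite Hk; field; lra]. }
    assert (E2 : (2 * u + 1 = 2 * (k * Z.of_nat h))%Z).
    { apply eq_IZR. rewrite plus_IZR, !mult_IZR, <- INR_IZR_INZ. lra. }
    lia. }
  destruct (Rlt_dec 0 (- sin th)), (Rlt_dec 0 (sin th)); simpl; auto; lra.
Qed.

Lemma st_periodic h : (0 < h)%nat -> periodic (2 * h) (st h).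
Proof.
  intros Hh x. replace (x + Z.of_nat (2 * h))%Z with (x + Z.of_nat h + Z.of_nat h)%Z by lia.
  rewrite !st_antiperiodic, negb_involutive; auto.
Qed.

Lemma st_shift h u q : (0 < h)%nat -> st h (u + q * Z.of_nat h) = xorb (Z.odd q) (st h u).
Proof.
  intros Hh. induction q as [|q IH|q IH] using Z.peano_ind.
  - rewrite Z.add_0_r; simpl; destruct (st h u); auto.
  - replace (u + Z.succ q * Z.of_nat h)%Z with (u + q * Z.of_nat h + Z.of_nat h)%Z by lia.
    rewrite st_antiperiodic, IH, Z.odd_succ, <- Z.negb_odd by auto.
    destruct (Z.odd q), (st h u); auto.
  - assert (E : st h (u + q * Z.of_nat h) = negb (st h (u + Z.pred q * Z.of_nat h))).
    { rewrite <- st_antiperiodic by auto. f_equal; lia. }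
    rewrite IH in E. rewrite Z.odd_pred, <- Z.negb_odd.
    destruct (Z.odd q), (st h u), (st h (u + Z.pred q * Z.of_nat h)); auto; discriminate.
Qed.

Lemma st_jump_run h x i : (0 < h)%nat -> jump (st h) x = true -> (i < h - 1)%nat ->
  jump (st h) (x + 1 + Z.of_nat i) = false.
Proof.
  intros Hh Hx Hi.
  set (q := ((x + 1) / Z.of_nat h)%Z). set (r := ((x + 1) mod Z.of_nat h)%Z).
  assert (Hr : (0 <= r < Z.of_nat h)%Z) by (apply Z.mod_pos_bound; lia).
  assert (E : (x + 1 = r + q * Z.of_nat h)%Z) by (pose proof (Z.div_mod (x + 1) (Z.of_nat h)); lia).
  assert (Hr0 : r = 0%Z).
  { destruct (Z.eq_dec r 0) as [|Hnz]; auto. exfalso. unfold jump in Hx.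
    rewrite E in Hx. replace x with (r - 1 + q * Z.of_nat h)%Z in Hx by lia.
    rewrite !st_shift, !st_base, xorb_nilpotent in Hx by lia. discriminate. }
  unfold jump. replace (x + 1 + Z.of_nat i)%Z with (Z.of_nat i + q * Z.of_nat h)%Z by lia.
  replace (Z.of_nat i + q * Z.of_nat h + 1)%Z with (Z.of_nat i + 1 + q * Z.of_nat h)%Z by lia.
  rewrite !st_shift, !st_base by lia. apply xorb_nilpotent.
Qed.

(** Antiperiodicity gives equal values at x and x + h, so the block relation becomes the fixed point
    equation s = lam^h (1 - s). *)
Lemma dual_sum_st lam h x : 0 < lam < 1 -> (0 < h)%nat -> jump (st h) x = true ->
  dual_sum lam (st h) x = lam ^ h / (1 + lam ^ h).
Proof.
  intros Hl Hh Hx.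
  assert (E : dual_sum lam (st h) x = lam ^ S (h - 1)
    * (1 - dual_sum lam (st h) (x + Z.of_nat (S (h - 1))))).
  { apply dual_sum_block; auto. intros i Hi. apply st_jump_run; auto. }
  replace (S (h - 1)) with h in E by lia.
  replace (dual_sum lam (st h) (x + Z.of_nat h)) with (dual_sum lam (st h) x) in E.
  - assert (0 < lam ^ h) by (apply pow_lt; lra).
    apply Rmult_eq_reg_r with (1 + lam ^ h); [|lra].
    replace (lam ^ h / (1 + lam ^ h) * (1 + lam ^ h)) with (lam ^ h) by (field; lra). lra.
  - unfold dual_sum; do 2 f_equal. apply Series_ext; intros k.
    replace (x + Z.of_nat h + Z.of_nat (S k))%Z with (x + Z.of_nat (S k) + Z.of_nat h)%Z by lia.
    rewrite !st_antiperiodic by auto. f_equal. unfold ne. destruct (st h x), (st h _); auto.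
Qed.

(** In each half period only the last [k] sites look across the next wall, and none looks across
    two. *)
Lemma mismatch_st_small h k : (0 <= k <= Z.of_nat h)%Z -> (0 < h)%nat -> mismatch (2 * h) (st h) k =
  2 * IZR k.
Proof.
  intros Hk Hh. unfold mismatch.
  replace (2 * IZR k) with (INR 2 * IZR k) by (simpl; ring).
  rewrite psum_multiple.
  2:{ intros x. replace (x + Z.of_nat h + k)%Z with (x + k + Z.of_nat h)%Z by lia.
      rewrite !st_antiperiodic by auto. unfold ne; destruct (st h x), (st h _); auto. }
  f_equal. unfold psum.
  rewrite (sumR_ext_in _ (fun n => if Nat.leb (h - Z.to_nat k) n then 1 else 0)).
  2:{ intros n Hn; apply in_seq in Hn. rewrite (st_base h (Z.of_nat n)) by lia.
      destruct (Nat.leb_spec (h - Z.to_nat k) n).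
      - replace (Z.of_nat n + k)%Z with (Z.of_nat n + k - Z.of_nat h + Z.of_nat h)%Z by lia.
        rewrite st_antiperiodic, st_base by lia. reflexivity.
      - rewrite st_base by lia. reflexivity. }
  assert (H : forall a n, sumR (fun n => if Nat.leb a n then 1 else 0) (seq 0 n) = INR (n - a)).
  { intros a n; induction n as [|n IH]; [reflexivity|]. rewrite sumR_seq_S, IH.
    destruct (Nat.leb_spec a n).
    - rewrite <- S_INR. f_equal; lia.
    - replace (S n - a)%nat with O by lia. replace (n - a)%nat with O by lia. simpl; ring. }
  rewrite H, INR_IZR_INZ. f_equal; lia.
Qed.

Lemma psum_jumps L f c : psum L (fun x => if jump f x then c else 0) = mismatch L f 1 * c.
Proof.
  unfold mismatch, psum. rewrite <- sumR_scal_r. apply sumR_ext; intros n. unfold jump, ne.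
  destruct (xorb _ _); ring.
Qed.

Lemma psum_decay_sum_st lam h : 0 < lam < 1 -> (0 < h)%nat ->
  psum (2 * h) (decay_sum lam (st h)) = lam / (1 - lam) ^ 2
    * (2 * (1 - 2 * (lam ^ h / (1 + lam ^ h)))).
Proof.
  intros Hl Hh. rewrite psum_decay_sum by auto using st_periodic. f_equal.
  rewrite (psum_ext _ _ (fun x => if jump (st h) x then 1 - 2 * (lam ^ h / (1 + lam ^ h)) else 0)).
  - rewrite psum_jumps, mismatch_st_small by lia. ring.
  - intros x. destruct (jump (st h) x) eqn:E; auto. rewrite dual_sum_st; auto.
Qed.

Lemma mismatch_st_bounds h k : (0 < h)%nat -> mismatch (2 * h) (st h) k <= 2 * Rabs (IZR k).
Proof.
  intros Hh. pose proof (mismatch_le (2 * h) (st h) k (st_periodic h Hh)).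
  rewrite (mismatch_st_small h 1) in H by lia. lra.
Qed.

(** * Comparison with equal-width arrangements *)

Definition block_mismatch (L : nat) (f : Z -> bool) (x k : Z) : R :=
  if jump f x then mismatch (2 * next_block f L x) (st (next_block f L x)) k else 0.

(** A period 2 n of the stripes of width n holds two blocks, whence the factor 1/2 when one stripe
    state is attached to each block of [f]. This is the function of the displacement to which
    [weight_mixture] is applied. *)
Definition excess (L : nat) (f : Z -> bool) (k : Z) : R :=
  / 2 * psum L (fun x => block_mismatch L f x k) - mismatch L f k.

Lemma next_block_pos f L x : (0 < next_block f L x)%nat.
Proof. unfold next_block; lia. Qed.

Lemma excess_0 L f : excess L f 0 = 0.
Proof.
  unfold excess. rewrite mismatch_0. rewrite (psum_ext L _ (fun _ => 0));
    [rewrite psum_const; ring|].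
  intros x; unfold block_mismatch; destruct (jump f x); auto. apply mismatch_0.
Qed.

Lemma excess_opp L f k : periodic L f -> excess L f (- k) = excess L f k.
Proof.
  intros Hf. unfold excess. rewrite mismatch_opp by auto. do 2 f_equal. apply psum_ext; intros x.
  unfold block_mismatch; destruct (jump f x); auto. apply mismatch_opp, st_periodic, next_block_pos.
Qed.

Lemma next_block_le L f x : (next_block f L x <= S L)%nat.
Proof. unfold next_block, right_gap. pose proof (first_le (fun i => jump f (x + 1 + Z.of_nat i)) L).
lia. Qed.

Lemma block_mismatch_bounds L f x k : 0 <= block_mismatch L f x k <= 2 * INR (S L).
Proof.
  pose proof (mismatch_bounds (2 * next_block f L x) (st (next_block f L x)) k) as Hd.
  pose proof (next_block_le L f x) as Hn. apply le_INR in Hn.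
  rewrite mult_INR in Hd. simpl (INR 2) in Hd.
  pose proof (pos_INR (S L)). unfold block_mismatch; destruct (jump f x); lra.
Qed.

Lemma excess_bound L f k : Rabs (excess L f k) <= INR L * INR (S L) + INR L.
Proof.
  unfold excess. pose proof (mismatch_bounds L f k).
  assert (H0 : 0 <= psum L (fun x => block_mismatch L f x k) <= psum L (fun _ => 2 * INR (S L))).
  { split; [apply psum_nonneg | apply psum_le]; intros x; apply block_mismatch_bounds. }
  rewrite psum_const in H0. apply Rabs_le; lra.
Qed.

(** The chessboard estimate at lam = exp (- al). By [psum_decay_sum] both Laplace sums run over the
    jumps of [f], and their difference is a positive multiple of the sum of [dual_sum] minus lam^n /
    (1 + lam^n), n being the length of the following block. *)
Lemma excess_laplace L f x0 : (0 < L)%nat -> periodic L f -> jump f x0 = true ->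
  laplace_pos (excess L f).
Proof.
  intros HL Hf Hx0 al Hal.
  set (lam := exp (- al)).
  assert (Hl : 0 < lam < 1) by (split; [apply exp_pos | apply exp_neg_lt_1; auto]).
  set (B := fun x => if jump f x
    then psum (2 * next_block f L x) (decay_sum lam (st (next_block f L x))) else 0).
  set (V := / 2 * psum L B - psum L (decay_sum lam f)).
  exists (2 * V). split.
  - assert (0 <= V); [|lra]. unfold V.
    rewrite (psum_ext L B (fun x => lam / (1 - lam) ^ 2 * ((if jump f x then 2 else 0)
      - 4 * (if jump f x then lam ^ next_block f L x / (1 + lam ^ next_block f L x) else 0)))).
    2:{ intros x; unfold B. destruct (jump f x); [|ring].
        rewrite psum_decay_sum_st by (auto using next_block_pos). ring. }
    rewrite (psum_decay_sum lam L f), psum_scal, psum_minus, psum_scal by auto.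
    rewrite (psum_ext L (fun x => if jump f x then 1 - 2 * dual_sum lam f x else 0)
       (fun x => / 2 * (if jump f x then 2 else 0) - 2
         * (if jump f x then dual_sum lam f x else 0))).
    2:{ intros x; destruct (jump f x); field. }
    rewrite psum_minus, !psum_scal.
    pose proof (dual_sum_chessboard lam L f x0 Hl HL Hf Hx0) as Hc.
    assert (0 < lam / (1 - lam) ^ 2) by (apply Rdiv_lt_0_compat; [lra | apply pow_lt; lra]).
    nra.
  - apply laplace_even with (C := INR L * INR (S L) + INR L);
      auto using excess_0, excess_opp, excess_bound.
    fold lam. unfold V, excess.
    assert (HB : forall x, is_series (fun k => lam ^ S k * block_mismatch L f x (Z.of_nat (S k)))
      (B x)).
    { intros x; unfold B, block_mismatch. destruct (jump f x); [apply mismatch_is_series; auto|].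
      apply is_series_ext with (fun k => 0 * lam ^ S k).
      { intros k. change (0 * lam ^ S k = lam ^ S k * 0). ring. }
      assert (Hz : is_series (fun k => 0 * lam ^ S k) (0 * (lam / (1 - lam))))
        by exact (is_series_scal 0 _ _ (is_series_geom_S lam Hl)).
      rewrite (Rmult_0_l (lam / (1 - lam))) in Hz. exact Hz. }
    apply is_series_ext with (fun k =>
      / 2 * psum L (fun x => lam ^ S k * block_mismatch L f x (Z.of_nat (S k)))
      - lam ^ S k * mismatch L f (Z.of_nat (S k))).
    { intros k. rewrite psum_scal. match goal with |- ?a = ?b => change (@eq R a b) end. ring. }
    apply (is_series_minus
      (fun k => / 2 * psum L (fun x => lam ^ S k * block_mismatch L f x (Z.of_nat (S k))))
      (fun k => lam ^ S k * mismatch L f (Z.of_nat (S k)))); [|apply mismatch_is_series; auto].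
    apply (is_series_scal (/ 2)
      (fun k => psum L (fun x => lam ^ S k * block_mismatch L f x (Z.of_nat (S k))))).
    apply (is_series_sumR (fun n k => lam ^ S k
      * block_mismatch L f (Z.of_nat n) (Z.of_nat (S k)))).
    intros n; apply HB.
Qed.

(** * The energy of stripes and of rows *)

Lemma has_sum_finite (f : site -> R) l : NoDup l -> (forall x, ~ In x l -> f x = 0) ->
  has_sum f (sumR f l).
Proof.
  intros Hl Hf eps He. exists l; intros l' Hn Hi.
  replace (sumR f l') with (sumR f l); [rewrite Rminus_diag, Rabs_R0; auto|].
  assert (Hm : forall x, memb x l = true <-> In x l).
  { intros x; unfold memb; rewrite existsb_exists. split.
    - intros (y & Hy & E). destruct (site_eqb_spec x y); [subst; auto | discriminate].
    - intros Hx; exists x; split; auto. destruct (site_eqb_spec x x); auto. }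
  transitivity (sumR f (filter (fun x => memb x l) l')).
  - apply sumR_perm, NoDup_Permutation; auto using NoDup_filter.
    intros x; rewrite filter_In, Hm. split; [auto | tauto].
  - rewrite sumR_filter. apply sumR_ext; intros x. destruct (memb x l) eqn:E; auto.
    symmetry; apply Hf. intros Hx; apply Hm in Hx; congruence.
Qed.

(* The energy of an ordered pair of opposite spins at displacement n, i.e. half the energy of the
   pair; note that weight p n = 1 when n joins nearest neighbours. *)
Definition coupling (p J : R) (n : site) : R :=
  weight p n * ((if Z.eqb (dist2 n zero_site) 1 then J else 0) - 1).

Lemma weight_nn p n : dist2 n zero_site = 1%Z -> weight p n = 1.
Proof.
  intros H. rewrite weight_Rpower by (intros ->; discriminate).
  rewrite <- dist2_norm2, H. apply Rpower_1_base.
Qed.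

Lemma nn_nbrs n : dist2 n zero_site = 1%Z <-> In n (nbrs zero_site).
Proof.
  destruct n as [a b]; unfold dist2, zero_site, nbrs; cbn [fst snd In]. rewrite !Z.sub_0_r.
  change (0 + 1)%Z with 1%Z. change (0 - 1)%Z with (-1)%Z.
  split.
  - intros H. assert (-1 <= a <= 1)%Z by nia. assert (-1 <= b <= 1)%Z by nia.
    assert ((a = 1 \/ a = -1) /\ b = 0 \/ a = 0 /\ (b = 1 \/ b = -1))%Z as
      [[[-> | ->] ->]|[-> [-> | ->]]] by nia; tauto.
  - intros [H|[H|[H|[H|[]]]]]; inversion H; reflexivity.
Qed.

Lemma NoDup_nbrs_0 : NoDup (nbrs zero_site).
Proof. unfold nbrs, zero_site; simpl. repeat constructor; simpl; intuition discriminate. Qed.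

Lemma summable_coupling p J (c : site -> R) C : 4 < p ->
  (forall n, n <> zero_site -> Rabs (c n) <= C * norm2 n) ->
    summable (fun n => coupling p J n * c n).
Proof.
  intros Hp Hc. apply summable_le with (fun n => (Rabs J + 1) * Rabs (weight p n * c n)).
  - intros n. unfold coupling. replace (weight p n
      * ((if Z.eqb (dist2 n zero_site) 1 then J else 0) - 1) * c n)
      with (((if Z.eqb (dist2 n zero_site) 1 then J else 0) - 1) * (weight p n * c n)) by ring.
    rewrite Rabs_mult. apply Rmult_le_compat_r; [apply Rabs_pos|].
    unfold Rminus. eapply Rle_trans; [apply Rabs_triang|]. rewrite Rabs_Ropp, Rabs_R1.
    destruct (Z.eqb _ _); [lra|]. rewrite Rabs_R0. pose proof (Rabs_pos J); lra.
  - apply summable_scal, summable_Rabs, (summable_weight_mult p c C); auto.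
Qed.

Lemma zsum_coupling p J (c : site -> R) C : 4 < p ->
  (forall n, n <> zero_site -> Rabs (c n) <= C * norm2 n) ->
  zsum (fun n => coupling p J n * c n) = J * sumR c (nbrs zero_site)
    - zsum (fun n => weight p n * c n).
Proof.
  intros Hp Hc. apply zsum_has_sum.
  apply has_sum_ext with (fun n => J * (if Z.eqb (dist2 n zero_site) 1 then c n else 0) - weight p n
    * c n).
  - intros n; unfold coupling. destruct (Z.eqb_spec (dist2 n zero_site) 1) as [E|E]; [|ring].
    rewrite weight_nn by auto. ring.
  - apply has_sum_minus.
    + apply has_sum_scal.
      rewrite (sumR_ext_in c (fun n => if Z.eqb (dist2 n zero_site) 1 then c n else 0)).
      * apply has_sum_finite; [apply NoDup_nbrs_0|]. intros n Hn.
        destruct (Z.eqb_spec (dist2 n zero_site) 1) as [E|E]; auto. apply nn_nbrs in E; tauto.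
      * intros n Hn. apply nn_nbrs in Hn. rewrite Hn; reflexivity.
    + apply has_sum_zsum, (summable_weight_mult p c C); auto.
Qed.

Lemma weight_opp_fst p a b : weight p ((- a)%Z, b) = weight p (a, b).
Proof.
  unfold weight, dpow, dist2, site_eqb, zero_site; cbn [fst snd].
  replace ((- a - 0) ^ 2)%Z with ((a - 0) ^ 2)%Z by nia.
  destruct (Z.eqb_spec (- a) 0), (Z.eqb_spec a 0); auto; lia.
Qed.

Lemma weight_swap p a b : weight p (b, a) = weight p (a, b).
Proof.
  unfold weight, dpow, dist2, site_eqb, zero_site; cbn [fst snd].
  rewrite andb_comm, Z.add_comm; reflexivity.
Qed.

Lemma coupling_swap p J a b : coupling p J (b, a) = coupling p J (a, b).
Proof.
  unfold coupling. rewrite weight_swap. unfold dist2, zero_site; cbn [fst snd].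
  rewrite Z.add_comm; reflexivity.
Qed.

Definition swap (x : site) : site := (snd x, fst x).

Lemma swap_swap x : swap (swap x) = x.
Proof. destruct x; reflexivity. Qed.

Lemma Jc_eq p : 4 < p -> zsum (fun n => weight p n * Rabs (IZR (fst n))) = 2 * Jc p.
Proof.
  intros Hp. set (g := fun n : site => weight p n * (if Z.ltb 0 (fst n) then IZR (fst n) else 0)).
  assert (HJ : Jc p = zsum g).
  { apply zsum_ext; intros y; unfold g, weight.
    destruct (site_eqb_spec y zero_site) as [->|]; [simpl; ring|].
    destruct (Z.ltb 0 (fst y)); unfold Rdiv, zero_site; ring. }
  assert (Hg : summable g).
  { apply summable_weight_mult with 1; auto. intros n _. rewrite Rmult_1_l.
    eapply Rle_trans; [|apply Rabs_fst_le_norm2].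
    destruct (Z.ltb 0 (fst n)); [lra | rewrite Rabs_R0; apply Rabs_pos]. }
  set (r := fun n : site => ((- fst n)%Z, snd n) : site).
  assert (Hr : forall n, r (r n) = n) by (intros [a b]; unfold r; simpl; f_equal; lia).
  rewrite HJ. replace (2 * zsum g) with (zsum g + zsum (fun n => g (r n))).
  2:{ rewrite (zsum_bij r r); auto. ring. }
  rewrite <- zsum_plus; auto.
  2:{ apply (summable_inj r g); auto. intros x y Hxy. rewrite <- (Hr x), <- (Hr y), Hxy; auto. }
  apply zsum_ext; intros [a b]; unfold g, r; cbn [fst snd]. rewrite weight_opp_fst, <- abs_IZR.
  destruct (Z.ltb_spec 0 a), (Z.ltb_spec 0 (- a)); try lia.
  - rewrite Z.abs_eq by lia. ring.
  - rewrite Z.abs_neq by lia. ring.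
  - replace a with 0%Z by lia. simpl. ring.
Qed.

Lemma weight_sub p x y :
  weight p ((fst y - fst x)%Z, (snd y - snd x)%Z) = if site_eqb y x then 0 else / dpow p x y.
Proof.
  destruct x as [a b], y as [c d]; unfold weight, site_eqb, dpow, dist2, zero_site; cbn [fst snd].
  replace ((c - a - 0) ^ 2 + (d - b - 0) ^ 2)%Z with ((a - c) ^ 2 + (b - d) ^ 2)%Z by nia.
  destruct (Z.eqb_spec (c - a) 0), (Z.eqb_spec c a), (Z.eqb_spec (d - b) 0), (Z.eqb_spec d b);
    simpl; auto; lia.
Qed.

Lemma bond_ne a b : bond a b = -2 * ne a b.
Proof. destruct a, b; unfold bond, spin, ne; simpl; ring. Qed.

Lemma mismatch_norm2 L f n : n <> zero_site -> Rabs (mismatch L f (fst n)) <= INR L * norm2 n.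
Proof.
  intros Hn. pose proof (mismatch_bounds L f (fst n)). pose proof (norm2_ge_1 n Hn).
  pose proof (pos_INR L).
  rewrite Rabs_pos_eq by lra. nra.
Qed.

Lemma e_s_eq p J h : 4 < p -> (0 < h)%nat ->
  e_s p J h = / (2 * INR h) * zsum (fun n => coupling p J n * mismatch (2 * h) (st h) (fst n)).
Proof.
  intros Hp Hh. unfold e_s. f_equal.
  assert (Hst : forall a b, stripe h (a, b) = st h a) by reflexivity.
  transitivity (sumR (fun i => zsum (fun n => coupling p J n
    * ne (st h (Z.of_nat i)) (st h (Z.of_nat i + fst n)%Z))) (seq 0 (2 * h))).
  - apply sumR_ext; intros i. cbv zeta.
    set (c := fun n : site => ne (st h (Z.of_nat i)) (st h (Z.of_nat i + fst n)%Z)).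
    assert (Hc : forall n, n <> zero_site -> Rabs (c n) <= 1 * norm2 n).
    { intros n Hn. pose proof (norm2_ge_1 n Hn).
      pose proof (Rabs_ne_le (st h (Z.of_nat i)) (st h (Z.of_nat i + fst n)%Z)). unfold c; lra. }
    transitivity (zsum (fun n => coupling p J n * c n)); [|reflexivity].
    rewrite (zsum_coupling p J c 1 Hp Hc). unfold Rminus. f_equal.
    + unfold nbrs, sumR, c, zero_site; cbn [fst snd fold_right]. rewrite !bond_ne, !Hst, !Z.add_0_r.
      change (0 + 1)%Z with 1%Z. change (0 - 1)%Z with (-1)%Z.
      replace (Z.of_nat i + -1)%Z with (Z.of_nat i - 1)%Z by lia. field.
    + set (x := (Z.of_nat i, 0%Z) : site).
      assert (Hw : summable (fun n => weight p n * c n)) by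
        (apply summable_weight_mult with 1; auto).
      rewrite (zsum_ext _ (fun y => (fun n => -2 * (weight p n * c n))
        ((fst y - fst x)%Z, (snd y - snd x)%Z))).
      * rewrite (zsum_bij (fun y => ((fst y - fst x)%Z, (snd y - snd x)%Z))
          (fun n => ((fst n + fst x)%Z, (snd n + snd x)%Z))
                   (fun n => -2 * (weight p n * c n))).
        -- rewrite zsum_scal by auto. field.
        -- apply summable_scal; auto.
        -- intros [u v]; cbn [fst snd]; f_equal; lia.
        -- intros [u v]; cbn [fst snd]; f_equal; lia.
      * intros y. cbv beta. rewrite weight_sub. unfold c; cbn [fst snd].
        destruct (site_eqb y x); [ring|]. rewrite bond_ne. destruct y as [u v]; unfold x.
        rewrite !Hst; cbn [fst].
        replace (Z.of_nat i + (u - Z.of_nat i))%Z with u by lia. unfold Rdiv; ring.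
  - rewrite <- zsum_sumR.
    + apply zsum_ext; intros n. rewrite sumR_scal; reflexivity.
    + intros i _. apply summable_coupling with 1; auto. intros n Hn. pose proof (norm2_ge_1 n Hn).
      pose proof (Rabs_ne_le (st h (Z.of_nat i)) (st h (Z.of_nat i + fst n)%Z)); lra.
Qed.

Lemma sumR_nbrs_mismatch L f : periodic L f ->
  sumR (fun n => mismatch L f (fst n)) (nbrs zero_site) = 2 * mismatch L f 1.
Proof.
  intros Hf. unfold nbrs, sumR, zero_site; cbn [fst snd fold_right].
  change (0 + 1)%Z with 1%Z. change (0 - 1)%Z with (-(1))%Z.
  rewrite mismatch_opp, mismatch_0 by auto. ring.
Qed.

Lemma zsum_coupling_mismatch p J L f : 4 < p -> periodic L f ->
  zsum (fun n => coupling p J n * mismatch L f (fst n)) =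
  2 * J * mismatch L f 1 - zsum (fun n => weight p n * mismatch L f (fst n)).
Proof.
  intros Hp Hf. rewrite (zsum_coupling p J (fun n => mismatch L f (fst n)) (INR L));
    auto using mismatch_norm2.
  rewrite sumR_nbrs_mismatch by auto. ring.
Qed.

(** Multiplying by [h] gives the energy of one wall per unit length: 2 J for the broken bonds, minus
    half of what a period, which holds two walls, gains from the long-range part. *)
Lemma e_s_stripe p J h : 4 < p -> (0 < h)%nat ->
  INR h * e_s p J h = 2 * J - / 2 * zsum (fun n => weight p n * mismatch (2 * h) (st h) (fst n)).
Proof.
  intros Hp Hh. assert (0 < INR h) by (apply lt_0_INR; auto).
  rewrite e_s_eq, zsum_coupling_mismatch by auto using st_periodic.
  rewrite (mismatch_st_small h 1) by lia. field; lra.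
Qed.

(** A pair of opposite spins is separated by a wall, so the mismatch of one period is at most 2
    |n1|, as if its two walls ignored each other. *)
Lemma e_s_lower p J h : 4 < p -> (0 < h)%nat -> -2 * (Jc p - J) <= INR h * e_s p J h.
Proof.
  intros Hp Hh. rewrite e_s_stripe by auto.
  assert (zsum (fun n => weight p n * mismatch (2 * h) (st h) (fst n)) <= 2 * (2 * Jc p)); [|lra].
  rewrite <- Jc_eq, <- zsum_scal by (auto; apply summable_weight_mult with 1; auto;
    intros n _; rewrite Rabs_Rabsolu, Rmult_1_l; apply Rabs_fst_le_norm2).
  apply zsum_le.
  - apply summable_weight_mult with (INR (2 * h)); auto using mismatch_norm2.
  - apply summable_scal, summable_weight_mult with 1; auto.
    intros n _; rewrite Rabs_Rabsolu, Rmult_1_l; apply Rabs_fst_le_norm2.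
  - intros n. pose proof (weight_nonneg p n). pose proof (mismatch_st_bounds h (fst n) Hh). nra.
Qed.

Definition tail (p : R) (h : nat) : R :=
  zsum (fun n => weight p n * (if Z.leb (Z.abs (fst n)) (Z.of_nat h) then 0 else IZR (fst n) ^ 2)).

Lemma tail_dominated h n : Rabs (if Z.leb (Z.abs (fst n)) (Z.of_nat h) then 0 else IZR (fst n) ^ 2)
  <= 1 * norm2 n.
Proof.
  pose proof (pow2_ge_0 (IZR (fst n))). pose proof (pow2_ge_0 (IZR (snd n))). unfold norm2.
  destruct (Z.leb _ _); [rewrite Rabs_R0 | rewrite Rabs_pos_eq]; lra.
Qed.

Lemma tail_lim p : 4 < p -> is_lim_seq (tail p) 0.
Proof.
  intros Hp.
  replace 0 with (zsum (fun n => 0 * weight p n)).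
  2:{ rewrite zsum_scal by (apply summable_weight; auto). ring. }
  apply zsum_dominated with (fun n => norm2 n * weight p n).
  - apply summable_norm2_weight; auto.
  - intros h n. rewrite Rabs_mult, (Rabs_pos_eq (weight p n)), Rmult_comm by apply weight_nonneg.
    apply Rmult_le_compat_r; [apply weight_nonneg|].
    pose proof (tail_dominated h n). lra.
  - intros n. apply is_lim_seq_ext_loc with (fun _ => 0 * weight p n); [|apply is_lim_seq_const].
    exists (Z.abs_nat (fst n)). intros h Hh. destruct (Z.leb_spec (Z.abs (fst n)) (Z.of_nat h));
      [ring | lia].
Qed.

(** The mismatch equals 2 |n1| up to |n1| = h. Beyond, the loss is at most |n1| <= n1^2 / h, whose
    weighted sum is [tail p h] / h. *)
Lemma e_s_upper p J h : 4 < p -> (0 < h)%nat ->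
  INR h * e_s p J h <= -2 * (Jc p - J) + / INR h * tail p h.
Proof.
  intros Hp Hh. rewrite e_s_stripe by auto. assert (HI : 0 < INR h) by (apply lt_0_INR; auto).
  assert (HI' : 0 < / INR h) by (apply Rinv_0_lt_compat; auto).
  assert (S1 : summable (fun n => weight p n * Rabs (IZR (fst n)))).
  { apply summable_weight_mult with 1; auto. intros n _; rewrite Rabs_Rabsolu, Rmult_1_l;
      apply Rabs_fst_le_norm2. }
  assert (S2 : summable (fun n => weight p n * mismatch (2 * h) (st h) (fst n))).
  { apply summable_weight_mult with (INR (2 * h)); auto using mismatch_norm2. }
  assert (S3 : summable (fun n => weight p n *
    (if Z.leb (Z.abs (fst n)) (Z.of_nat h) then 0 else IZR (fst n) ^ 2))).
  { apply summable_weight_mult with 1; auto. intros n _; apply tail_dominated. }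
  assert (zsum (fun n => weight p n * Rabs (IZR (fst n))) <=
          zsum (fun n => / 2 * (weight p n * mismatch (2 * h) (st h) (fst n)) + / INR h
            * (weight p n *
             (if Z.leb (Z.abs (fst n)) (Z.of_nat h) then 0 else IZR (fst n) ^ 2)))).
  { apply zsum_le; auto.
    - apply summable_le with (fun n => / 2 * Rabs (weight p n * mismatch (2 * h) (st h) (fst n))
        + / INR h * Rabs (weight p n *
             (if Z.leb (Z.abs (fst n)) (Z.of_nat h) then 0 else IZR (fst n) ^ 2))).
      + intros n. eapply Rle_trans; [apply Rabs_triang|].
        rewrite !(Rabs_mult (/ _)), (Rabs_pos_eq (/ 2)), (Rabs_pos_eq (/ INR h)) by lra. lra.
      + apply summable_plus; apply summable_scal, summable_Rabs; auto.
    - intros n. pose proof (weight_nonneg p n).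
      assert (Rabs (IZR (fst n)) <= / 2 * mismatch (2 * h) (st h) (fst n) + / INR h *
             (if Z.leb (Z.abs (fst n)) (Z.of_nat h) then 0 else IZR (fst n) ^ 2)); [|nra].
      destruct (Z.leb_spec (Z.abs (fst n)) (Z.of_nat h)).
      + assert (E : mismatch (2 * h) (st h) (fst n) = 2 * IZR (Z.abs (fst n))).
        { destruct (Z.abs_eq_or_opp (fst n)) as [E|E]; rewrite E.
          - apply mismatch_st_small; lia.
          - rewrite <- mismatch_opp by (apply st_periodic; auto). apply mismatch_st_small; lia. }
        rewrite E, abs_IZR. lra.
      + pose proof (mismatch_bounds (2 * h) (st h) (fst n)).
        assert (INR h * Rabs (IZR (fst n)) <= IZR (fst n) ^ 2).
        { rewrite <- pow2_abs, <- abs_IZR, INR_IZR_INZ. simpl; rewrite Rmult_1_r, <- !mult_IZR.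
          apply IZR_le; nia. }
        assert (Rabs (IZR (fst n)) <= / INR h * IZR (fst n) ^ 2).
        { apply Rmult_le_reg_l with (INR h); auto. rewrite <- Rmult_assoc, Rinv_r; lra. }
        lra. }
  rewrite zsum_plus, !zsum_scal in H; auto using summable_scal.
  rewrite Jc_eq in H by auto. fold (tail p h) in H. lra.
Qed.

(** Width 0 stands for a constant line, which has energy 0 because only opposite spins
    contribute. *)
Definition e_width (p J : R) (h : nat) : R := if Nat.eqb h 0 then 0 else e_s p J h.

Lemma right_gap_no_jump f L z : (forall x, jump f x = false) -> right_gap f L z = L.
Proof.
  intros H. pose proof (first_le (fun i => jump f (z + Z.of_nat i)) L) as Hle.
  fold (right_gap f L z) in Hle. destruct (Nat.eq_dec (right_gap f L z) L) as [|Hne]; auto.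
  assert (Hlt : (right_gap f L z < L)%nat) by lia. apply first_lt in Hlt.
  rewrite H in Hlt; discriminate.
Qed.

(** [weight_mixture] applied to [excess]: replacing the mismatch of the row by half the mismatches
    of the stripes attached to its blocks can only lower the energy, since the weights enter with a
    minus sign. The nearest-neighbour parts agree, both counting jumps. *)
Lemma row_energy p J L f : 4 < p -> (0 < L)%nat -> periodic L f ->
  psum L (fun x => e_width p J (width f L x)) <=
    zsum (fun n => coupling p J n * mismatch L f (fst n)).
Proof.
  intros Hp HL Hf. destruct (classic (exists x0, jump f x0 = true)) as [[x0 Hx0]|Hno].
  - assert (HE : periodic L (fun x => e_width p J (width f L x))).
    { intros x. rewrite (width_periodic L f L Hf); auto. }
    rewrite (psum_blocks L f _ x0 HL Hf HE Hx0).
    assert (HW : forall x, summable (fun n : site => weight p n * block_mismatch L f x (fst n))).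
    { intros x. apply summable_weight_mult with (2 * INR (S L)); auto. intros n Hn.
      pose proof (norm2_ge_1 n Hn). pose proof (block_mismatch_bounds L f x (fst n)).
      rewrite Rabs_pos_eq by lra. nra. }
    assert (HB : forall x, (if jump f x
        then sumR (fun j => e_width p J (width f L (x + 1 + Z.of_nat j))) (seq 0 (next_block f L x))
        else 0)
      = (if jump f x then 2 * J else 0)
        - / 2 * zsum (fun n => weight p n * block_mismatch L f x (fst n))).
    { intros x. unfold block_mismatch. destruct (jump f x) eqn:E.
      - rewrite (sumR_ext_in _ (fun _ => e_s p J (next_block f L x))).
        + rewrite sumR_const, length_seq, e_s_stripe by auto using next_block_pos. reflexivity.
        + intros j Hj; apply in_seq in Hj.
          destruct (next_block_gaps L f x0 x j) as (_ & _ & ->); auto; lia.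
      - rewrite (zsum_ext _ (fun n => 0 * weight p n)) by (intros; ring).
        rewrite zsum_scal by (apply summable_weight; auto). ring. }
    rewrite (psum_ext L _ _ HB), psum_minus, psum_scal, psum_jumps, zsum_coupling_mismatch by auto.
    pose proof (weight_mixture p (excess L f) _ Hp (excess_0 L f) (excess_bound L f)
      (excess_laplace L f x0 HL Hf Hx0)) as Hm.
    assert (E : zsum (fun n : site => weight p n * excess L f (fst n)) =
      / 2 * psum L (fun x => zsum (fun n => weight p n * block_mismatch L f x (fst n)))
      - zsum (fun n => weight p n * mismatch L f (fst n))).
    { apply zsum_has_sum. apply has_sum_ext with (fun n : site =>
        / 2 * sumR (fun i => weight p n * block_mismatch L f (Z.of_nat i) (fst n)) (seq 0 L)
        - weight p n * mismatch L f (fst n)).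
      - intros n; unfold excess, psum. rewrite sumR_scal. ring.
      - apply has_sum_minus.
        + apply has_sum_scal.
          apply (has_sum_sumR (fun i n => weight p n * block_mismatch L f (Z.of_nat i) (fst n))
            (fun i => zsum (fun n => weight p n * block_mismatch L f (Z.of_nat i) (fst n)))).
          intros i _. apply has_sum_zsum; auto.
        + apply has_sum_zsum, summable_weight_mult with (INR L); auto using mismatch_norm2. }
    rewrite E in Hm. lra.
  - assert (Hno' : forall x, jump f x = false).
    { intros x. destruct (jump f x) eqn:E; auto. exfalso; eauto. }
    rewrite (psum_ext L _ (fun _ => 0)), psum_const.
    2:{ intros x. unfold width. rewrite right_gap_no_jump, Nat.ltb_irrefl; auto. }
    assert (H1 : mismatch L f 1 = 0).
    { apply sumR_0; intros n _. unfold ne. change (xorb _ _) with (jump f (Z.of_nat n)).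
      rewrite Hno'; auto. }
    rewrite (zsum_ext _ (fun n => 0 * weight p n)), zsum_scal;
      [lra | apply summable_weight; auto |].
    intros n. pose proof (mismatch_le L f (fst n) Hf). pose proof (mismatch_bounds L f (fst n)).
    rewrite H1, Rmult_0_r in H. replace (mismatch L f (fst n)) with 0 by lra. ring.
Qed.

(** * Periodic configurations in the plane *)

Definition per2 {A} (L : nat) (s : site -> A) : Prop :=
  (forall b, periodic L (fun a => s (a, b))) /\ (forall a, periodic L (fun b => s (a, b))).

Definition psum2 (L : nat) (F : site -> R) : R := psum L (fun b => psum L (fun a => F (a, b))).

Definition mismatch2 (L : nat) (s : config) (n : site) : R :=
  psum2 L (fun x => ne (s x) (s ((fst x + fst n)%Z, (snd x + snd n)%Z))).

(** The displacement runs over all of Z^2 and not modulo [L]: this is the energy per period of a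
    periodic configuration of the plane. *)
Definition energy (p J : R) (L : nat) (s : config) : R :=
  zsum (fun n => coupling p J n * mismatch2 L s n).

Definition transpose (s : config) : config := fun x => s (swap x).

(** A site with an opposite neighbour in its row and another in its column, so that walls of both
    directions meet at it. *)
Definition corner (s : config) (x : site) : bool :=
  let (a, b) := x in
  (xorb (s (a, b)) (s (a + 1, b)%Z) || xorb (s (a, b)) (s (a - 1, b)%Z)) &&
  (xorb (s (a, b)) (s (a, b + 1)%Z) || xorb (s (a, b)) (s (a, b - 1)%Z)).

Definition ncorner (L : nat) (s : config) : R := psum2 L (fun x => if corner s x then 1 else 0).

Definition row_width (L : nat) (s : config) (x : site) : nat :=
  width (fun a => s (a, snd x)) L (fst x).

Lemma psum2_ext L F G : (forall x, F x = G x) -> psum2 L F = psum2 L G.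
Proof. intros H; apply psum_ext; intros b; apply psum_ext; auto. Qed.

Lemma psum2_le L F G : (forall x, F x <= G x) -> psum2 L F <= psum2 L G.
Proof. intros H; apply psum_le; intros b; apply psum_le; auto. Qed.

Lemma psum2_nonneg L F : (forall x, 0 <= F x) -> 0 <= psum2 L F.
Proof. intros H; apply psum_nonneg; intros b; apply psum_nonneg; auto. Qed.

Lemma psum2_plus L F G : psum2 L (fun x => F x + G x) = psum2 L F + psum2 L G.
Proof.
  unfold psum2. rewrite <- psum_plus. apply psum_ext; intros; apply psum_plus.
Qed.

Lemma psum2_scal L c F : psum2 L (fun x => c * F x) = c * psum2 L F.
Proof. unfold psum2. rewrite <- psum_scal. apply psum_ext; intros; apply psum_scal. Qed.

Lemma psum2_const L c : psum2 L (fun _ => c) = INR L ^ 2 * c.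
Proof. unfold psum2. rewrite !psum_const. ring. Qed.

Lemma psum2_swap L F : psum2 L (fun x => F (swap x)) = psum2 L F.
Proof. unfold psum2, swap; cbn [fst snd]. apply psum_swap. Qed.

Lemma psum2_sumR {A} L (F : A -> site -> R) l :
  psum2 L (fun x => sumR (fun a => F a x) l) = sumR (fun a => psum2 L (F a)) l.
Proof.
  unfold psum2. rewrite <- psum_sumR. apply psum_ext; intros; apply psum_sumR.
Qed.

Lemma psum2_shift L F u v : per2 L F ->
  psum2 L (fun x => F ((fst x + u)%Z, (snd x + v)%Z)) = psum2 L F.
Proof.
  intros [H1 H2]. unfold psum2; cbn [fst snd].
  rewrite <- (psum_shift L (fun b => psum L (fun a => F (a, b))) v).
  - apply psum_ext; intros b. apply (psum_shift L (fun a => F (a, (b + v)%Z))). apply H1.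
  - intros b. apply psum_ext; intros a. apply H2.
Qed.

Lemma per2_transpose L s : per2 L s -> per2 L (transpose s).
Proof. intros [H1 H2]; split; intros b; unfold transpose, swap; simpl; auto. Qed.

Lemma corner_transpose s x : corner (transpose s) x = corner s (swap x).
Proof. destruct x as [a b]; unfold corner, transpose, swap; cbn [fst snd]. apply andb_comm. Qed.

Lemma ncorner_transpose L s : ncorner L (transpose s) = ncorner L s.
Proof.
  unfold ncorner. rewrite <- (psum2_swap L (fun x => if corner s x then 1 else 0)).
  apply psum2_ext; intros x. rewrite corner_transpose; auto.
Qed.

Lemma corner_per2 L s : per2 L s -> per2 L (fun x => if corner s x then 1 else 0).
Proof.
  intros [H1 H2]. split; intros y x; unfold corner.
  - replace (x + Z.of_nat L + 1)%Z with (x + 1 + Z.of_nat L)%Z by lia.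
    replace (x + Z.of_nat L - 1)%Z with (x - 1 + Z.of_nat L)%Z by lia.
    rewrite !(H1 _ _); auto.
  - replace (x + Z.of_nat L + 1)%Z with (x + 1 + Z.of_nat L)%Z by lia.
    replace (x + Z.of_nat L - 1)%Z with (x - 1 + Z.of_nat L)%Z by lia.
    rewrite !(H2 _ _); auto.
Qed.

(* Here x is the pivot of the L-shaped path from x - n1 e1 to x + n2 e2. *)
Definition cross (L : nat) (s : config) (n : site) : R :=
  psum2 L (fun x => ne (s x) (s ((fst x - fst n)%Z, snd x))
    * ne (s x) (s (fst x, (snd x + snd n)%Z))).

(** [ne_cross] with middle point x + n1 e1, summed over a period; translation by n1 brings the
    vertical leg and the product term to this pivot. *)
Lemma mismatch2_decomp L s n : per2 L s ->
  mismatch2 L s n = psum L (fun b => mismatch L (fun a => s (a, b)) (fst n))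
              + psum L (fun a => mismatch L (fun b => s (a, b)) (snd n)) - 2 * cross L s n.
Proof.
  intros [H1 H2]. destruct n as [u v]; cbn [fst snd].
  assert (E1 : psum L (fun a => mismatch L (fun b => s (a, b)) v)
      = psum2 L (fun x => ne (s ((fst x + u)%Z, snd x)) (s ((fst x + u)%Z, (snd x + v)%Z)))).
  { unfold mismatch, psum2; cbn [fst snd]. rewrite psum_swap. apply psum_ext; intros b.
    symmetry. apply (psum_shift L (fun a => ne (s (a, b)) (s (a, (b + v)%Z)))).
    intros a. f_equal; apply H1. }
  assert (E2 : cross L s (u, v) = psum2 L (fun x => ne (s ((fst x + u)%Z, snd x)) (s x)
      * ne (s ((fst x + u)%Z, snd x)) (s ((fst x + u)%Z, (snd x + v)%Z)))).
  { unfold cross, psum2; cbn [fst snd]. apply psum_ext; intros b.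
    rewrite <- (psum_shift L _ u).
    - apply psum_ext; intros a. replace (a + u - u)%Z with a by lia. reflexivity.
    - intros a. replace (a + Z.of_nat L - u)%Z with (a - u + Z.of_nat L)%Z by lia.
      rewrite !(H1 _ _); auto. }
  rewrite E1, E2, <- psum2_scal.
  assert (E3 : psum L (fun b => mismatch L (fun a => s (a, b)) u) =
    psum2 L (fun x => ne (s x) (s ((fst x + u)%Z, snd x)))) by reflexivity.
  rewrite E3, <- psum2_plus. unfold Rminus. 
  replace (- psum2 L (fun x => 2 * (ne (s ((fst x + u)%Z, snd x)) (s x)
    * ne (s ((fst x + u)%Z, snd x)) (s ((fst x + u)%Z, (snd x + v)%Z)))))
    with (psum2 L (fun x => -1 * (2 * (ne (s ((fst x + u)%Z, snd x)) (s x)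
      * ne (s ((fst x + u)%Z, snd x)) (s ((fst x + u)%Z, (snd x + v)%Z)))))) by
      (rewrite psum2_scal; ring).
  rewrite <- psum2_plus. apply psum2_ext; intros [a b]; cbn [fst snd].
  rewrite (ne_cross (s (a, b)) (s ((a + u)%Z, b))). ring.
Qed.

Lemma cross_bounds L s n : 0 <= cross L s n <= INR L ^ 2.
Proof.
  assert (H : forall x, 0 <= ne (s x) (s ((fst x - fst n)%Z, snd x))
    * ne (s x) (s (fst x, (snd x + snd n)%Z)) <= 1).
  { intros x. pose proof (ne_bounds (s x) (s ((fst x - fst n)%Z, snd x))).
    pose proof (ne_bounds (s x) (s (fst x, (snd x + snd n)%Z))). nra. }
  split; [apply psum2_nonneg; apply H|].
  rewrite <- (Rmult_1_r (INR L ^ 2)), <- psum2_const. apply psum2_le; apply H.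
Qed.

Lemma cross_axis L s n : fst n = 0%Z \/ snd n = 0%Z -> cross L s n = 0.
Proof.
  intros H. rewrite <- (Rmult_0_r (INR L ^ 2)), <- psum2_const.
  apply psum2_ext; intros [a b]; cbn [fst snd].
  destruct H as [-> | ->]; [rewrite Z.sub_0_r | rewrite Z.add_0_r]; rewrite ne_refl; ring.
Qed.

(** Only the four diagonal displacements, with |n|^2 = 2, are kept. At a corner site at least one of
    the four choices of a horizontal and a vertical neighbour has both spins opposite to the
    site. *)
Lemma weight_cross_ge p L s : 4 < p ->
  Rpower 2 (- (p / 2)) * ncorner L s <= zsum (fun n => weight p n * cross L s n).
Proof.
  intros Hp.
  assert (HS : summable (fun n => weight p n * cross L s n)).
  { apply summable_weight_mult with (INR L ^ 2); auto. intros n Hn. pose proof (cross_bounds L s n).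
    pose proof (norm2_ge_1 n Hn). rewrite Rabs_pos_eq by lra. nra. }
  set (l := ((1, 1) :: (1, -1) :: (-1, 1) :: (-1, -1) :: nil)%Z : list site).
  apply Rle_trans with (sumR (fun n => weight p n * cross L s n) l).
  2:{ apply has_sum_ge_part.
      - intros n. apply Rmult_le_pos; [apply weight_nonneg | apply cross_bounds].
      - apply has_sum_zsum; auto.
      - unfold l. repeat constructor; simpl; intuition discriminate. }
  rewrite (sumR_ext_in _ (fun n => Rpower 2 (- (p / 2)) * cross L s n)).
  2:{ intros n Hn. f_equal. rewrite weight_Rpower.
      - f_equal. unfold norm2. destruct Hn as [<-|[<-|[<-|[<-|[]]]]]; simpl; ring.
      - intros ->. destruct Hn as [E|[E|[E|[E|[]]]]]; discriminate E. }
  rewrite sumR_scal. apply Rmult_le_compat_l; [left; apply exp_pos|].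
  unfold cross. rewrite <- psum2_sumR. apply psum2_le; intros [a b].
  unfold sumR, l; cbn [fold_right fst snd].
  replace (a - 1)%Z with (a + -1)%Z by lia. replace (a - -1)%Z with (a + 1)%Z by lia.
  unfold corner. replace (a - 1)%Z with (a + -1)%Z by lia. replace (b - 1)%Z with (b + -1)%Z by lia.
  unfold ne. destruct (s (a, b)), (s ((a + 1)%Z, b)), (s ((a + -1)%Z, b)), (s (a, (b + 1)%Z)),
    (s (a, (b + -1)%Z));
    simpl; lra.
Qed.

Lemma mismatch2_bounds L s n : 0 <= mismatch2 L s n <= INR L ^ 2.
Proof.
  split; [apply psum2_nonneg; intros; apply ne_bounds|].
  rewrite <- (Rmult_1_r (INR L ^ 2)), <- psum2_const. apply psum2_le; intros; apply ne_bounds.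
Qed.

Lemma summable_coupling_bounded p J (c : site -> R) C : 4 < p -> (forall n, 0 <= c n <= C) ->
  summable (fun n => coupling p J n * c n).
Proof.
  intros Hp Hc. apply summable_coupling with C; auto. intros n Hn. specialize (Hc n).
  pose proof (norm2_ge_1 n Hn). rewrite Rabs_pos_eq by lra. nra.
Qed.

Lemma zsum_coupling_snd p J (c : Z -> R) C : 4 < p -> (forall k, 0 <= c k <= C) ->
  zsum (fun n => coupling p J n * c (snd n)) = zsum (fun n => coupling p J n * c (fst n)).
Proof.
  intros Hp Hc. rewrite <- (zsum_bij swap swap (fun n => coupling p J n * c (fst n)));
    auto using swap_swap.
  - apply zsum_ext; intros [a b]. unfold swap; cbn [fst snd]. rewrite coupling_swap; reflexivity.
  - apply (summable_coupling_bounded p J (fun n => c (fst n)) C); auto.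
Qed.

Lemma energy_widths p J L s : 4 < p -> (0 < L)%nat -> per2 L s ->
  psum2 L (fun x => e_width p J (row_width L s x))
  + psum2 L (fun x => e_width p J (row_width L (transpose s) (swap x)))
  + 2 * (Rpower 2 (- (p / 2)) * ncorner L s) <= energy p J L s.
Proof.
  intros Hp HL Hs. pose proof Hs as [H1 H2]. unfold energy.
  assert (Hsum : forall (F : Z -> Z -> bool) (g : site -> Z) i,
    summable (fun n => coupling p J n * mismatch L (F i) (g n))).
  { intros F g i. apply summable_coupling_bounded with (INR L); auto. intros; apply mismatch_bounds.
    }
  assert (E : zsum (fun n => coupling p J n * mismatch2 L s n) =
     psum L (fun b => zsum (fun n => coupling p J n * mismatch L (fun a => s (a, b)) (fst n)))
     + psum L (fun a => zsum (fun n => coupling p J n * mismatch L (fun b => s (a, b)) (fst n)))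
     + 2 * zsum (fun n => weight p n * cross L s n)).
  { apply zsum_has_sum.
    apply has_sum_ext with (fun n =>
      sumR (fun i => coupling p J n * mismatch L (fun a => s (a, Z.of_nat i)) (fst n)) (seq 0 L)
      + sumR (fun i => coupling p J n * mismatch L (fun b => s (Z.of_nat i, b)) (snd n)) (seq 0 L)
      + 2 * (weight p n * cross L s n)).
    - intros n. rewrite mismatch2_decomp by auto. unfold psum. rewrite !sumR_scal.
      (* [cross] vanishes on the axes, where the nearest neighbours lie, so [J] drops out and the
         coupling acts on it as a pure repulsion. *)
      assert (Ec : coupling p J n * cross L s n = - (weight p n * cross L s n)).
      { unfold coupling. destruct (Z.eqb_spec (dist2 n zero_site) 1) as [Hn|Hn]; [|ring].
        apply nn_nbrs in Hn. rewrite cross_axis; [ring|].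
        unfold nbrs, zero_site in Hn. destruct Hn as [<-|[<-|[<-|[<-|[]]]]]; simpl; auto. }
      rewrite Rmult_minus_distr_l, Rmult_plus_distr_l.
      replace (coupling p J n * (2 * cross L s n)) with (2 * (coupling p J n * cross L s n)) by
        ring.
      rewrite Ec. ring.
    - apply has_sum_plus; [apply has_sum_plus|].
      + apply (has_sum_sumR (fun i n => coupling p J n
          * mismatch L (fun a => s (a, Z.of_nat i)) (fst n))
          (fun i => zsum (fun n => coupling p J n
            * mismatch L (fun a => s (a, Z.of_nat i)) (fst n)))).
        intros i _. apply has_sum_zsum, (Hsum (fun b a => s (a, b)) fst).
      + apply (has_sum_sumR (fun i n => coupling p J n
          * mismatch L (fun b => s (Z.of_nat i, b)) (snd n))
          (fun i => zsum (fun n => coupling p J n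
            * mismatch L (fun b => s (Z.of_nat i, b)) (fst n)))).
        intros i _. rewrite <- (zsum_coupling_snd p J _ (INR L)) by (auto using mismatch_bounds).
        apply has_sum_zsum, (Hsum (fun a b => s (a, b)) snd).
      + apply has_sum_scal, has_sum_zsum, summable_weight_mult with (INR L ^ 2); auto.
        intros n Hn. pose proof (cross_bounds L s n). pose proof (norm2_ge_1 n Hn).
        rewrite Rabs_pos_eq by lra. nra. }
  rewrite E. apply Rplus_le_compat; [apply Rplus_le_compat|].
  - apply psum_le; intros b. unfold row_width; cbn [fst snd]. apply row_energy; auto.
  - unfold psum2. rewrite psum_swap. apply psum_le; intros a.
    unfold row_width, transpose, swap; cbn [fst snd].
    apply row_energy; auto.
  - apply Rmult_le_compat_l; [lra | apply weight_cross_ge; auto].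
Qed.

(** * Corners and their charges *)

(** A site that has an opposite vertical neighbour and is not a corner agrees with its horizontal
    neighbours; this is used on both sides of the wall. *)
Lemma wall_extends s a b : s (a, b) <> s (a, b + 1)%Z ->
  corner s (a, b) = false -> corner s (a, b + 1)%Z = false ->
  s (a + 1, b)%Z = s (a, b) /\ s (a + 1, b + 1)%Z = s (a, b + 1)%Z.
Proof.
  unfold corner. replace (b + 1 - 1)%Z with b by lia.
  destruct (s (a, b)), (s (a, b + 1)%Z), (s (a + 1, b)%Z), (s (a + 1, b + 1)%Z); simpl;
    rewrite ?orb_true_r; simpl; try congruence; auto; intros; try discriminate;
    destruct (xorb _ _); discriminate.
Qed.

Lemma wall_extends_n s a b n : s (a, b) <> s (a, b + 1)%Z ->
  (forall i, (i < n)%nat -> corner s (a + Z.of_nat i, b)%Z =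
    false /\ corner s (a + Z.of_nat i, b + 1)%Z = false) ->
  s (a + Z.of_nat n, b)%Z = s (a, b) /\ s (a + Z.of_nat n, b + 1)%Z = s (a, b + 1)%Z.
Proof.
  intros Hne Hc. induction n as [|n IH].
  - rewrite !Z.add_0_r; auto.
  - destruct IH as [E1 E2]; [intros i Hi; apply Hc; lia|].
    destruct (Hc n) as [C1 C2]; [lia|].
    replace (a + Z.of_nat (S n))%Z with (a + Z.of_nat n + 1)%Z by lia.
    rewrite <- E1, <- E2. apply wall_extends; congruence.
Qed.

(* A vertical and a horizontal wall, both extended straight, would have to cross. *)
Lemma corner_exists s a b r t :
  s (a + Z.of_nat r, b)%Z <> s (a + Z.of_nat r + 1, b)%Z ->
  s (a, b + Z.of_nat t)%Z <> s (a, b + Z.of_nat t + 1)%Z ->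
  exists i j, (i <= S r)%nat /\ (j <= S t)%nat /\ corner s (a + Z.of_nat i, b + Z.of_nat j)%Z =
    true.
Proof.
  intros Hr Ht. apply NNPP; intros Hno.
  assert (Hc : forall i j, (i <= S r)%nat -> (j <= S t)%nat ->
    corner s (a + Z.of_nat i, b + Z.of_nat j)%Z = false).
  { intros i j Hi Hj. destruct (corner s _) eqn:E; auto. exfalso; apply Hno; eauto. }
  assert (Hh : forall n, (n <= S r)%nat -> s (a + Z.of_nat n, b + Z.of_nat t)%Z =
    s (a, b + Z.of_nat t)%Z).
  { intros n Hn. apply (wall_extends_n s a (b + Z.of_nat t)%Z n Ht). intros i Hi. split.
    - apply Hc; lia.
    - replace (b + Z.of_nat t + 1)%Z with (b + Z.of_nat (S t))%Z by lia. apply Hc; lia. }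
  assert (Hv : s (a + Z.of_nat r, b + Z.of_nat t)%Z = s (a + Z.of_nat r, b)%Z /\
               s (a + Z.of_nat r + 1, b + Z.of_nat t)%Z = s (a + Z.of_nat r + 1, b)%Z).
  { apply (wall_extends_n (transpose s) b (a + Z.of_nat r)%Z t); [exact Hr|].
    intros i Hi. rewrite !corner_transpose. unfold swap; cbn [fst snd]. split.
    - apply Hc; lia.
    - replace (a + Z.of_nat r + 1)%Z with (a + Z.of_nat (S r))%Z by lia. apply Hc; lia. }
  pose proof (Hh r ltac:(lia)). pose proof (Hh (S r) ltac:(lia)) as H'.
  replace (a + Z.of_nat (S r))%Z with (a + Z.of_nat r + 1)%Z in H' by lia.
  destruct Hv. congruence.
Qed.

(** Within a block of length n, each value of [K] is met by at most n sites, each of which counts it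
    with weight 1 / n. *)
Lemma charge_row L f (K : Z -> R) : (0 < L)%nat -> periodic L f -> periodic L K ->
  (forall x, 0 <= K x) ->
  psum L (fun z => if Nat.eqb (width f L z) 0 then 0 else
     / INR (width f L z) * sumR (fun i => K (z + Z.of_nat i)%Z) (seq 0 (S (right_gap f L z)))) <=
       psum L K.
Proof.
  intros HL Hf HK HK0. destruct (classic (exists x0, jump f x0 = true)) as [[x0 Hx0]|Hno].
  - rewrite (psum_blocks L f K x0 HL Hf HK Hx0).
    rewrite (psum_blocks L f (fun z => if Nat.eqb (width f L z) 0 then 0 else _) x0); auto.
    2:{ intros z. cbv beta. rewrite (width_periodic L f L Hf z), (right_gap_periodic L f L Hf z).
        destruct (Nat.eqb _ _); auto. f_equal. apply sumR_ext; intros i.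
        replace (z + Z.of_nat L + Z.of_nat i)%Z with (z + Z.of_nat i + Z.of_nat L)%Z by lia.
        apply HK. }
    apply psum_le; intros x. destruct (jump f x) eqn:Ex; [|lra].
    set (n := next_block f L x).
    assert (Hn : (0 < n)%nat) by (unfold n, next_block; lia).
    assert (HnR : 0 < INR n) by (apply lt_0_INR; auto).
    set (T := sumR (fun j => K (x + 1 + Z.of_nat j)%Z) (seq 0 n)).
    apply Rle_trans with (sumR (fun _ => / INR n * T) (seq 0 n)).
    2:{ rewrite sumR_const, length_seq, <- Rmult_assoc, Rinv_r by lra. lra. }
    apply sumR_le_in; intros j Hj. apply in_seq in Hj.
    destruct (next_block_gaps L f x0 x j) as (_ & E1 & E2); auto; [fold n; lia|].
    rewrite E1, E2. fold n. rewrite (proj2 (Nat.eqb_neq n 0)) by lia.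
    apply Rmult_le_compat_l; [left; apply Rinv_0_lt_compat; auto|].
    unfold T. replace n with (j + (S (n - 1 - j)))%nat at 2 by lia.
    rewrite seq_app, sumR_app.
    assert (0 <= sumR (fun j => K (x + 1 + Z.of_nat j)%Z) (seq 0 j)) by (apply sumR_nonneg; auto).
    assert (Es : forall m k, sumR (fun i => K (x + 1 + Z.of_nat k + Z.of_nat i)%Z) (seq 0 m)
                = sumR (fun i => K (x + 1 + Z.of_nat i)%Z) (seq k m)).
    { intros m; induction m as [|m IHm]; intros k; [reflexivity|].
      rewrite !seq_S, !sumR_app, IHm. simpl. do 3 f_equal. lia. }
    rewrite Es. simpl (0 + j)%nat. lra.
  - rewrite (psum_ext L _ (fun _ => 0)), psum_const.
    + rewrite Rmult_0_r. apply psum_nonneg; auto.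
    + intros z. unfold width. rewrite right_gap_no_jump, Nat.ltb_irrefl; auto.
      intros x. destruct (jump f x) eqn:E; auto. exfalso; eauto.
Qed.

(** Up to the factor 2 tau, the most by which a site can fall below the minimum when [b] <= [A]: the
    block of length [b] gives at least the minimum, the other one at least -2 tau / a. Constant
    lines have length 0 and are not charged. *)
Definition charge (A a b : nat) : R :=
  if (Nat.ltb 0 a && Nat.ltb 0 b && Nat.leb b A)%bool then / INR a else 0.

Lemma width_jump f L z : width f L z <> O -> jump f (z + Z.of_nat (right_gap f L z)) =
  true /\ (S (right_gap f L z) <= width f L z)%nat.
Proof.
  unfold width. destruct (Nat.ltb_spec (right_gap f L z) L) as [H|H]; [|tauto]. intros _.
  split; [|lia].
  apply (first_lt (fun i => jump f (z + Z.of_nat i))); auto.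
Qed.

Lemma xorb_true_neq a b : xorb a b = true -> a <> b.
Proof. destruct a, b; simpl; congruence. Qed.

(** By [corner_exists] a charged site has a corner in the rectangle spanned by the rest of its two
    blocks, at vertical offset at most [A]. For each of the A + 1 offsets [charge_row] bounds the
    cost by the sum of [kap2], twice the number of corners. *)
Lemma charge_bound L s A : (0 < L)%nat -> per2 L s ->
  psum2 L (fun x => charge A (row_width L s x) (row_width L (transpose s) (swap x)))
  <= 2 * INR (S A) * ncorner L s.
Proof.
  intros HL Hs. pose proof Hs as [H1 H2].
  set (kap := fun x => if corner s x then 1 else 0).
  (* The corner may lie one column past the end of the block; [kap2] detects it from the last site
     inside. *)
  set (kap2 := fun x : site => kap x + kap ((fst x + 1)%Z, snd x)).
  assert (Hk0 : forall x, 0 <= kap x) by (intros x; unfold kap; destruct (corner s x); lra).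
  assert (Hk20 : forall x, 0 <= kap2 x).
  { intros x; unfold kap2. pose proof (Hk0 x). pose proof (Hk0 ((fst x + 1)%Z, snd x)). lra. }
  pose proof (corner_per2 L s Hs) as Hkp. fold kap in Hkp.
  assert (Hk2p : per2 L kap2).
  { destruct Hkp as [P1 P2]. split; intros y x; unfold kap2; cbn [fst snd].
    - replace (x + Z.of_nat L + 1)%Z with (x + 1 + Z.of_nat L)%Z by lia. rewrite !(P1 _ _); auto.
    - rewrite !(P2 _ _); auto. }
  apply Rle_trans with (psum2 L (fun x => sumR (fun j => if Nat.eqb (row_width L s x) 0 then 0 else
     / INR (row_width L s x) * sumR (fun i => kap2 ((fst x + Z.of_nat i)%Z, (snd x + Z.of_nat j)%Z))
       (seq 0 (S (right_gap (fun a => s (a, snd x)) L (fst x))))) (seq 0 (S A)))).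
  - apply psum2_le; intros [a b]. unfold charge.
    destruct (Nat.ltb_spec 0 (row_width L s (a, b))) as [Ha|Ha]; simpl andb.
    2:{ apply sumR_nonneg; intros. destruct (Nat.eqb_spec (row_width L s (a, b)) 0); [lra | lia]. }
    rewrite (proj2 (Nat.eqb_neq _ 0)) by lia.
    assert (Hinv : 0 < / INR (row_width L s (a, b))) by (apply Rinv_0_lt_compat, lt_0_INR; auto).
    rewrite sumR_scal. rewrite <- (Rmult_1_r (/ INR _)) at 1.
    assert (Hnn : 0 <= sumR (fun j => sumR (fun i
      => kap2 ((fst (a, b) + Z.of_nat i)%Z, (snd (a, b) + Z.of_nat j)%Z))
       (seq 0 (S (right_gap (fun a0 => s (a0, snd (a, b))) L (fst (a, b)))))) (seq 0 (S A))).
    { apply sumR_nonneg; intros; apply sumR_nonneg; auto. }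
    destruct (Nat.ltb_spec 0 (row_width L (transpose s) (swap (a, b)))) as [Hb|Hb]; simpl andb.
    2:{ apply Rmult_le_pos; [lra | exact Hnn]. }
    destruct (Nat.leb_spec (row_width L (transpose s) (swap (a, b))) A) as [HbA|HbA].
    2:{ apply Rmult_le_pos; [lra | exact Hnn]. }
    rewrite Rmult_1_r at 1. rewrite <- (Rmult_1_r (/ INR _)) at 1.
    apply Rmult_le_compat_l; [lra|]. cbn [fst snd] in *.
    unfold row_width in Ha, Hb, HbA. unfold swap in Hb, HbA; cbn [fst snd] in *.
    destruct (width_jump (fun a => s (a, b)) L a) as [Hja _]; [lia|].
    destruct (width_jump (fun b' => transpose s (b', a)) L b) as [Hjb Hwb]; [lia|].
    set (r := right_gap (fun a => s (a, b)) L a) in *.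
    set (t := right_gap (fun b' => transpose s (b', a)) L b) in *.
    destruct (corner_exists s a b r t) as (i & j & Hi & Hj & Hc).
    { apply xorb_true_neq, Hja. }
    { apply xorb_true_neq, Hjb. }
    assert (Hij : exists i', (i' <= r)%nat /\ 1 <= kap2 ((a + Z.of_nat i')%Z, (b + Z.of_nat j)%Z)).
    { destruct (Nat.le_gt_cases i r) as [Hle|Hgt].
      - exists i; split; auto. unfold kap2. unfold kap at 1. rewrite Hc.
        pose proof (Hk0 ((fst ((a + Z.of_nat i)%Z, (b + Z.of_nat j)%Z) + 1)%Z,
          snd ((a + Z.of_nat i)%Z, (b + Z.of_nat j)%Z))). lra.
      - exists r; split; auto. unfold kap2. cbn [fst snd].
        replace (a + Z.of_nat r + 1)%Z with (a + Z.of_nat i)%Z by lia. unfold kap at 2. rewrite Hc.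
        pose proof (Hk0 ((a + Z.of_nat r)%Z, (b + Z.of_nat j)%Z)). lra. }
    destruct Hij as (i' & Hi' & Hk).
    eapply Rle_trans; [exact Hk|].
    eapply Rle_trans; [|apply (sumR_term_le (fun j
      => sumR (fun i => kap2 ((a + Z.of_nat i)%Z, (b + Z.of_nat j)%Z)) (seq 0 (S r))) (seq 0 (S A))
      j)].
    + apply (sumR_term_le (fun i => kap2 ((a + Z.of_nat i)%Z, (b + Z.of_nat j)%Z))); auto.
      apply in_seq; lia.
    + intros; apply sumR_nonneg; auto.
    + apply in_seq; lia.
  - rewrite psum2_sumR.
    apply Rle_trans with (sumR (fun _ => 2 * ncorner L s) (seq 0 (S A))).
    2:{ rewrite sumR_const, length_seq. right; ring. }
    apply sumR_le_in; intros j _.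
    apply Rle_trans with (psum2 L (fun x => kap2 ((fst x + 0)%Z, (snd x + Z.of_nat j)%Z))).
    + apply psum_le; intros b. unfold row_width; cbn [fst snd].
      rewrite (psum_ext L (fun a => kap2 ((a + 0)%Z, (b + Z.of_nat j)%Z))
        (fun a => kap2 (a, (b + Z.of_nat j)%Z)))
        by (intros; rewrite Z.add_0_r; auto).
      apply (charge_row L (fun a => s (a, b)) (fun a => kap2 (a, (b + Z.of_nat j)%Z))); auto.
      apply Hk2p.
    + rewrite psum2_shift by auto. unfold kap2. rewrite psum2_plus.
      rewrite (psum2_ext L (fun x => kap ((fst x + 1)%Z, snd x))
        (fun x => kap ((fst x + 1)%Z, (snd x + 0)%Z)))
        by (intros; rewrite Z.add_0_r; auto).
      rewrite psum2_shift by auto. unfold ncorner. fold kap. lra.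
Qed.

Lemma e_width_pair p J A es a b : 4 < p -> (0 < A)%nat -> J < Jc p ->
  (forall h, (0 < h)%nat -> es <= e_s p J h) -> INR A * es <= -4 * (Jc p - J) ->
  es - 2 * (Jc p - J) * (charge A a b + charge A b a) <= e_width p J a + e_width p J b.
Proof.
  intros Hp HA HJ Hes HAe. assert (HAR : 0 < INR A) by (apply lt_0_INR; auto).
  set (tau := Jc p - J) in *. assert (Ht : 0 < tau) by (unfold tau; lra).
  (* Used for constant lines, whose energy 0 is thus no smaller than [es]. *)
  assert (Hes0 : es <= 0) by nra.
  assert (Hc0 : forall a b, 0 <= charge A a b).
  { intros a' b'; unfold charge. destruct (Nat.ltb_spec 0 a'); simpl; [|lra].
    destruct (_ && _)%bool; [left; apply Rinv_0_lt_compat, lt_0_INR; auto | lra]. }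
  assert (Hlow : forall h, (0 < h)%nat -> -2 * tau * / INR h <= e_s p J h).
  { intros h Hh. pose proof (e_s_lower p J h Hp Hh) as He. fold tau in He.
    assert (0 < INR h) by (apply lt_0_INR; auto).
    apply Rmult_le_reg_l with (INR h); auto.
    replace (INR h * (-2 * tau * / INR h)) with (-2 * tau) by (field; lra). auto. }
  pose proof (Hc0 a b). pose proof (Hc0 b a).
  unfold e_width. destruct (Nat.eqb_spec a 0) as [->|Ha], (Nat.eqb_spec b 0) as [->|Hb].
  - nra.
  - specialize (Hes b ltac:(lia)). nra.
  - specialize (Hes a ltac:(lia)). nra.
  - pose proof (Hes a ltac:(lia)). pose proof (Hes b ltac:(lia)).
    pose proof (Hlow a ltac:(lia)) as La. pose proof (Hlow b ltac:(lia)) as Lb.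
    destruct (Nat.le_gt_cases b A) as [HbA|HbA]; [|destruct (Nat.le_gt_cases a A) as [HaA|HaA]].
    + assert (E : charge A a b = / INR a).
      { unfold charge. rewrite (proj2 (Nat.ltb_lt 0 a)), (proj2 (Nat.ltb_lt 0 b)),
          (proj2 (Nat.leb_le b A)) by lia. reflexivity. }
      rewrite E in *. nra.
    + assert (E : charge A b a = / INR b).
      { unfold charge. rewrite (proj2 (Nat.ltb_lt 0 a)), (proj2 (Nat.ltb_lt 0 b)),
          (proj2 (Nat.leb_le a A)) by lia. reflexivity. }
      rewrite E in *. nra.
    + assert (Hi : forall h, (A < h)%nat -> / INR h <= / INR A).
      { intros h Hh. apply Rinv_le_contravar; auto. apply le_INR; lia. }
      pose proof (Hi a HaA). pose proof (Hi b HbA).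
      assert (Es : es <= -4 * tau * / INR A).
      { apply Rmult_le_reg_l with (INR A); auto.
        replace (INR A * (-4 * tau * / INR A)) with (-4 * tau) by (field; lra). auto. }
      nra.
Qed.

Lemma energy_lower p J L s A es : 4 < p -> (0 < L)%nat -> per2 L s -> (0 < A)%nat -> J < Jc p ->
  (forall h, (0 < h)%nat -> es <= e_s p J h) -> INR A * es <= -4 * (Jc p - J) ->
  8 * (Jc p - J) * INR (S A) <= Rpower 2 (- (p / 2)) ->
  INR L ^ 2 * es + Rpower 2 (- (p / 2)) * ncorner L s <= energy p J L s.
Proof.
  intros Hp HL Hs HA HJ Hes HAe HA8.
  eapply Rle_trans; [|apply energy_widths; auto].
  pose proof (charge_bound L s A HL Hs) as C1.
  pose proof (charge_bound L (transpose s) A HL (per2_transpose L s Hs)) as C2.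
  rewrite ncorner_transpose, <- psum2_swap in C2.
  set (c1 := psum2 L (fun x => charge A (row_width L s x) (row_width L (transpose s) (swap x)))) in
    *.
  assert (E2 : psum2 L (fun x => charge A (row_width L (transpose s) (swap x))
    (row_width L (transpose (transpose s)) (swap (swap x))))
     = psum2 L (fun x => charge A (row_width L (transpose s) (swap x)) (row_width L s x))) by
       reflexivity.
  rewrite E2 in C2. clear E2.
  set (c2 := psum2 L (fun x => charge A (row_width L (transpose s) (swap x)) (row_width L s x))) in
    *.
  assert (Hpt : psum2 L (fun x => es + (-2 * (Jc p - J))
    * (charge A (row_width L s x) (row_width L (transpose s) (swap x))
      + charge A (row_width L (transpose s) (swap x)) (row_width L s x))) <=
      psum2 L (fun x => e_width p J (row_width L s x)
        + e_width p J (row_width L (transpose s) (swap x)))).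
  { apply psum2_le; intros x.
    pose proof (e_width_pair p J A es (row_width L s x) (row_width L (transpose s) (swap x))
      Hp HA HJ Hes HAe). lra. }
  rewrite !psum2_plus, psum2_const, psum2_scal, psum2_plus in Hpt. fold c1 c2 in Hpt.
  assert (Hn : 0 <= ncorner L s).
  { apply psum2_nonneg; intros x. destruct (corner s x); lra. }
  set (W := Rpower 2 (- (p / 2))) in *. set (N := ncorner L s) in *.
  (* The charges of both directions cost at most 8 tau (A + 1) <= W per corner, while
     [energy_widths] supplies 2 W; one W per corner is left. *)
  assert (2 * (Jc p - J) * (c1 + c2) <= 2 * (Jc p - J) * (4 * INR (S A) * N)) by
    (apply Rmult_le_compat_l; lra).
  assert (8 * (Jc p - J) * INR (S A) * N <= W * N) by (apply Rmult_le_compat_r; lra).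
  lra.
Qed.

(** * Finite perturbations of striped states *)

(** The trial width h0 is the integer part of W / (64 tau), and eps forces h0 > H + 1. Then tail(h0)
    < W / 128 <= h0 tau, so [e_s_upper] gives h0 es <= - tau. With A = 4 h0 the last condition reads
    32 h0 tau + 8 tau <= W, where 32 h0 tau <= W / 2. *)
Lemma width_scale_exists p : 4 < p -> exists eps, 0 < eps /\ forall J es, Jc p - eps < J < Jc p ->
  (forall h, (0 < h)%nat -> es <= e_s p J h) ->
  exists A, (0 < A)%nat /\ INR A * es <= -4 * (Jc p - J) /\
    8 * (Jc p - J) * INR (S A) <= Rpower 2 (- (p / 2)).
Proof.
  intros Hp. set (W := Rpower 2 (- (p / 2))). assert (HW : 0 < W) by apply exp_pos.
  destruct (proj1 (is_lim_seq_Rabs _ _) (tail_lim p Hp) (W / 128)) as [H HH]; [lra|].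
  pose proof (pos_INR H) as HHR.
  exists (W / (64 * (INR H + 2))). split; [apply Rdiv_lt_0_compat; lra|].
  intros J es HJ Hes. set (tau := Jc p - J).
  assert (Ht : 0 < tau) by (unfold tau; lra).
  assert (Ht2 : tau * (64 * (INR H + 2)) < W).
  { assert (tau < W / (64 * (INR H + 2))) by (unfold tau; lra). apply Rlt_div_r in H0; lra. }
  destruct (nfloor_ex (W / (64 * tau))) as [h0 [Hh1 Hh2]]; [apply Rdiv_le_0_compat; lra|].
  assert (Hh1' : INR h0 * (64 * tau) <= W) by (apply Rle_div_r; lra).
  assert (Hh2' : W < (INR h0 + 1) * (64 * tau)) by (apply Rlt_div_l; lra).
  assert (Hbig : INR H + 1 < INR h0) by nra.
  assert (Hh0 : (H <= h0 /\ 0 < h0)%nat).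
  { split; [apply INR_le; lra | apply INR_lt; simpl; lra]. }
  destruct Hh0 as [HhH Hh0].
  exists (4 * h0)%nat. split; [lia|].
  specialize (HH h0 HhH). rewrite Rminus_0_r in HH. apply Rabs_def2 in HH.
  assert (Hprod : W / 128 <= INR h0 * tau) by nra.
  rewrite (S_INR (4 * h0)), (mult_INR 4 h0). replace (INR 4) with 4 by (simpl; ring). split.
  - pose proof (e_s_upper p J h0 Hp Hh0) as Hu. fold tau in Hu. specialize (Hes h0 Hh0).
    assert (HI : 0 < INR h0) by lra.
    assert (/ INR h0 * tail p h0 <= tau).
    { apply Rmult_le_reg_l with (INR h0); auto. rewrite <- Rmult_assoc, Rinv_r by lra. lra. }
    nra.
  - nra.
Qed.

(** * The finite-volume Hamiltonian as a sum over displacements *)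

Lemma memb_iff x X : memb x X = true <-> In x X.
Proof.
  unfold memb; rewrite existsb_exists. split.
  - intros (y & Hy & E). destruct (site_eqb_spec x y); [subst; auto | discriminate].
  - intros Hx; exists x; split; auto. destruct (site_eqb_spec x x); auto.
Qed.

Definition shift (x n : site) : site := ((fst x + fst n)%Z, (snd x + snd n)%Z).

(* A pair inside X occurs twice among the ordered pairs, a pair leaving X only once. *)
Definition bmult (X : list site) (y : site) : R := if memb y X then 1 else 2.

Lemma sumR_nbrs_shift (c : site -> R) x : sumR (fun n => c (shift x n)) (nbrs zero_site) =
  sumR c (nbrs x).
Proof.
  destruct x as [a b]. unfold nbrs, sumR, shift, zero_site; cbn [fst snd fold_right].
  rewrite !Z.add_0_r. reflexivity.
Qed.

Lemma sumR_memb_swap (c : site -> R) X Y : NoDup X -> NoDup Y ->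
  sumR (fun y => if memb y Y then c y else 0) X = sumR (fun y => if memb y X then c y else 0) Y.
Proof.
  intros HX HY. rewrite <- !sumR_filter. apply sumR_perm, NoDup_Permutation;
    auto using NoDup_filter.
  intros x. rewrite !filter_In, !memb_iff. tauto.
Qed.

Lemma nn_memb x y : nn x y = memb y (nbrs x).
Proof.
  apply eq_true_iff_eq. unfold nn. rewrite Z.eqb_eq, memb_iff.
  destruct x as [a b], y as [c d]. unfold dist2, nbrs; cbn [fst snd In].
  split.
  - intros H. assert (-1 <= a - c <= 1)%Z by nia. assert (-1 <= b - d <= 1)%Z by nia.
    assert ((c = a + 1 \/ c = a - 1) /\ d = b \/ c = a /\ (d = b + 1 \/ d = b - 1))%Z
      as [[[-> | ->] ->]|[-> [-> | ->]]] by nia; tauto.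
  - intros [H|[H|[H|[H|[]]]]]; inversion H; ring.
Qed.

Lemma NoDup_nbrs x : NoDup (nbrs x).
Proof.
  destruct x as [a b]; unfold nbrs; cbn [fst snd].
  repeat constructor; simpl; intros Hx; repeat destruct Hx as [Hx|Hx]; try contradiction;
    inversion Hx; lia.
Qed.

Lemma bmult_bounds X y : 1 <= bmult X y <= 2.
Proof. unfold bmult; destruct (memb y X); lra. Qed.

Lemma summable_shift (f : site -> R) x : summable f ->
  summable (fun y => f ((fst y - fst x)%Z, (snd y - snd x)%Z)).
Proof.
  apply (summable_inj (fun y : site => ((fst y - fst x)%Z, (snd y - snd x)%Z) : site)).
  intros [u v] [u' v'] H; inversion H. f_equal; lia.
Qed.

(** The share of one site in the four sums of [H_X], rewritten by displacement so that it can be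
    compared term by term with the energy of a torus. *)
Lemma site_energy p J X s sg x : 4 < p -> NoDup X -> In x X -> (forall y, ~ In y X -> sg y = s y) ->
  zsum (fun n => coupling p J n * (ne (sg x) (sg (shift x n)) * bmult X (shift x n))) =
  - J * (/ 2) * sumR (fun y => if nn x y then bond (sg x) (sg y) else 0) X
  + / 2 * sumR (fun y => if site_eqb x y then 0 else bond (sg x) (sg y) / dpow p x y) X
  - J * sumR (fun y => if memb y X then 0 else bond (sg x) (s y)) (nbrs x)
  + zsum (fun y => if memb y X then 0 else bond (sg x) (s y) / dpow p x y).
Proof.
  intros Hp HX Hx Hs.
  set (c := fun n => ne (sg x) (sg (shift x n)) * bmult X (shift x n)).
  assert (Hc : forall n, n <> zero_site -> Rabs (c n) <= 2 * norm2 n).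
  { intros n Hn. pose proof (norm2_ge_1 n Hn). pose proof (ne_bounds (sg x) (sg (shift x n))).
    pose proof (bmult_bounds X (shift x n)). unfold c. rewrite Rabs_pos_eq by nra. nra. }
  transitivity (zsum (fun n => coupling p J n * c n)); [reflexivity|].
  rewrite (zsum_coupling p J c 2 Hp Hc).
  set (g := fun y : site => weight p ((fst y - fst x)%Z, (snd y - snd x)%Z) * ne (sg x) (sg y)).
  assert (Hg : summable g).
  { apply (summable_le _ (fun y => (fun n => weight p n) ((fst y - fst x)%Z, (snd y - snd x)%Z))).
    - intros y. unfold g. pose proof (weight_nonneg p ((fst y - fst x)%Z, (snd y - snd x)%Z)).
      pose proof (ne_bounds (sg x) (sg y)). rewrite Rabs_pos_eq by nra. nra.
    - apply (summable_shift (weight p)), summable_weight; auto. }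
  assert (E1 : sumR c (nbrs zero_site) = sumR (fun y => if nn x y then ne (sg x) (sg y) else 0) X
       + 2 * sumR (fun y => if memb y X then 0 else ne (sg x) (s y)) (nbrs x)).
  { unfold c. rewrite (sumR_nbrs_shift (fun y => ne (sg x) (sg y) * bmult X y)).
    rewrite (sumR_ext _ (fun y => if memb y (nbrs x) then ne (sg x) (sg y) else 0) X) by
      (intros; rewrite nn_memb; auto).
    rewrite sumR_memb_swap by auto using NoDup_nbrs. rewrite <- sumR_scal, <- sumR_plus.
    apply sumR_ext; intros y; unfold bmult. destruct (memb y X) eqn:E; [ring|].
    rewrite (Hs y); [ring|]. rewrite <- memb_iff, E; discriminate. }
  assert (E2 : zsum (fun n => weight p n * c n) = zsum (fun y => g y * bmult X y)).
  { rewrite <- (zsum_bij (fun n => ((fst n + fst x)%Z, (snd n + snd x)%Z))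
      (fun y => ((fst y - fst x)%Z, (snd y - snd x)%Z)) (fun y => g y * bmult X y)).
    - apply zsum_ext; intros [u v]. unfold g, c, shift; cbn [fst snd].
      replace (u + fst x - fst x)%Z with u by lia. replace (v + snd x - snd x)%Z with v by lia.
      rewrite (Z.add_comm u), (Z.add_comm v). ring.
    - apply summable_le with (fun y => Rabs (2 * g y)).
      + intros y. rewrite !Rabs_mult, (Rabs_pos_eq 2), Rmult_comm by lra.
        pose proof (bmult_bounds X y).
        rewrite (Rabs_pos_eq (bmult X y)) by lra. apply Rmult_le_compat_r; [apply Rabs_pos | lra].
      + apply summable_Rabs, summable_scal; auto.
    - intros [u v]; cbn [fst snd]; f_equal; lia.
    - intros [u v]; cbn [fst snd]; f_equal; lia. }
  set (gx := fun y => if memb y X then g y else 0).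
  assert (Hgx : has_sum gx (sumR gx X)).
  { apply has_sum_finite; auto. intros y Hy. unfold gx. destruct (memb y X) eqn:E; auto.
    apply memb_iff in E; tauto. }
  assert (Hgo : summable (fun y => g y - gx y)).
  { apply summable_le with (fun y => Rabs (g y)).
    - intros y; unfold gx. destruct (memb y X);
        [rewrite Rminus_diag, Rabs_R0; apply Rabs_pos | rewrite Rminus_0_r; lra].
    - apply summable_Rabs; auto. }
  assert (E3 : zsum (fun y => g y * bmult X y) = sumR gx X + 2 * zsum (fun y => g y - gx y)).
  { apply zsum_has_sum. apply has_sum_ext with (fun y => gx y + 2 * (g y - gx y)).
    - intros y; unfold gx, bmult. destruct (memb y X); ring.
    - apply has_sum_plus; auto. apply has_sum_scal, has_sum_zsum; auto. }
  assert (E4 : zsum (fun y => if memb y X then 0 else bond (sg x) (s y) / dpow p x y) = -2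
    * zsum (fun y => g y - gx y)).
  { rewrite <- zsum_scal by auto. apply zsum_ext; intros y; unfold gx.
    destruct (memb y X) eqn:E; [ring|].
    unfold g. rewrite weight_sub. destruct (site_eqb_spec y x) as [->|Hne].
    - exfalso. apply memb_iff in Hx; congruence.
    - rewrite bond_ne, (Hs y) by (rewrite <- memb_iff, E; discriminate). unfold Rdiv; ring. }
  assert (E5 : sumR (fun y => if site_eqb x y then 0 else bond (sg x) (sg y) / dpow p x y) X = -2
    * sumR gx X).
  { rewrite <- sumR_scal. apply sumR_ext_in; intros y Hy. unfold gx.
    rewrite (proj2 (memb_iff y X) Hy).
    unfold g. rewrite weight_sub, bond_ne.
    destruct (site_eqb_spec x y), (site_eqb_spec y x); try congruence; unfold Rdiv; ring. }
  assert (E6 : sumR (fun y => if nn x y then bond (sg x) (sg y) else 0) X = -2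
    * sumR (fun y => if nn x y then ne (sg x) (sg y) else 0) X).
  { rewrite <- sumR_scal. apply sumR_ext; intros y. rewrite bond_ne. destruct (nn x y); ring. }
  assert (E7 : sumR (fun y => if memb y X then 0 else bond (sg x) (s y)) (nbrs x) = -2
    * sumR (fun y => if memb y X then 0 else ne (sg x) (s y)) (nbrs x)).
  { rewrite <- sumR_scal. apply sumR_ext; intros y. rewrite bond_ne. destruct (memb y X); ring. }
  rewrite E1, E2, E3, E4, E5, E6, E7. field.
Qed.

Lemma H_X_eq p J X s sg : 4 < p -> NoDup X -> (forall y, ~ In y X -> sg y = s y) ->
  H_X p J X sg s = sumR (fun x => zsum (fun n => coupling p J n
    * (ne (sg x) (sg (shift x n)) * bmult X (shift x n)))) X.
Proof.
  intros Hp HX Hs. unfold H_X. rewrite <- !sumR_scal, <- sumR_plus, <- sumR_minus, <- sumR_plus.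
  apply sumR_ext_in; intros x Hx. symmetry. apply site_energy; auto.
Qed.

Lemma H_X_ext p J X sg sg' s s' : (forall x, In x X -> sg x = sg' x) ->
  (forall x, ~ In x X -> s x = s' x) ->
  H_X p J X sg s = H_X p J X sg' s'.
Proof.
  intros Hg Hs.
  assert (Hm : forall y, memb y X = false -> s y = s' y).
  { intros y Hy. apply Hs. rewrite <- memb_iff, Hy; discriminate. }
  unfold H_X. f_equal; [f_equal; [f_equal|]|].
  - f_equal. apply sumR_ext_in; intros x Hx. apply sumR_ext_in; intros y Hy.
    rewrite (Hg x), (Hg y); auto.
  - f_equal. apply sumR_ext_in; intros x Hx. apply sumR_ext_in; intros y Hy.
    rewrite (Hg x), (Hg y); auto.
  - f_equal. apply sumR_ext_in; intros x Hx. apply sumR_ext_in; intros y Hy.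
    destruct (memb y X) eqn:E; auto. rewrite (Hg x), (Hm y); auto.
  - apply sumR_ext_in; intros x Hx. apply zsum_ext; intros y.
    destruct (memb y X) eqn:E; auto. rewrite (Hg x), (Hm y); auto.
Qed.

(** * Periodized perturbations *)

(* Representative of x modulo 2M in the window [-M, M)^2. *)
Definition fold1 (M : nat) (u : Z) : Z := ((u + Z.of_nat M) mod Z.of_nat (2 * M) - Z.of_nat M)%Z.
Definition foldp (M : nat) (x : site) : site := (fold1 M (fst x), fold1 M (snd x)).
Definition in_window (M : nat) (x : site) : Prop :=
  (- Z.of_nat M <= fst x < Z.of_nat M)%Z /\ (- Z.of_nat M <= snd x < Z.of_nat M)%Z.

Lemma fold1_id M u : (- Z.of_nat M <= u < Z.of_nat M)%Z -> fold1 M u = u.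
Proof. intros H; unfold fold1. rewrite Z.mod_small by lia. lia. Qed.

Lemma fold1_periodic M : periodic (2 * M) (fold1 M).
Proof.
  intros u; unfold fold1. f_equal.
  replace (u + Z.of_nat (2 * M) + Z.of_nat M)%Z with (u + Z.of_nat M + 1 * Z.of_nat (2 * M))%Z by
    lia.
  destruct M; [simpl; rewrite !Zmod_0_r; lia|]. apply Z_mod_plus_full.
Qed.

Lemma foldp_id M x : in_window M x -> foldp M x = x.
Proof. intros [H1 H2]; unfold foldp. rewrite !fold1_id by auto. destruct x; reflexivity. Qed.

(** The window is centred so that every finite set is eventually inside it. *)
Definition periodize (M : nat) (t : config) : config := fun x => t (foldp M x).

Lemma periodize_per2 M t : per2 (2 * M) (periodize M t).
Proof.
  split; intros b a; unfold periodize, foldp; cbn [fst snd]; rewrite (fold1_periodic M a); auto.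
Qed.

Lemma per2_fold M (s : config) x : per2 (2 * M) s -> (0 < M)%nat -> s (foldp M x) = s x.
Proof.
  intros [H1 H2] HM. destruct x as [a b]. unfold foldp; cbn [fst snd].
  assert (E : forall u, exists q, (u = fold1 M u + q * Z.of_nat (2 * M))%Z).
  { intros u. exists ((u + Z.of_nat M) / Z.of_nat (2 * M))%Z. unfold fold1.
    pose proof (Z.div_mod (u + Z.of_nat M) (Z.of_nat (2 * M))). lia. }
  destruct (E a) as [q Hq], (E b) as [r Hr].
  rewrite Hq at 2. rewrite (periodic_mul (2 * M) (fun a => s (a, b)) q) by auto.
  rewrite Hr at 2. rewrite (periodic_mul (2 * M) (fun b => s (fold1 M a, b)) r); auto.
Qed.

Lemma in_window_cover (l : list site) : exists M0, forall M, (M0 <= M)%nat -> forall x, In x l ->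
  in_window M x.
Proof.
  destruct (box_cover l) as [L HL]. exists (S L). intros M HM x Hx.
  specialize (HL L (le_n L) x Hx). apply in_box in HL. rewrite !in_zrange in HL.
  unfold in_window; lia.
Qed.

Lemma psum2_window M (F : site -> R) : per2 (2 * M) F ->
  exists W, NoDup W /\ (forall x, In x W <-> in_window M x) /\ psum2 (2 * M) F = sumR F W.
Proof.
  intros HF.
  set (I := map (fun i => (Z.of_nat i - Z.of_nat M)%Z) (seq 0 (2 * M))).
  assert (HI : NoDup I).
  { apply FinFun.Injective_map_NoDup; [intros x y; lia | apply seq_NoDup]. }
  assert (HIn : forall u, In u I <-> (- Z.of_nat M <= u < Z.of_nat M)%Z).
  { intros u; unfold I; rewrite in_map_iff; split.
    - intros (i & <- & Hi). apply in_seq in Hi. lia.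
    - intros H. exists (Z.to_nat (u + Z.of_nat M)). rewrite in_seq. lia. }
  exists (list_prod I I). split; [apply NoDup_list_prod; auto|]. split.
  - intros [a b]. rewrite (in_prod_iff I I a b), !HIn. unfold in_window; simpl; tauto.
  - rewrite <- (psum2_shift (2 * M) F (- Z.of_nat M) (- Z.of_nat M) HF).
    rewrite (sumR_list_prod (A := Z) (B := Z)). unfold psum2, I. rewrite psum_swap, sumR_map.
    unfold psum. apply sumR_ext; intros i. rewrite sumR_map. reflexivity.
Qed.

Definition ne_diff (t s : config) (x y : site) : R := ne (t x) (t y) - ne (s x) (s y).

Lemma ne_diff_bound t s x y : Rabs (ne_diff t s x y) <= 1.
Proof.
  unfold ne_diff. pose proof (ne_bounds (t x) (t y)). pose proof (ne_bounds (s x) (s y)).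
  apply Rabs_le; lra.
Qed.

Definition back (x n : site) : site := ((fst x - fst n)%Z, (snd x - snd n)%Z).

(** Change of the ordered pairs of displacement [n] that touch a perturbed site [x]: the pair
    leaving [x], and the pair arriving at [x] unless its origin is itself perturbed ([chi]) and
    already counts it. With [chi] as a parameter, torus and plane share the formula. *)
Definition local_diff (chi : site -> bool) (t s : config) (x n : site) : R :=
  ne_diff t s x (shift x n) + (if chi (back x n) then 0 else ne_diff t s x (back x n)).

Lemma local_diff_bound chi t s x n : Rabs (local_diff chi t s x n) <= 2.
Proof.
  unfold local_diff. eapply Rle_trans; [apply Rabs_triang|].
  pose proof (ne_diff_bound t s x (shift x n)). pose proof (ne_diff_bound t s x (back x n)).
  destruct (chi _); [rewrite Rabs_R0|]; lra.
Qed.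

(** Pairs with both ends off the perturbation are unchanged. Those whose second end alone is
    perturbed are translated by [n], so that all remaining pairs are indexed by [X]. *)
Lemma mismatch2_diff M (t s : config) X n : (0 < M)%nat -> per2 (2 * M) s -> NoDup X ->
  (forall x, In x X -> in_window M x) -> (forall x, ~ In x X -> t x = s x) ->
  mismatch2 (2 * M) (periodize M t) n - mismatch2 (2 * M) s n =
  sumR (fun x => local_diff (fun y => memb (foldp M y) X) (periodize M t) s x n) X.
Proof.
  intros HM Hs HX HXw Ht. set (tl := periodize M t). set (chi := fun y => memb (foldp M y) X).
  assert (Htl : forall x, chi x = false -> tl x = s x).
  { intros x Hx. unfold tl, periodize. rewrite Ht, per2_fold; auto.
    rewrite <- memb_iff. unfold chi in Hx. rewrite Hx; discriminate. }
  pose proof (periodize_per2 M t) as Htp. fold tl in Htp.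
  assert (Hchi : forall b, periodic (2 * M) (fun a => chi (a, b)) /\ periodic (2 * M)
    (fun a => chi (b, a))).
  { intros b; split; intros a; unfold chi, foldp; cbn [fst snd]; rewrite (fold1_periodic M a); auto.
    }
  assert (Hper : forall u v, per2 (2 * M) (fun x => ne (tl x) (tl ((fst x + u)%Z, (snd x + v)%Z))
    - ne (s x) (s ((fst x + u)%Z, (snd x + v)%Z)))).
  { intros u v. destruct Htp as [T1 T2], Hs as [S1 S2]. split; intros y x; cbn [fst snd].
    - replace (x + Z.of_nat (2 * M) + u)%Z with (x + u + Z.of_nat (2 * M))%Z by lia.
      rewrite !(T1 _ _), !(S1 _ _). reflexivity.
    - replace (x + Z.of_nat (2 * M) + v)%Z with (x + v + Z.of_nat (2 * M))%Z by lia.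
      rewrite !(T2 _ _), !(S2 _ _). reflexivity. }
  assert (E1 : mismatch2 (2 * M) tl n - mismatch2 (2 * M) s n =
     psum2 (2 * M) (fun x => if chi x then ne_diff tl s x (shift x n) else 0)
     + psum2 (2 * M) (fun x => if chi x then 0 else if chi (shift x n)
         then ne_diff tl s x (shift x n) else 0)).
  { unfold Rminus, mismatch2. rewrite <- (Rmult_1_l (psum2 _ (fun x => ne (s x) _))),
      Ropp_mult_distr_l, <- psum2_scal, <- !psum2_plus.
    apply psum2_ext; intros x. fold (shift x n).
    destruct (chi x) eqn:Ex; [unfold ne_diff; ring|].
    destruct (chi (shift x n)) eqn:Ey; [unfold ne_diff; ring|].
    rewrite (Htl x Ex), (Htl _ Ey). ring. }
  set (F2 := fun y => if chi y then (if chi (back y n) then 0 else ne_diff tl s y (back y n))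
    else 0).
  assert (HF2 : per2 (2 * M) F2).
  { pose proof (Hper (- fst n)%Z (- snd n)%Z) as [P1 P2].
    split; intros y x; unfold F2, ne_diff, back.
    - pose proof (P1 y x) as P. cbn [fst snd] in *.
      destruct (Hchi y) as [C1 _]. rewrite (C1 x).
      replace (x + Z.of_nat (2 * M) - fst n)%Z with (x - fst n + Z.of_nat (2 * M))%Z by lia.
      destruct (Hchi (y - snd n)%Z) as [C2 _]. rewrite (C2 (x - fst n)%Z).
      destruct Htp as [T1 T2], Hs as [S1 S2]. rewrite !(T1 _ _), !(S1 _ _). reflexivity.
    - cbn [fst snd] in *.
      destruct (Hchi y) as [_ C1]. rewrite (C1 x).
      replace (x + Z.of_nat (2 * M) - snd n)%Z with (x - snd n + Z.of_nat (2 * M))%Z by lia.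
      destruct (Hchi (y - fst n)%Z) as [_ C2]. rewrite (C2 (x - snd n)%Z).
      destruct Htp as [T1 T2], Hs as [S1 S2]. rewrite !(T2 _ _), !(S2 _ _). reflexivity. }
  assert (E2 : psum2 (2 * M) (fun x => if chi x then 0 else if chi (shift x n)
    then ne_diff tl s x (shift x n) else 0) = psum2 (2 * M) F2).
  { rewrite <- (psum2_shift (2 * M) F2 (fst n) (snd n) HF2). apply psum2_ext; intros [a b].
    unfold F2. fold (shift (a, b) n).
    assert (Eb : back (shift (a, b) n) n = (a, b)).
    { unfold back, shift; cbn [fst snd]; f_equal; lia. }
    rewrite Eb. destruct (chi (a, b)), (chi (shift (a, b) n)); auto.
    unfold ne_diff. rewrite (ne_sym (tl (a, b))), (ne_sym (s (a, b))); auto. }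
  rewrite E1, E2, <- psum2_plus.
  set (F := fun x => (if chi x then ne_diff tl s x (shift x n) else 0) + F2 x).
  assert (HF : per2 (2 * M) F).
  { destruct HF2 as [Q1 Q2]. pose proof (Hper (fst n) (snd n)) as [P1 P2].
    split; intros y x; unfold F.
    - rewrite (Q1 y x). destruct (Hchi y) as [C1 _]. rewrite (C1 x). unfold ne_diff, shift.
      pose proof (P1 y x) as P. cbn [fst snd] in *. rewrite P. reflexivity.
    - rewrite (Q2 y x). destruct (Hchi y) as [_ C1]. rewrite (C1 x). unfold ne_diff, shift.
      pose proof (P2 y x) as P. cbn [fst snd] in *. rewrite P. reflexivity. }
  destruct (psum2_window M F HF) as (W & HWn & HWi & EW). rewrite EW.
  rewrite (sumR_ext_in F (fun x => if memb x X then local_diff chi tl s x n else 0)).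
  - rewrite sumR_memb_swap by auto. apply sumR_ext_in; intros x Hx.
    rewrite (proj2 (memb_iff x W)); auto. apply HWi; auto.
  - intros x Hx. unfold F, F2, local_diff. assert (Ec : chi x = memb x X).
    { unfold chi. rewrite foldp_id; auto. apply HWi; auto. }
    rewrite Ec. destruct (memb x X); ring.
Qed.

Lemma coupling_opp p J a b : coupling p J ((- a)%Z, (- b)%Z) = coupling p J (a, b).
Proof.
  unfold coupling. rewrite weight_opp_fst, weight_swap, weight_opp_fst, weight_swap.
  unfold dist2, zero_site; cbn [fst snd]. replace ((- a - 0) ^ 2 + (- b - 0) ^ 2)%Z with
    ((a - 0) ^ 2 + (b - 0) ^ 2)%Z by ring.
  reflexivity.
Qed.

Lemma summable_coupling_Rabs p J (c : site -> R) C : 4 < p -> (forall n, Rabs (c n) <= C) ->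
  summable (fun n => coupling p J n * c n).
Proof.
  intros Hp Hc. apply summable_coupling with C; auto. intros n Hn. specialize (Hc n).
  pose proof (norm2_ge_1 n Hn). pose proof (Rabs_pos (c n)). nra.
Qed.

(** The factor 2 of [bmult] on a pair leaving [X] splits into one outgoing and one incoming ordered
    pair, the latter by the symmetry n -> - n of [coupling]. *)
Lemma H_X_diff p J X t s : 4 < p -> NoDup X -> (forall y, ~ In y X -> t y = s y) ->
  H_X p J X t s - H_X p J X s s =
  zsum (fun n => coupling p J n * sumR (fun x => local_diff (fun y => memb y X) t s x n) X).
Proof.
  intros Hp HX Ht. rewrite !H_X_eq, <- sumR_minus by auto.
  rewrite (zsum_ext _ (fun n => sumR (fun x => coupling p J n
    * local_diff (fun y => memb y X) t s x n) X))
    by (intros; rewrite sumR_scal; auto).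
  rewrite zsum_sumR.
  2:{ intros x _. apply summable_coupling_Rabs with 2; auto using local_diff_bound. }
  apply sumR_ext_in; intros x Hx.
  assert (Hb : forall (u : config) n, Rabs (ne (u x) (u (shift x n)) * bmult X (shift x n)) <= 2).
  { intros u n. pose proof (ne_bounds (u x) (u (shift x n))).
    pose proof (bmult_bounds X (shift x n)).
    rewrite Rabs_pos_eq by nra. nra. }
  rewrite <- zsum_minus by (apply summable_coupling_Rabs with 2; auto).
  set (A := fun n => coupling p J n * ne_diff t s x (shift x n)).
  set (B := fun n => coupling p J n * (if memb (shift x n)
    X then 0 else ne_diff t s x (shift x n))).
  assert (HA : summable A).
  { apply (summable_coupling_Rabs p J (fun n => ne_diff t s x (shift x n)) 1); auto.
    intros; apply ne_diff_bound. }
  assert (HB : summable B).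
  { apply (summable_coupling_Rabs p J (fun n => if memb (shift x n)
      X then 0 else ne_diff t s x (shift x n)) 1); auto.
    intros; destruct (memb _ X); [rewrite Rabs_R0; lra | apply ne_diff_bound]. }
  set (r := fun n : site => ((- fst n)%Z, (- snd n)%Z) : site).
  assert (Hr : forall n, r (r n) = n) by (intros [a b]; unfold r; simpl; f_equal; lia).
  transitivity (zsum A + zsum B).
  - rewrite <- zsum_plus by auto. apply zsum_ext; intros n. unfold A, B, ne_diff, bmult.
    destruct (memb (shift x n) X); ring.
  - rewrite <- (zsum_bij r r B) by auto. rewrite <- zsum_plus; auto.
    + apply zsum_ext; intros n. unfold A, B, local_diff.
      assert (Es : shift x (r n) = back x n) by
        (unfold shift, back, r; cbn [fst snd]; f_equal; lia).
      rewrite Es. destruct n as [a b]. unfold r; cbn [fst snd]. rewrite coupling_opp. ring.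
    + apply (summable_inj r B); auto. intros u v Huv. rewrite <- (Hr u), <- (Hr v), Huv; auto.
Qed.

(** Dominated convergence in the displacement: each [local_diff] is bounded by 2, and for fixed [n]
    the windows eventually contain [X], X + n and X - n, where the torus and plane expressions
    coincide. *)
Lemma energy_diff_lim p J X t s (M : nat -> nat) : 4 < p -> NoDup X ->
  (forall y, ~ In y X -> t y = s y) ->
  (forall m, (m < M m)%nat) -> (forall m, per2 (2 * M m) s) ->
  is_lim_seq (fun m => energy p J (2 * M m) (periodize (M m) t) - energy p J (2 * M m) s)
    (H_X p J X t s - H_X p J X s s).
Proof.
  intros Hp HX Ht HM Hs. rewrite H_X_diff by auto.
  destruct (in_window_cover X) as [m0 Hm0].
  assert (Hwin : forall l : list site, exists m1, forall m, (m1 <= m)%nat -> forall x, In x l ->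
    in_window (M m) x).
  { intros l. destruct (in_window_cover l) as [m1 H1]. exists m1; intros m Hm. apply H1.
    specialize (HM m); lia. }
  destruct (Hwin X) as [m1 H1].
  apply (is_lim_seq_incr_n _ m1).
  apply is_lim_seq_ext with (fun m => zsum (fun n => coupling p J n *
     sumR (fun x => local_diff (fun y => memb (foldp (M (m + m1)%nat) y) X)
       (periodize (M (m + m1)%nat) t) s x n) X)).
  - intros m. set (K := M (m + m1)%nat). unfold energy.
    assert (HK : (0 < K)%nat) by (specialize (HM (m + m1)%nat); unfold K; lia).
    rewrite <- zsum_minus.
    + apply zsum_ext; intros n. rewrite <- mismatch2_diff; auto; [ring | apply Hs | apply H1; lia].
    + apply summable_coupling_bounded with (INR (2 * K) ^ 2); auto. intros; apply mismatch2_bounds.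
    + apply summable_coupling_bounded with (INR (2 * K) ^ 2); auto. intros; apply mismatch2_bounds.
  - set (C := INR (length X) * 2).
    assert (Hbd : forall chi u n, Rabs (sumR (fun x => local_diff chi u s x n) X) <= C).
    { intros chi u n. eapply Rle_trans; [apply sumR_Rabs|]. unfold C. rewrite <- sumR_const.
      apply sumR_le_in; intros; apply local_diff_bound. }
    apply zsum_dominated with (fun n => Rabs (coupling p J n * C)).
    + apply summable_Rabs, summable_coupling_Rabs with (Rabs C); auto. intros; lra.
    + intros m n. rewrite !Rabs_mult. apply Rmult_le_compat_l; [apply Rabs_pos|].
      eapply Rle_trans; [apply Hbd|]. apply Rle_abs.
    + intros n.
      destruct (Hwin (X ++ map (fun x => shift x n) X ++ map (fun x => back x n) X)) as [m2 H2].
      apply is_lim_seq_ext_loc with (fun _ => coupling p J n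
        * sumR (fun x => local_diff (fun y => memb y X) t s x n) X);
        [|apply is_lim_seq_const].
      exists m2. intros m Hm. f_equal. apply sumR_ext_in; intros x Hx.
      assert (Hw : in_window (M (m + m1)%nat) x /\ in_window (M (m + m1)%nat) (shift x n) /\
        in_window (M (m + m1)%nat) (back x n)).
      { split; [|split]; (apply H2; [lia|]); rewrite !in_app_iff.
        - auto.
        - right; left. apply (in_map (fun x => shift x n)); auto.
        - right; right. apply (in_map (fun x => back x n)); auto. }
      destruct Hw as (W1 & W2 & W3).
      unfold local_diff, ne_diff, periodize. rewrite !foldp_id; auto.
Qed.

(** * Striped states and the cost of perturbing them *)

Lemma iter_rot k : (forall x, Nat.iter k rot x = x) \/
  (forall x, Nat.iter k rot x = ((- snd x)%Z, fst x)) \/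
  (forall x, Nat.iter k rot x = ((- fst x)%Z, (- snd x)%Z)) \/
    (forall x, Nat.iter k rot x = (snd x, (- fst x)%Z)).
Proof.
  induction k as [|k [H|[H|[H|H]]]].
  - left; auto.
  - right; left; intros x; simpl; rewrite H; auto.
  - right; right; left; intros x; simpl; rewrite H; auto.
  - right; right; right; intros x; simpl; rewrite H; unfold rot; simpl; f_equal; lia.
  - left; intros [a b]; simpl; rewrite H; unfold rot; simpl; f_equal; lia.
Qed.

(** The one-dimensional profiles of the transformed stripes: translates of [st h], reflected for
    some of the rotations. *)
Definition profile (h : nat) (f : Z -> bool) : Prop :=
  exists c, (forall u, f u = st h (u + c)) \/ (forall u, f u = st h (- u + c)).

Lemma transf_profile h k a : exists f, profile h f /\
  ((forall x, transf k a (stripe h) x = f (fst x)) \/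
    (forall x, transf k a (stripe h) x = f (snd x))).
Proof.
  assert (E : forall x, transf k a (stripe h) x = st h (fst (Nat.iter k rot x) + fst a)) by
    reflexivity.
  destruct (iter_rot k) as [H|[H|[H|H]]].
  - exists (fun u => st h (u + fst a)). split; [exists (fst a); auto|].
    left; intros x; rewrite E, H; auto.
  - exists (fun u => st h (- u + fst a)). split; [exists (fst a); auto|].
    right; intros x; rewrite E, H; auto.
  - exists (fun u => st h (- u + fst a)). split; [exists (fst a); auto|].
    left; intros x; rewrite E, H; auto.
  - exists (fun u => st h (u + fst a)). split; [exists (fst a); auto|].
    right; intros x; rewrite E, H; auto.
Qed.

Lemma profile_periodic h f : (0 < h)%nat -> profile h f -> periodic (2 * h) f.
Proof.
  intros Hh [c [H|H]] x; rewrite !H.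
  - rewrite <- (st_periodic h Hh (x + c)%Z). f_equal; lia.
  - rewrite <- (st_periodic h Hh (- (x + Z.of_nat (2 * h)) + c)%Z). f_equal; lia.
Qed.

Lemma profile_mismatch h f k : (0 < h)%nat -> profile h f -> mismatch (2 * h) f k =
  mismatch (2 * h) (st h) k.
Proof.
  intros Hh [c Hc].
  assert (P : forall j, periodic (2 * h) (fun x => ne (st h x) (st h (x + j)%Z))).
  { intros j x. replace (x + Z.of_nat (2 * h) + j)%Z with (x + j + Z.of_nat (2 * h))%Z by lia.
    rewrite !(st_periodic h Hh _). reflexivity. }
  destruct Hc as [H|H].
  - unfold mismatch. rewrite <- (psum_shift _ (fun x => ne (st h x) (st h (x + k)%Z)) c) by apply P.
    apply psum_ext; intros x. rewrite !H. do 2 f_equal; lia.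
  - rewrite <- (mismatch_opp (2 * h) (st h)) by (apply st_periodic; auto). unfold mismatch.
    rewrite <- (psum_shift _ (fun x => ne (st h x) (st h (x + - k)%Z)) c) by apply P.
    rewrite <- (psum_opp _ (fun x => ne (st h (x + c)%Z) (st h (x + c + - k)%Z))).
    + apply psum_ext; intros x. rewrite !H. do 2 f_equal; lia.
    + intros x. pose proof (P (- k)%Z (x + c)%Z) as Px. cbv beta in Px.
      replace (x + Z.of_nat (2 * h) + c)%Z with (x + c + Z.of_nat (2 * h))%Z by lia. exact Px.
Qed.

Lemma periodic_multiple {A} P m (f : Z -> A) : periodic P f -> periodic (m * P) f.
Proof. intros Hf x. rewrite Nat2Z.inj_mul. apply periodic_mul; auto. Qed.

Lemma mismatch_multiple P m f k : periodic P f -> mismatch (m * P) f k = INR m * mismatch P f k.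
Proof.
  intros Hf. apply psum_multiple. intros x.
  replace (x + Z.of_nat P + k)%Z with (x + k + Z.of_nat P)%Z by lia. rewrite !(Hf _). reflexivity.
Qed.

Lemma stripes_per2 h m s f : (0 < h)%nat -> profile h f ->
  ((forall x, s x = f (fst x)) \/ (forall x, s x = f (snd x))) -> per2 (m * (2 * h)) s.
Proof.
  intros Hh Hf Hs. pose proof (periodic_multiple _ m _ (profile_periodic h f Hh Hf)) as Hp.
  destruct Hs as [Hs|Hs]; split; intros y x; rewrite !Hs; cbn [fst snd]; auto.
Qed.

Lemma stripes_energy p J h m s f : 4 < p -> (0 < h)%nat -> profile h f ->
  ((forall x, s x = f (fst x)) \/ (forall x, s x = f (snd x))) ->
  energy p J (m * (2 * h)) s = INR (m * (2 * h)) ^ 2 * e_s p J h.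
Proof.
  intros Hp Hh Hf Hs. pose proof (profile_periodic h f Hh Hf) as Hfp.
  set (L := (m * (2 * h))%nat).
  assert (HhR : 0 < INR h) by (apply lt_0_INR; auto).
  assert (E : energy p J L s = zsum (fun n : site => INR L * INR m
    * (coupling p J n * mismatch (2 * h) (st h) (fst n)))).
  { assert (Eps : forall n : site, psum2 L (fun x => ne (f (fst x)) (f (fst x + fst n)%Z)) = INR L
      * INR m * mismatch (2 * h) (st h) (fst n)).
    { intros n. unfold psum2; cbn [fst snd]. rewrite psum_const. rewrite Rmult_assoc. f_equal.
      change (mismatch L f (fst n) = INR m * mismatch (2 * h) (st h) (fst n)). unfold L.
      rewrite mismatch_multiple, (profile_mismatch h f); auto. }
    destruct Hs as [Hs|Hs].
    - apply zsum_ext; intros n.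
      rewrite (Rmult_comm (coupling p J n) (mismatch _ _ _)), <- Rmult_assoc, <- Eps, Rmult_comm.
      f_equal.
      apply psum2_ext; intros x. rewrite !Hs; reflexivity.
    - unfold energy. rewrite <- (zsum_bij swap swap (fun n => coupling p J n * mismatch2 L s n));
        auto using swap_swap.
      + apply zsum_ext; intros [u v].
        rewrite (Rmult_comm (coupling p J (u, v)) (mismatch _ _ _)), <- Rmult_assoc, <- Eps,
          Rmult_comm.
        unfold swap; cbn [fst snd]. rewrite coupling_swap. f_equal.
        unfold mismatch2. rewrite <- psum2_swap. apply psum2_ext; intros x.
        rewrite !Hs; reflexivity.
      + apply summable_coupling_bounded with (INR L ^ 2); auto using mismatch2_bounds. }
  rewrite E, zsum_scal, e_s_eq by (auto; apply summable_coupling_bounded with (INR (2 * h)); auto;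
    intros; apply mismatch_bounds).
  unfold L. rewrite !mult_INR. simpl (INR 2). field; lra.
Qed.

(** On the column of a perturbed site there is a place where [t] stops differing from [s]; since [s]
    is constant along columns, [t] has a horizontal wall there. Without corners this wall would
    extend to the right beyond [X], where [t] equals [s] and has no such wall. *)
Lemma perturbation_corner_vertical t s X (f : Z -> bool) : (forall x, s x = f (fst x)) ->
  (forall x, ~ In x X -> t x = s x) -> (exists x, t x <> s x) -> exists x, corner t x = true.
Proof.
  intros Hs HX [[a b] Hz]. apply NNPP; intros Hno.
  assert (Hc : forall x, corner t x = false).
  { intros x; destruct (corner t x) eqn:E; auto. exfalso; eauto. }
  destruct (box_cover X) as [L HL].
  assert (Hout : forall x, ~ In x (box L) -> t x = s x).
  { intros x Hx. apply HX. intros Hi. apply Hx, (HL L); auto. }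
  assert (Hy : exists n, t (a, b + Z.of_nat n)%Z <> s (a, b + Z.of_nat n)%Z /\
                         t (a, b + Z.of_nat n + 1)%Z = s (a, b + Z.of_nat n + 1)%Z).
  { apply NNPP; intros Hn.
    assert (Hall : forall n, t (a, b + Z.of_nat n)%Z <> s (a, b + Z.of_nat n)%Z).
    { induction n as [|n IH]; [rewrite Z.add_0_r; auto|]. intros E. apply Hn. exists n; split; auto.
      replace (b + Z.of_nat n + 1)%Z with (b + Z.of_nat (S n))%Z by lia. auto. }
    apply (Hall (Z.abs_nat b + S L)%nat). apply Hout. rewrite in_box, !in_zrange; cbn [fst snd].
    lia. }
  destruct Hy as (n & H1 & H2). set (y := (b + Z.of_nat n)%Z) in *.
  assert (Hw : t (a, y) <> t (a, y + 1)%Z).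
  { rewrite H2, Hs; cbn [fst]. rewrite Hs in H1; cbn [fst] in H1. auto. }
  destruct (wall_extends_n t a y (Z.abs_nat a + S L) Hw) as [E1 E2]; [auto|].
  apply Hw. rewrite <- E1, <- E2. rewrite !Hout, !Hs; auto; rewrite in_box, !in_zrange;
    cbn [fst snd]; lia.
Qed.

Lemma perturbation_corner t s X (f : Z -> bool) :
  ((forall x, s x = f (fst x)) \/ (forall x, s x = f (snd x))) ->
  (forall x, ~ In x X -> t x = s x) -> (exists x, t x <> s x) -> exists x, corner t x = true.
Proof.
  intros [Hs|Hs] HX Hne.
  - apply (perturbation_corner_vertical t s X f); auto.
  - destruct (perturbation_corner_vertical (transpose t) (transpose s) (map swap X) f) as [x Hx];
      auto.
    + intros x. unfold transpose. rewrite Hs; reflexivity.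
    + intros x Hx. unfold transpose. apply HX. intros Hi. apply Hx.
      rewrite <- (swap_swap x). apply in_map; auto.
    + destruct Hne as [x Hx]. exists (swap x). unfold transpose. rewrite swap_swap; auto.
    + exists (swap x). rewrite <- corner_transpose; auto.
Qed.

Lemma ncorner_nonneg L s : 0 <= ncorner L s.
Proof. apply psum2_nonneg; intros x. destruct (corner s x); lra. Qed.

Lemma ncorner_periodize (t : config) x : corner t x = true ->
  exists m0, forall M, (m0 <= M)%nat -> 1 <= ncorner (2 * M) (periodize M t).
Proof.
  intros Hx. destruct x as [a b].
  destruct (in_window_cover (((a, b) :: (a + 1, b) :: (a - 1, b) :: (a, b + 1) :: (a, b - 1) ::
    nil)%Z : list site)) as [m0 Hm0].
  exists m0; intros M HM.
  assert (Hw : forall y, In y (((a, b) :: (a + 1, b) :: (a - 1, b) :: (a, b + 1) :: (a, b - 1) ::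
    nil)%Z : list site) ->
     periodize M t y = t y /\ in_window M y).
  { intros y Hy. specialize (Hm0 M HM y Hy). unfold periodize. rewrite foldp_id; auto. }
  assert (Hc : corner (periodize M t) (a, b) = true).
  { unfold corner in *. rewrite !(fun y Hy => proj1 (Hw y Hy)) by (simpl; tauto). auto. }
  unfold ncorner.
  destruct (psum2_window M (fun x => if corner (periodize M t) x then 1 else 0))
    as (W & _ & HWi & ->).
  { apply corner_per2, periodize_per2. }
  replace 1 with ((fun x => if corner (periodize M t) x then 1 else 0) (a, b)) at 1 by
    (rewrite Hc; auto).
  apply (sumR_term_le (fun x => if corner (periodize M t) x then 1 else 0)).
  - intros y _. destruct (corner _ y); lra.
  - apply HWi. apply Hw. simpl; auto.
Qed.

(** The torus sides are multiples of the stripe period, so the energy of [s] is exactly the constant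
    in [energy_lower] and the difference is at least W per corner. A corner of [t] persists in all
    large tori, hence the gap W persists in the limit. *)
Lemma perturbation_energy p J h A s f t X : 4 < p -> (0 < h)%nat -> (0 < A)%nat -> J < Jc p ->
  (forall h', (0 < h')%nat -> e_s p J h <= e_s p J h') ->
  INR A * e_s p J h <= -4 * (Jc p - J) ->
  8 * (Jc p - J) * INR (S A) <= Rpower 2 (- (p / 2)) ->
  profile h f -> ((forall x, s x = f (fst x)) \/ (forall x, s x = f (snd x))) ->
  NoDup X -> (forall x, ~ In x X -> t x = s x) ->
  0 <= H_X p J X t s - H_X p J X s s /\
  ((exists x, t x <> s x) -> 0 < H_X p J X t s - H_X p J X s s).
Proof.
  intros Hp Hh HA HJ Hmin HAe HA8 Hf Hs HX Ht.
  set (W := Rpower 2 (- (p / 2))) in *. assert (HW : 0 < W) by apply exp_pos.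
  set (M := fun m => ((m + 1) * h)%nat).
  assert (EM : forall m, (2 * M m = (m + 1) * (2 * h))%nat) by (intros m; unfold M; lia).
  assert (HM : forall m, (m < M m)%nat) by (intros m; unfold M; nia).
  assert (Hper : forall m, per2 (2 * M m) s) by
    (intros m; rewrite EM; apply stripes_per2 with f; auto).
  pose proof (energy_diff_lim p J X t s M Hp HX Ht HM Hper) as Hlim.
  assert (Hlow : forall m, W * ncorner (2 * M m) (periodize (M m) t) <=
      energy p J (2 * M m) (periodize (M m) t) - energy p J (2 * M m) s).
  { intros m. assert (HL : (0 < 2 * M m)%nat) by (specialize (HM m); lia).
    pose proof (energy_lower p J (2 * M m) (periodize (M m) t) A (e_s p J h) Hp HL
      (periodize_per2 (M m) t) HA HJ Hmin HAe HA8) as HE.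
    rewrite EM in HE |- *. rewrite (stripes_energy p J h (m + 1) s f) by auto. fold W in HE. lra. }
  split.
  - apply (is_lim_seq_le (fun _ => 0) _ 0 (H_X p J X t s - H_X p J X s s)) with
      (2 := is_lim_seq_const 0) (3 := Hlim).
    intros m. pose proof (ncorner_nonneg (2 * M m) (periodize (M m) t)). specialize (Hlow m). nra.
  - intros Hne. destruct (perturbation_corner t s X f Hs Ht Hne) as [x Hx].
    destruct (ncorner_periodize t x Hx) as [m0 Hm0].
    apply Rlt_le_trans with W; auto.
    apply (is_lim_seq_incr_n _ m0) in Hlim.
    apply (is_lim_seq_le (fun _ => W) _ W (H_X p J X t s - H_X p J X s s)) with
      (2 := is_lim_seq_const W) (3 := Hlim).
    intros m. assert (Hle : (m0 <= M (m + m0)%nat)%nat) by (specialize (HM (m + m0)%nat); lia).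
    specialize (Hm0 _ Hle). specialize (Hlow (m + m0)%nat). nra.
Qed.

Theorem theorem1 (p : R) (hp : 4 < p) :
  exists eps : R, 0 < eps /\
  forall J : R, 0 < J -> Jc p - eps < J < Jc p ->
  forall h : nat, (0 < h)%nat ->
  (forall h' : nat, (0 < h')%nat -> e_s p J h <= e_s p J h') ->
  forall (k : nat) (a : site),
    ground_state p J (transf k a (stripe h)) /\
    (forall t : config, ground_state p J t ->
       differ_finitely (transf k a (stripe h)) t ->
       forall x, t x = transf k a (stripe h) x).
Proof.
  destruct (width_scale_exists p hp) as (eps & Heps & Hscale).
  exists eps; split; auto. intros J _ HJ h Hh Hmin k a.
  destruct (Hscale J (e_s p J h) HJ Hmin) as (A & HA & HAe & HA8).
  destruct (transf_profile h k a) as (f & Hf & Hs).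
  set (s := transf k a (stripe h)) in *.
  assert (Hpert : forall t X, NoDup X -> (forall x, ~ In x X -> t x = s x) ->
    0 <= H_X p J X t s - H_X p J X s s /\ ((exists x, t x <> s x) -> 0 < H_X p J X t s
      - H_X p J X s s)).
  { intros t X HX Ht. apply (perturbation_energy p J h A s f); auto; lra. }
  split.
  - intros X HX sg.
    (* [H_X] reads [sg] only on [X], so [sg] is replaced by its extension by [s]. *)
    set (t := fun x => if memb x X then sg x else s x).
    destruct (Hpert t X HX) as [H0 _].
    { intros x Hx. unfold t. destruct (memb x X) eqn:E; auto. apply memb_iff in E; tauto. }
    rewrite (H_X_ext p J X sg t s s); [lra | | auto].
    intros x Hx. unfold t. rewrite (proj2 (memb_iff x X) Hx); auto.
  - intros t Ht [l Hl]. apply NNPP; intros Hne.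
    assert (Hex : exists x, t x <> s x).
    { apply not_all_ex_not in Hne. destruct Hne as [x Hx]; exists x; auto. }
    destruct (NoDup_cover l) as (X & HX & HlX).
    assert (Hoff : forall x, ~ In x X -> t x = s x).
    { intros x Hx. apply NNPP; intros Hd. apply Hx, HlX, Hl. auto. }
    destruct (Hpert t X HX Hoff) as [_ Hpos]. specialize (Hpos Hex).
    (* The ground state [t] is tested against [s]. Both agree off [X], so the boundary condition [t]
       may be exchanged for [s], which contradicts [Hpos]. *)
    specialize (Ht X HX s).
    rewrite (H_X_ext p J X s s t s), (H_X_ext p J X t t t s) in Ht; auto. lra.
Qed.
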